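(* Let $\Lambda$ be a row-finite $k$-graph with no sources and let $K$ be a field. The following conditions are equivalent. (1) $\mathrm{KP}_K(\Lambda)$ is semisimple. (2) There exist a countable set $\Upsilon$ and, for each $i\in\Upsilon$, an $n_i\in\mathbb N\cup\{\infty\}$ such that $\mathrm{KP}_K(\Lambda)\cong\bigoplus_{i\in\Upsilon}M_{n_i}(K)$. (3) There exist a countable set $\Upsilon$ and, for each $i\in\Upsilon$, an $n_i\in\mathbb N\cup\{\infty\}$ such that $V(\mathrm{KP}_K(\Lambda))\cong\bigoplus_{i\in\Upsilon}\mathbb N$, and $\mathrm{KP}_K(\Lambda)$ is von Neumann regular. (4) The monoid $V(\mathrm{KP}_K(\Lambda))$ is cancellative and atomic, and $\mathrm{KP}_K(\Lambda)$ is von Neumann regular. (5) For every $y\in\Lambda^\infty$ there exists $m\in\mathbb N^k$ such that $y(m)\in P_l(\Lambda)$.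
   Context: $\mathbb N=\{0,1,2,\dots\}$; $k$ is a positive integer; $\mathbb N^k$ is ordered coordinatewise. A $k$-graph is a countable category $\Lambda$ with object set $\Lambda^0$ and range and source maps $r,s$, with a functor $d:\Lambda\to\mathbb N^k$ ($\mathbb N^k$ viewed as a one-object category) such that whenever $d(\lambda)=m+n$ there are unique $\mu,\nu\in\Lambda$ with $s(\mu)=r(\nu)$, $d(\mu)=m$, $d(\nu)=n$, $\lambda=\mu\nu$. Morphisms are called paths; objects (vertices) are identified with the paths of degree $0$. $\Lambda^n=d^{-1}(n)$, $\Lambda^{\neq 0}=\Lambda\setminus\Lambda^0$, $v\Lambda=\{\lambda: r(\lambda)=v\}$, $v\Lambda^n=v\Lambda\cap\Lambda^n$. $\Lambda$ is row-finite with no sources if $0<|v\Lambda^n|<\infty$ for all $v\in\Lambda^0$, $n\in\mathbb N^k$. Infinite paths: $\Omega_k$ is the $k$-graph with objects $\mathbb N^k$, morphisms $(m,n)$ with $m\le n$, $r(m,n)=m$, $s(m,n)=n$, $(m,n)(n,p)=(m,p)$, $d(m,n)=n-m$. $\Lambda^\infty$ is the set of degree-preserving functors $x:\Omega_k\to\Lambda$; $x(m):=x(m,m)$; $v\Lambda^\infty=\{x\in\Lambda^\infty:x(0)=v\}$. For $p\in\mathbb N^k$, $\sigma^p(x)(m,n)=x(m+p,n+p)$. $x$ is periodic if $\sigma^p(x)=\sigma^q(x)$ for some $p\ne q$ in $\mathbb N^k$, and aperiodic otherwise. A vertex $v$ is a line point if $v\Lambda^\infty=\{x\}$ is a singleton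 and $x$ is aperiodic; $P_l(\Lambda)$ is the set of line points. Kumjian-Pask algebra: $\mathrm{KP}_K(\Lambda)$ is the universal $K$-algebra generated by elements $p_v$ ($v\in\Lambda^0$), $s_\lambda$, $s_{\lambda^*}$ ($\lambda\in\Lambda^{\ne0}$) subject to: (KP1) the $p_v$ are mutually orthogonal idempotents; (KP2) for $\lambda,\mu\in\Lambda^{\neq0}$ with $r(\mu)=s(\lambda)$: $s_\lambda s_\mu=s_{\lambda\mu}$, $s_{\mu^*}s_{\lambda^*}=s_{(\lambda\mu)^*}$, $p_{r(\lambda)}s_\lambda=s_\lambda=s_\lambda p_{s(\lambda)}$, $p_{s(\lambda)}s_{\lambda^*}=s_{\lambda^*}=s_{\lambda^*}p_{r(\lambda)}$; (KP3) $s_{\lambda^*}s_\mu=\delta_{\lambda,\mu}p_{s(\lambda)}$ if $d(\lambda)=d(\mu)$; (KP4) $p_v=\sum_{\lambda\in v\Lambda^n}s_\lambda s_{\lambda^*}$ for all $v\in\Lambda^0$, $n\in\mathbb N^k\setminus\{0\}$. (The algebra need not be unital.) The socle $\mathrm{Soc}(R)$ of a semiprime ring $R$ is the sum of all its minimal left-ideals; a semiprime ring $R$ is semisimple if $\mathrm{Soc}(R)=R$. $\mathrm{KP}_K(\Lambda)$ is semiprime and has local units. $M_\infty(K)$ is the algebra of matrices indexed by $\mathbb N\times\mathbb N$ over $K$ with only finitely many nonzero entries. In (2) the isomorphism is one of $K$-algebras, in (3) one of monoids. A ring $R$ is von Neumann regular if for every $a\in R$ there is $b\in R$ with $aba=a$.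 For a ring $R$ with local units, $V(R)$ is the abelian monoid of isomorphism classes of finitely generated projective (unital, i.e. $RM=M$) left $R$-modules under direct sum. In an abelian monoid $V$, a unit is an element $u$ with $u+v=0$ for some $v$; an element $s$ is an atom if $s=u+v$ implies $u$ or $v$ is a unit; $V$ is atomic if every element is a sum of atoms; $V$ is cancellative if $a+c=b+c$ implies $a=b$. *)

(* Defs.v *)
From HB Require Import structures.
From mathcomp Require Import all_boot all_order all_algebra finmap.
From mathcomp Require Import boolp classical_sets functions cardinality fsbigop.

Set Implicit Arguments.
Unset Strict Implicit.
Unset Printing Implicit Defensive.

Import GRing.Theory.
Local Open Scope classical_set_scope.
Local Open Scope ring_scope.
Local Open Scope quotient_scope.

HB.mixin Record Zmodule_isNonUnitalRing R of GRing.Zmodule R := {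
  nmul : R -> R -> R;
  nmulA : associative nmul;
  nmulDl : left_distributive nmul +%R;
  nmulDr : right_distributive nmul +%R
}.

#[short(type="nuRingType")]
HB.structure Definition NonUnitalRing :=
  {R of Zmodule_isNonUnitalRing R & GRing.Zmodule R}.

HB.mixin Record NonUnitalRing_isAlgebra (K : pzRingType) A
    of NonUnitalRing A & GRing.Lmodule K A := {
  nscaleAl : forall (a : K) (x y : A), a *: nmul x y = nmul (a *: x) y;
  nscaleAr : forall (a : K) (x y : A), a *: nmul x y = nmul x (a *: y)
}.

#[short(type="nuAlgType")]
HB.structure Definition NonUnitalAlgebra (K : pzRingType) :=
  {A of NonUnitalRing_isAlgebra K A & NonUnitalRing A & GRing.Lmodule K A}.

Local Notation "x ** y" := (nmul x y) (at level 40, left associativity).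

Definition alg_iso (K : pzRingType) (A B : nuAlgType K) : Prop :=
  exists f : {linear A -> B}, {morph f : x y / x ** y} /\ bijective f.

Lemma nmul0r (R : nuRingType) (x : R) : 0 ** x = 0.
Proof. by apply: (addrI (0 ** x)); rewrite -nmulDl !addr0. Qed.

Lemma nmulr0 (R : nuRingType) (x : R) : x ** 0 = 0.
Proof. by apply: (addrI (x ** 0)); rewrite -nmulDr !addr0. Qed.

Section RingNotions.
Variable R : nuRingType.

Definition additive_subgroup (I : set R) : Prop :=
  [/\ I 0, forall x y, I x -> I y -> I (x + y) & forall x, I x -> I (- x)].

Definition left_ideal (I : set R) : Prop :=
  additive_subgroup I /\ forall r x, I x -> I (r ** x).

Definition two_sided_ideal (I : set R) : Prop :=
  left_ideal I /\ forall r x, I x -> I (x ** r).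

Definition semiprime : Prop :=
  forall I : set R, two_sided_ideal I ->
    (forall x y, I x -> I y -> x ** y = 0) -> I = [set 0].

Definition minimal_left_ideal (L : set R) : Prop :=
  [/\ left_ideal L, L <> [set 0] &
      forall L' : set R, left_ideal L' -> L' `<=` L -> L' = [set 0] \/ L' = L].

Definition socle : set R :=
  [set x | exists s : seq R,
     (forall y, y \in s -> exists2 L, minimal_left_ideal L & L y) /\
     x = \sum_(y <- s) y].

Definition semisimple : Prop := semiprime /\ socle = [set: R].

Definition von_neumann_regular : Prop :=
  forall a : R, exists b : R, a ** b ** a = a.

End RingNotions.

Section SquareMatrix.
Variables (K : comPzRingType) (n : nat).

HB.instance Definition _ :=
  Zmodule_isNonUnitalRing.Build 'M[K]_n
    (@mulmxA K n n n n) (@mulmxDl K n n n) (@mulmxDr K n n n).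

HB.instance Definition _ :=
  NonUnitalRing_isAlgebra.Build K 'M[K]_n
    (@scalemxAl K n n n) (@scalemxAr K n n n).

End SquareMatrix.

Section InfiniteMatrix.
Variable K : comPzRingType.

Definition finsupp_mx (f : nat -> nat -> K) : Prop :=
  finite_set [set ij : nat * nat | f ij.1 ij.2 != 0].

Record mxinf := MxInf { mxinf_fun :> nat -> nat -> K; _ : finsupp_mx mxinf_fun }.

HB.instance Definition _ := gen_eqMixin mxinf.
HB.instance Definition _ := gen_choiceMixin mxinf.

Lemma mxinfP (f g : mxinf) : (forall i j, f i j = g i j) -> f = g.
Proof.
case: f g => [f fP] [g gP] /= fg.
have e : f = g by apply/funext => i; apply/funext => j.
by case: _ / e gP => gP; congr MxInf; exact: Prop_irrelevance.
Qed.

Lemma finsupp_mxP (f : nat -> nat -> K) :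
  finsupp_mx f <->
  exists N, forall i j, (N <= i)%N || (N <= j)%N -> f i j = 0.
Proof.
split.
  move=> /finite_seqP[s sP].
  exists (\max_(ij <- s) (maxn ij.1 ij.2)).+1 => i j ij.
  apply/eqP; apply: contraT => fij.
  have ijs : (i, j) \in s.
    by have : [set` s] (i, j) by rewrite -sP.
  have le : (maxn i j <= \max_(ij <- s) maxn ij.1 ij.2)%N.
    exact: (@leq_bigmax_seq _ s xpredT (fun p => maxn p.1 p.2) (i, j)).
  move: ij le; rewrite geq_max.
  by case/orP=> h /andP[h1 h2]; [move: h1|move: h2]; rewrite leqNgt h.
move=> [N fN].
apply: (sub_finite_set (B := [set` [seq (i, j) | i <- iota 0 N, j <- iota 0 N]])).
  move=> [i j] /= fij; apply/allpairsP; exists (i, j) => /=.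
  rewrite !mem_iota /= !add0n.
  by split=> //; rewrite ltnNge; apply: contra fij => Ni;
    rewrite fN ?Ni ?orbT.
exact: finite_seq.
Qed.

Fact mxinf_supp (f : mxinf) :
  exists N, forall i j, (N <= i)%N || (N <= j)%N -> f i j = 0.
Proof. by apply/finsupp_mxP; case: f. Qed.

Fact mxinf0_subproof : finsupp_mx (fun _ _ => 0).
Proof. by apply/finsupp_mxP; exists 0%N. Qed.
Definition mxinf0 := MxInf mxinf0_subproof.

Fact mxinfN_subproof (f : mxinf) : finsupp_mx (fun i j => - f i j).
Proof.
by apply/finsupp_mxP; have [N fN] := mxinf_supp f;
   exists N => i j ij; rewrite fN ?oppr0.
Qed.
Definition mxinfN f := MxInf (mxinfN_subproof f).

Fact mxinfD_subproof (f g : mxinf) : finsupp_mx (fun i j => f i j + g i j).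
Proof.
apply/finsupp_mxP; have [N fN] := mxinf_supp f; have [M gM] := mxinf_supp g.
exists (maxn N M) => i j; rewrite !geq_max => ij.
rewrite fN ?gM ?addr0 //.
  by case/orP: ij => /andP[_ ->]; rewrite ?orbT.
by case/orP: ij => /andP[-> _]; rewrite ?orbT.
Qed.
Definition mxinfD f g := MxInf (mxinfD_subproof f g).

Fact mxinfZ_subproof (a : K) (f : mxinf) : finsupp_mx (fun i j => a * f i j).
Proof.
by apply/finsupp_mxP; have [N fN] := mxinf_supp f;
   exists N => i j ij; rewrite fN ?mulr0.
Qed.
Definition mxinfZ a f := MxInf (mxinfZ_subproof a f).

Lemma mxinf_sumE (f g : mxinf) N i j :
  (forall i j, (N <= i)%N || (N <= j)%N -> f i j = 0) ->
  \sum_(l \in [set: nat]) f i l * g l j = \sum_(l < N) f i l * g l j.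
Proof.
move=> fN; rewrite -(@fsbig_widen _ _ _ _ `I_N [set: nat]) //.
  exact/esym/fsbig_ord.
by move=> l [_ /= /negP]; rewrite -leqNgt => Nl; rewrite fN ?Nl ?orbT ?mul0r.
Qed.

Fact mxinfM_subproof (f g : mxinf) :
  finsupp_mx (fun i j => \sum_(l \in [set: nat]) f i l * g l j).
Proof.
apply/finsupp_mxP; have [N fN] := mxinf_supp f; have [M gM] := mxinf_supp g.
exists (maxn N M) => i j; rewrite !geq_max => ij.
rewrite (mxinf_sumE _ _ _ fN) big1 // => l _.
case/orP: ij => /andP[Ni Mi]; first by rewrite fN ?Ni ?mul0r.
by rewrite gM ?Mi ?orbT ?mulr0.
Qed.
Definition mxinfM f g := MxInf (mxinfM_subproof f g).

Fact mxinf_addA : associative mxinfD.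
Proof. by move=> f g h; apply: mxinfP => i j /=; rewrite addrA. Qed.
Fact mxinf_addC : commutative mxinfD.
Proof. by move=> f g; apply: mxinfP => i j /=; rewrite addrC. Qed.
Fact mxinf_add0 : left_id mxinf0 mxinfD.
Proof. by move=> f; apply: mxinfP => i j /=; rewrite add0r. Qed.
Fact mxinf_addN : left_inverse mxinf0 mxinfN mxinfD.
Proof. by move=> f; apply: mxinfP => i j /=; rewrite addNr. Qed.

HB.instance Definition _ :=
  GRing.isZmodule.Build mxinf mxinf_addA mxinf_addC mxinf_add0 mxinf_addN.

Fact mxinf_mulA : associative mxinfM.
Proof.
move=> f g h; apply: mxinfP => i j /=.
have [N fN] := mxinf_supp f; have [M gM] := mxinf_supp g.
have [P fgP] := mxinf_supp (mxinfM f g).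
pose Q := maxn (maxn N M) P.
have fQ a b : (Q <= a)%N || (Q <= b)%N -> f a b = 0.
  by rewrite !geq_max => ab; apply: fN;
     case/orP: ab => /andP[/andP[-> _] _]; rewrite ?orbT.
have gQ a b : (Q <= a)%N || (Q <= b)%N -> g a b = 0.
  by rewrite !geq_max => ab; apply: gM;
     case/orP: ab => /andP[/andP[_ ->] _]; rewrite ?orbT.
have fgQ a b : (Q <= a)%N || (Q <= b)%N -> mxinfM f g a b = 0.
  by rewrite !geq_max => ab; apply: fgP;
     case/orP: ab => /andP[_ ->]; rewrite ?orbT.
rewrite (mxinf_sumE (mxinfM g h) _ _ fQ) (mxinf_sumE h _ _ fgQ) /=.
under eq_bigr do rewrite (mxinf_sumE h _ _ gQ) big_distrr /=.
rewrite exchange_big /=; apply: eq_bigr => l _.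
rewrite (mxinf_sumE g _ _ fQ) big_distrl /=.
by apply: eq_bigr => l' _; rewrite mulrA.
Qed.

Fact mxinf_mulDl : left_distributive mxinfM +%R.
Proof.
move=> f g h; apply: mxinfP => i j /=.
have [N fN] := mxinf_supp f; have [M gM] := mxinf_supp g.
pose Q := maxn N M.
have fQ a b : (Q <= a)%N || (Q <= b)%N -> f a b = 0.
  by rewrite !geq_max => ab; apply: fN;
     case/orP: ab => /andP[-> _]; rewrite ?orbT.
have gQ a b : (Q <= a)%N || (Q <= b)%N -> g a b = 0.
  by rewrite !geq_max => ab; apply: gM;
     case/orP: ab => /andP[_ ->]; rewrite ?orbT.
have fgQ a b : (Q <= a)%N || (Q <= b)%N -> (mxinfD f g) a b = 0.
  by move=> ab /=; rewrite fQ ?gQ ?addr0.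
rewrite (mxinf_sumE h _ _ fQ) (mxinf_sumE h _ _ gQ) (mxinf_sumE h _ _ fgQ).
by rewrite -big_split; apply: eq_bigr => l _; rewrite /= mulrDl.
Qed.

Fact mxinf_mulDr : right_distributive mxinfM +%R.
Proof.
move=> f g h; apply: mxinfP => i j /=; have [N fN] := mxinf_supp f.
rewrite (mxinf_sumE g _ _ fN) (mxinf_sumE h _ _ fN).
rewrite (mxinf_sumE (mxinfD g h) _ _ fN) -big_split.
by apply: eq_bigr => l _; rewrite /= mulrDr.
Qed.

HB.instance Definition _ :=
  Zmodule_isNonUnitalRing.Build mxinf mxinf_mulA mxinf_mulDl mxinf_mulDr.

Fact mxinf_scaleA a b f : mxinfZ a (mxinfZ b f) = mxinfZ (a * b) f.
Proof. by apply: mxinfP => i j /=; rewrite mulrA. Qed.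
Fact mxinf_scale1 : left_id 1 mxinfZ.
Proof. by move=> f; apply: mxinfP => i j /=; rewrite mul1r. Qed.
Fact mxinf_scaleDr : right_distributive mxinfZ +%R.
Proof. by move=> a f g; apply: mxinfP => i j /=; rewrite mulrDr. Qed.
Fact mxinf_scaleDl f : {morph mxinfZ^~ f : a b / a + b}.
Proof. by move=> a b; apply: mxinfP => i j /=; rewrite mulrDl. Qed.

HB.instance Definition _ :=
  GRing.Zmodule_isLmodule.Build K mxinf
    mxinf_scaleA mxinf_scale1 mxinf_scaleDr mxinf_scaleDl.

Fact mxinf_scaleAl (a : K) (f g : mxinf) : a *: (f ** g) = (a *: f) ** g.
Proof.
apply: mxinfP => i j /=.
have [N fN] := mxinf_supp f.
have afN a' b : (N <= a')%N || (N <= b)%N -> mxinfZ a f a' b = 0.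
  by move=> ab /=; rewrite fN ?mulr0.
rewrite (mxinf_sumE g _ _ fN) (mxinf_sumE g _ _ afN) big_distrr.
by apply: eq_bigr => l _; rewrite /= mulrA.
Qed.

Fact mxinf_scaleAr (a : K) (f g : mxinf) : a *: (f ** g) = f ** (a *: g).
Proof.
apply: mxinfP => i j /=.
have [N fN] := mxinf_supp f.
rewrite (mxinf_sumE g _ _ fN) (mxinf_sumE (mxinfZ a g) _ _ fN) big_distrr.
by apply: eq_bigr => l _; rewrite /= mulrCA.
Qed.

HB.instance Definition _ :=
  NonUnitalRing_isAlgebra.Build K mxinf mxinf_scaleAl mxinf_scaleAr.

End InfiniteMatrix.

(* [None] stands for the size infinity. *)
Definition mx_alg (K : comPzRingType) (n : option nat) : nuAlgType K :=
  match n with Some m => 'M[K]_m | None => mxinf K end.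

Section DirectSum.
Variables (K : pzRingType) (I : choiceType) (A : I -> nuAlgType K).

Record dsum := DSum {
  dsum_fun :> forall i, A i;
  _ : finite_set [set i | dsum_fun i != 0]
}.

HB.instance Definition _ := gen_eqMixin dsum.
HB.instance Definition _ := gen_choiceMixin dsum.

Lemma dsumP (f g : dsum) : (forall i, f i = g i) -> f = g.
Proof.
case: f g => [f fP] [g gP] /= fg.
have e : f = g by apply: functional_extensionality_dep.
by case: _ / e gP => gP; congr DSum; exact: Prop_irrelevance.
Qed.

Fact dsum_supp (f : dsum) : finite_set [set i | f i != 0].
Proof. by case: f. Qed.

Fact dsum0_subproof : finite_set [set i : I | (0 : A i) != 0].
Proof. by apply: (sub_finite_set (B := set0)) => // i /=; rewrite eqxx. Qed.
Definition dsum0 := DSum dsum0_subproof.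

Fact dsumN_subproof (f : dsum) : finite_set [set i | - f i != 0].
Proof. by apply: sub_finite_set (dsum_supp f) => i /=; rewrite oppr_eq0. Qed.
Definition dsumN f := DSum (dsumN_subproof f).

Fact dsumD_subproof (f g : dsum) : finite_set [set i | f i + g i != 0].
Proof.
apply: (sub_finite_set (B := [set i | f i != 0] `|` [set i | g i != 0])).
  move=> i /=; have [->|] := eqVneq (f i) 0; last by left.
  by rewrite add0r; right.
by rewrite finite_setU; split; exact: dsum_supp.
Qed.
Definition dsumD f g := DSum (dsumD_subproof f g).

Fact dsumM_subproof (f g : dsum) : finite_set [set i | f i ** g i != 0].
Proof.
apply: sub_finite_set (dsum_supp f) => i /=.
by apply: contra => /eqP ->; rewrite nmul0r.
Qed.
Definition dsumM f g := DSum (dsumM_subproof f g).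

Fact dsumZ_subproof (a : K) (f : dsum) : finite_set [set i | a *: f i != 0].
Proof.
apply: sub_finite_set (dsum_supp f) => i /=.
by apply: contra => /eqP ->; rewrite scaler0.
Qed.
Definition dsumZ a f := DSum (dsumZ_subproof a f).

Fact dsum_addA : associative dsumD.
Proof. by move=> f g h; apply: dsumP => i /=; rewrite addrA. Qed.
Fact dsum_addC : commutative dsumD.
Proof. by move=> f g; apply: dsumP => i /=; rewrite addrC. Qed.
Fact dsum_add0 : left_id dsum0 dsumD.
Proof. by move=> f; apply: dsumP => i /=; rewrite add0r. Qed.
Fact dsum_addN : left_inverse dsum0 dsumN dsumD.
Proof. by move=> f; apply: dsumP => i /=; rewrite addNr. Qed.

HB.instance Definition _ :=
  GRing.isZmodule.Build dsum dsum_addA dsum_addC dsum_add0 dsum_addN.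

Fact dsum_mulA : associative dsumM.
Proof. by move=> f g h; apply: dsumP => i /=; rewrite nmulA. Qed.
Fact dsum_mulDl : left_distributive dsumM +%R.
Proof. by move=> f g h; apply: dsumP => i /=; rewrite nmulDl. Qed.
Fact dsum_mulDr : right_distributive dsumM +%R.
Proof. by move=> f g h; apply: dsumP => i /=; rewrite nmulDr. Qed.

HB.instance Definition _ :=
  Zmodule_isNonUnitalRing.Build dsum dsum_mulA dsum_mulDl dsum_mulDr.

Fact dsum_scaleA a b f : dsumZ a (dsumZ b f) = dsumZ (a * b) f.
Proof. by apply: dsumP => i /=; rewrite scalerA. Qed.
Fact dsum_scale1 : left_id 1 dsumZ.
Proof. by move=> f; apply: dsumP => i /=; rewrite scale1r. Qed.
Fact dsum_scaleDr : right_distributive dsumZ +%R.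
Proof. by move=> a f g; apply: dsumP => i /=; rewrite scalerDr. Qed.
Fact dsum_scaleDl f : {morph dsumZ^~ f : a b / a + b}.
Proof. by move=> a b; apply: dsumP => i /=; rewrite scalerDl. Qed.

HB.instance Definition _ :=
  GRing.Zmodule_isLmodule.Build K dsum
    dsum_scaleA dsum_scale1 dsum_scaleDr dsum_scaleDl.

Fact dsum_scaleAl (a : K) (f g : dsum) : a *: (f ** g) = (a *: f) ** g.
Proof. by apply: dsumP => i /=; rewrite nscaleAl. Qed.
Fact dsum_scaleAr (a : K) (f g : dsum) : a *: (f ** g) = f ** (a *: g).
Proof. by apply: dsumP => i /=; rewrite nscaleAr. Qed.

HB.instance Definition _ :=
  NonUnitalRing_isAlgebra.Build K dsum dsum_scaleAl dsum_scaleAr.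

End DirectSum.

HB.mixin Record Zmodule_isNonUnitalModule (R : nuRingType) M
    of GRing.Zmodule M := {
  act : R -> M -> M;
  actA : forall r s m, act r (act s m) = act (r ** s) m;
  actDl : forall r s m, act (r + s) m = act r m + act s m;
  actDr : forall r m n, act r (m + n) = act r m + act r n
}.

#[short(type="nuModType")]
HB.structure Definition NonUnitalModule (R : nuRingType) :=
  {M of Zmodule_isNonUnitalModule R M & GRing.Zmodule M}.

Section Modules.
Variable R : nuRingType.
Implicit Types M N P : nuModType R.

Lemma act0 M (r : R) : act r (0 : M) = 0.
Proof. by apply: (addrI (act r 0)); rewrite -actDr !addr0. Qed.

Definition module_hom M N (f : M -> N) : Prop :=
  {morph f : x y / x + y} /\ forall (r : R) x, f (act r x) = act r (f x).

Definition module_iso M N : Prop :=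
  exists f : M -> N, module_hom f /\ bijective f.

(* [RM = M], where [RM] is the set of finite sums of products. *)
Definition unital_module M : Prop :=
  forall m : M, exists s : seq (R * M), m = \sum_(x <- s) act x.1 x.2.

Definition finitely_generated M : Prop :=
  exists (n : nat) (x : 'I_n -> M),
    forall m : M, exists a : 'I_n -> R, m = \sum_i act (a i) (x i).

(* Projectivity in the category of unital left modules. *)
Definition projective_module P : Prop :=
  forall (M N : nuModType R), unital_module M -> unital_module N ->
  forall (g : M -> N) (f : P -> N), module_hom g -> module_hom f ->
    (forall y, exists x, g x = y) ->
    exists2 h : P -> M, module_hom h & forall x, g (h x) = f x.

Record fgProj := FgProj {
  fgproj_mod :> nuModType R;
  fgproj_unital : unital_module fgproj_mod;
  fgproj_fg : finitely_generated fgproj_mod;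
  fgproj_proj : projective_module fgproj_mod
}.

Lemma module_iso_refl M : module_iso M M.
Proof. by exists id; split; [split|exists id]. Qed.

Lemma module_iso_sym M N : module_iso M N -> module_iso N M.
Proof.
move=> [f [[fD fZ] [g fK gK]]]; exists g; split; last by exists f.
split=> [x y|r x]; first by rewrite -{1}(gK x) -{1}(gK y) -fD fK.
by rewrite -{1}(gK x) -fZ fK.
Qed.

Lemma module_iso_trans M N P :
  module_iso M N -> module_iso N P -> module_iso M P.
Proof.
move=> [f [[fD fZ] fb]] [g [[gD gZ] gb]]; exists (g \o f).
split; last exact: bij_comp.
by split=> [x y|r x] /=; rewrite ?fD ?gD ?fZ ?gZ.
Qed.

End Modules.

Arguments fgproj_unital {R} f.
Arguments fgproj_fg {R} f.
Arguments fgproj_proj {R} f.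

Section ModuleSum.
Variable R : nuRingType.

Section Prod.
Variables M N : nuModType R.

Definition prod_act (r : R) (x : M * N) : M * N := (act r x.1, act r x.2).

Fact prod_actA r s m : prod_act r (prod_act s m) = prod_act (r ** s) m.
Proof. by rewrite /prod_act /= !actA. Qed.
Fact prod_actDl r s m : prod_act (r + s) m = prod_act r m + prod_act s m.
Proof. by rewrite /prod_act /= !actDl. Qed.
Fact prod_actDr r m n : prod_act r (m + n) = prod_act r m + prod_act r n.
Proof. by rewrite /prod_act /= !actDr. Qed.

HB.instance Definition _ :=
  Zmodule_isNonUnitalModule.Build R (M * N)%type
    prod_actA prod_actDl prod_actDr.

End Prod.

Definition zero_module : Type := 'rV[int]_0.
HB.instance Definition _ := GRing.Zmodule.on zero_module.

Lemma zero_moduleP (x : zero_module) : x = 0.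
Proof. by apply/rowP => -[]. Qed.

Definition zero_act (r : R) (x : zero_module) : zero_module := 0.

Fact zero_actA r s m : zero_act r (zero_act s m) = zero_act (r ** s) m.
Proof. by []. Qed.
Fact zero_actDl r s m : zero_act (r + s) m = zero_act r m + zero_act s m.
Proof. by rewrite [RHS]zero_moduleP. Qed.
Fact zero_actDr r m n : zero_act r (m + n) = zero_act r m + zero_act r n.
Proof. by rewrite [RHS]zero_moduleP. Qed.

HB.instance Definition _ :=
  Zmodule_isNonUnitalModule.Build R zero_module
    zero_actA zero_actDl zero_actDr.

Lemma sum_pair (M N : zmodType) (I : Type) (s : seq I) (f : I -> M) (g : I -> N) :
  \sum_(i <- s) (f i, g i) = (\sum_(i <- s) f i, \sum_(i <- s) g i) :> M * N.
Proof. by elim: s => [|i s IH]; rewrite ?big_nil // !big_cons IH. Qed.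

Fact unital_prod (M N : nuModType R) :
  unital_module M -> unital_module N -> unital_module (M * N)%type.
Proof.
move=> uM uN [m n]; have [s ->] := uM m; have [t ->] := uN n.
exists ([seq (x.1, (x.2, 0)) | x <- s] ++ [seq (x.1, (0, x.2)) | x <- t]).
rewrite big_cat !big_map /= /act /= /prod_act /= !sum_pair.
rewrite [X in (_, X) + _]big1 => [|i _]; last exact: act0.
rewrite [X in _ + (X, _)]big1 => [|i _]; last exact: act0.
by congr pair; rewrite /= ?addr0 ?add0r.
Qed.

Fact fg_prod (M N : nuModType R) :
  finitely_generated M -> finitely_generated N ->
  finitely_generated (M * N)%type.
Proof.
move=> [p [x xP]] [q [y yP]].
exists (p + q)%N, (fun i : 'I_(p + q) => match fintype.split i with
                            | inl j => (x j, 0) | inr j => (0, y j) end).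
move=> [m n]; have [a ->] := xP m; have [b ->] := yP n.
exists (fun i : 'I_(p + q) => match fintype.split i with inl j => a j | inr j => b j end).
rewrite big_split_ord /=.
under [X in _ = X + _]eq_bigr do
  rewrite (unsplitK (inl _ : 'I_p + 'I_q)) /act /= /prod_act /= act0.
under [X in _ = _ + X]eq_bigr do
  rewrite (unsplitK (inr _ : 'I_p + 'I_q)) /act /= /prod_act /= act0.
rewrite !sum_pair !big1_eq.
by congr pair; rewrite /= ?addr0 ?add0r.
Qed.

Fact proj_prod (M N : nuModType R) :
  projective_module M -> projective_module N ->
  projective_module (M * N)%type.
Proof.
move=> pM pN A B uA uB g f hg [fD fZ] gs.
have h1 : module_hom (fun x : M => f (x, 0)).
  split=> [x y|r x]; first by rewrite -fD; congr f; congr pair; rewrite /= addr0.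
  by rewrite -fZ; congr f; rewrite /act /= /prod_act /= act0.
have h2 : module_hom (fun x : N => f (0, x)).
  split=> [x y|r x]; first by rewrite -fD; congr f; congr pair; rewrite /= addr0.
  by rewrite -fZ; congr f; rewrite /act /= /prod_act /= act0.
have [u [uD uZ] gu] := pM A B uA uB g _ hg h1 gs.
have [v [vD vZ] gv] := pN A B uA uB g _ hg h2 gs.
exists (fun x => u x.1 + v x.2).
  split=> [x y|r x] /=; first by rewrite uD vD addrACA.
  by rewrite uZ vZ actDr.
move=> [x y] /=; rewrite hg.1 gu gv -fD; congr f.
by congr pair; rewrite /= ?addr0 ?add0r.
Qed.

Definition fgProj_sum (M N : fgProj R) : fgProj R :=
  FgProj (unital_prod (fgproj_unital M) (fgproj_unital N))
         (fg_prod (fgproj_fg M) (fgproj_fg N))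
         (proj_prod (fgproj_proj M) (fgproj_proj N)).

Fact unital_zero : unital_module zero_module.
Proof. by move=> m; exists [::]; rewrite big_nil [m]zero_moduleP. Qed.

Fact fg_zero : finitely_generated zero_module.
Proof.
exists 0%N, (fun=> 0) => m; exists (fun=> 0).
by rewrite big_ord0 [m]zero_moduleP.
Qed.

Fact hom0 (M N : nuModType R) (f : M -> N) : module_hom f -> f 0 = 0.
Proof. by move=> [fD _]; apply: (addrI (f 0)); rewrite -fD !addr0. Qed.

Fact proj_zero : projective_module zero_module.
Proof.
move=> A B uA uB g f hg hf gs; exists (fun=> 0).
  by split=> [x y|r x]; rewrite ?addr0 ?act0.
by move=> x; rewrite (hom0 hg) [x]zero_moduleP (hom0 hf).
Qed.

Definition fgProj_zero : fgProj R := FgProj unital_zero fg_zero proj_zero.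

Lemma fgProj_sum_iso (M M' N N' : fgProj R) :
  module_iso M M' -> module_iso N N' ->
  module_iso (fgProj_sum M N) (fgProj_sum M' N').
Proof.
move=> [f [[fD fZ] [f' fK f'K]]] [g [[gD gZ] [g' gK g'K]]].
exists (fun x => (f x.1, g x.2)); split.
  split=> [x y|r x]; first by rewrite /= fD gD.
  by rewrite /act /= /prod_act /= fZ gZ.
by exists (fun x => (f' x.1, g' x.2)) => -[x y] /=; rewrite ?fK ?gK ?f'K ?g'K.
Qed.

Lemma fgProj_sumA (M N P : fgProj R) :
  module_iso (fgProj_sum M (fgProj_sum N P)) (fgProj_sum (fgProj_sum M N) P).
Proof.
exists (fun x => ((x.1, x.2.1), x.2.2)); split; first by split.
by exists (fun x => (x.1.1, (x.1.2, x.2))) => [[x [y z]]|[[x y] z]].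
Qed.

Lemma fgProj_sumC (M N : fgProj R) :
  module_iso (fgProj_sum M N) (fgProj_sum N M).
Proof.
exists (fun x => (x.2, x.1)); split; first by split.
by exists (fun x => (x.2, x.1)) => -[].
Qed.

Lemma fgProj_sum0 (M : fgProj R) : module_iso (fgProj_sum fgProj_zero M) M.
Proof.
exists (fun x => x.2); split; first by split.
by exists (fun x => (0, x)) => [[y x]|x] //=; rewrite [y]zero_moduleP.
Qed.

(* The elements of [V(R)] are the isomorphism classes themselves, as
   predicates on modules.  [Vmon] lives in a larger universe than the carriers
   of the modules, so it is not given a [choiceType] or [nmodType] structure;
   it is a commutative monoid through [Monoid.com_law]. *)
Definition is_class (C : fgProj R -> Prop) : Prop :=
  exists M : fgProj R, forall N : fgProj R, C N <-> module_iso M N.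

Record Vmon := VMon { Vmem : fgProj R -> Prop; VmemP : is_class Vmem }.

Fact Vclass_subproof (M : fgProj R) :
  is_class (fun N : fgProj R => module_iso M N).
Proof. by exists M. Qed.
Definition Vclass (M : fgProj R) : Vmon := VMon (Vclass_subproof M).

Lemma Vmon_eq (C D : Vmon) : (forall M, Vmem C M <-> Vmem D M) -> C = D.
Proof.
case: C D => [C CP] [D DP] /= CD.
have e : C = D by apply/funext => M; apply/propext.
by case: _ / e DP => DP; congr VMon; exact: Prop_irrelevance.
Qed.

Lemma Vclass_eq (M N : fgProj R) : Vclass M = Vclass N <-> module_iso M N.
Proof.
split=> [e|MN]; first by rewrite -[module_iso M N]/(Vmem (Vclass M) N) e;
  exact: module_iso_refl.
apply: Vmon_eq => P /=; split; apply: module_iso_trans => //.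
exact: module_iso_sym.
Qed.

Lemma Vclass_surj (C : Vmon) : exists M, C = Vclass M.
Proof. by case: C => C [M MC]; exists M; apply: Vmon_eq. Qed.

Fact Vadd_subproof (C D : Vmon) :
  is_class (fun P : fgProj R => exists M N : fgProj R,
    [/\ Vmem C M, Vmem D N & module_iso (fgProj_sum M N) P]).
Proof.
have [M ->] := Vclass_surj C; have [N ->] := Vclass_surj D.
exists (fgProj_sum M N) => P; split => /=; last first.
  by exists M, N; split=> //; exact: module_iso_refl.
move=> [M' [N' [MM' NN' +]]]; apply: module_iso_trans.
exact: fgProj_sum_iso.
Qed.

Definition V0 : Vmon := Vclass fgProj_zero.
Definition Vadd (C D : Vmon) : Vmon := VMon (Vadd_subproof C D).

Lemma Vadd_class (M N : fgProj R) :
  Vadd (Vclass M) (Vclass N) = Vclass (fgProj_sum M N).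
Proof.
apply: Vmon_eq => P /=; split; last first.
  by exists M, N; split=> //; exact: module_iso_refl.
move=> [M' [N' [MM' NN' +]]]; apply: module_iso_trans.
exact: fgProj_sum_iso.
Qed.

Fact VaddA : associative Vadd.
Proof.
move=> C D E; have [M ->] := Vclass_surj C; have [N ->] := Vclass_surj D.
have [P ->] := Vclass_surj E; rewrite !Vadd_class.
by apply/Vclass_eq; exact: fgProj_sumA.
Qed.

Fact VaddC : commutative Vadd.
Proof.
move=> C D; have [M ->] := Vclass_surj C; have [N ->] := Vclass_surj D.
by rewrite !Vadd_class; apply/Vclass_eq; exact: fgProj_sumC.
Qed.

Fact Vadd0 : left_id V0 Vadd.
Proof.
move=> C; have [M ->] := Vclass_surj C.
by rewrite Vadd_class; apply/Vclass_eq; exact: fgProj_sum0.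
Qed.

HB.instance Definition _ := Monoid.isComLaw.Build Vmon V0 Vadd VaddA VaddC Vadd0.

End ModuleSum.

Section AbelianMonoids.
Variables (T : Type) (zero : T) (add : Monoid.com_law zero).

Definition monoid_unit (u : T) : Prop := exists v, add u v = zero.

Definition monoid_atom (s : T) : Prop :=
  forall u v, s = add u v -> monoid_unit u \/ monoid_unit v.

Definition atomic_monoid : Prop :=
  forall x, exists n (a : 'I_n -> T),
    (forall i, monoid_atom (a i)) /\ x = \big[add/zero]_i a i.

Definition cancellative_monoid : Prop :=
  forall a b c, add a c = add b c -> a = b.

(* Isomorphism with the direct sum of [I] copies of [nat], whose elements are
   the finitely supported functions from [I] to [nat]. *)
Definition iso_dsum_nat (I : choiceType) : Prop :=
  exists f : T -> {fsfun I -> nat with 0%N},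
    [/\ forall i, f zero i = 0%N,
        forall x y i, f (add x y) i = (f x i + f y i)%N &
        bijective f].

End AbelianMonoids.

Definition Nk (k : nat) : Type := {ffun 'I_k -> nat}.
HB.instance Definition _ k := Countable.on (Nk k).
HB.instance Definition _ k := GRing.Nmodule.on (Nk k).

Definition leNk (k : nat) (m n : Nk k) : bool := [forall i, (m i <= n i)%N].

Lemma leNkP k (m n : Nk k) : reflect (forall i, (m i <= n i)%N) (leNk m n).
Proof. exact: forallP. Qed.

(* The coordinatewise difference, used only when [leNk m n]. *)
Definition subNk (k : nat) (n m : Nk k) : Nk k := [ffun i => (n i - m i)%N].

Lemma addNkE k (m n : Nk k) i : (m + n) i = (m i + n i)%N.
Proof. by rewrite ffunE. Qed.

Lemma subNkE k (n m : Nk k) i : subNk n m i = (n i - m i)%N.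
Proof. by rewrite ffunE. Qed.

(* [kcomp l m] is the composite [l m] when [ksrc l = krng m]; outside of
   composable pairs its value is irrelevant.  Unique factorisation makes
   [kid] a bijection from the objects to the paths of degree 0. *)
Record kGraph (k : nat) := KGraph {
  kvert : countType;
  kpath :> countType;
  krng : kpath -> kvert;
  ksrc : kpath -> kvert;
  kid : kvert -> kpath;
  kcomp : kpath -> kpath -> kpath;
  kdeg : kpath -> Nk k;
  krng_id : forall v, krng (kid v) = v;
  ksrc_id : forall v, ksrc (kid v) = v;
  krng_comp : forall l m, ksrc l = krng m -> krng (kcomp l m) = krng l;
  ksrc_comp : forall l m, ksrc l = krng m -> ksrc (kcomp l m) = ksrc m;
  kcomp_idl : forall l, kcomp (kid (krng l)) l = l;
  kcomp_idr : forall l, kcomp l (kid (ksrc l)) = l;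
  kcompA : forall l m n, ksrc l = krng m -> ksrc m = krng n ->
    kcomp l (kcomp m n) = kcomp (kcomp l m) n;
  kdeg_id : forall v, kdeg (kid v) = 0;
  kdeg_comp : forall l m, ksrc l = krng m -> kdeg (kcomp l m) = kdeg l + kdeg m;
  kfactor : forall l (m n : Nk k), kdeg l = m + n ->
    exists! p : kpath * kpath,
      [/\ ksrc p.1 = krng p.2, kdeg p.1 = m, kdeg p.2 = n & l = kcomp p.1 p.2]
}.

Record kGraph_morph (k : nat) (G H : kGraph k) := KMorph {
  kmorph_vert : kvert G -> kvert H;
  kmorph_path :> G -> H;
  kmorph_rng : forall l, krng (kmorph_path l) = kmorph_vert (krng l);
  kmorph_src : forall l, ksrc (kmorph_path l) = kmorph_vert (ksrc l);
  kmorph_id : forall v, kmorph_path (kid v) = kid (kmorph_vert v);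
  kmorph_comp : forall l m, ksrc l = krng m ->
    kmorph_path (kcomp l m) = kcomp (kmorph_path l) (kmorph_path m);
  kmorph_deg : forall l, kdeg (kmorph_path l) = kdeg l
}.

Lemma kGraph_morphP (k : nat) (G H : kGraph k) (x y : kGraph_morph G H) :
  (forall l, x l = y l) -> x = y.
Proof.
case: x y => [xv xp xr xs xi xc xd] [yv yp yr ys yi yc yd] /= xy.
have ep : xp = yp by apply/funext.
case: _ / ep in yr ys yi yc yd xy *.
have ev : xv = yv.
  by apply/funext => v; rewrite -[LHS]krng_id -xi yi krng_id.
case: _ / ev in yr ys yi *.
by congr KMorph; exact: Prop_irrelevance.
Qed.

Section Omega.
Variable k : nat.

Lemma leNk_refl (m : Nk k) : leNk m m.
Proof. by apply/leNkP. Qed.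

Lemma leNk_trans (n m p : Nk k) : leNk m n -> leNk n p -> leNk m p.
Proof.
by move=> /leNkP mn /leNkP np; apply/leNkP => i; exact: leq_trans (np i).
Qed.

Definition omega_path : Type := {x : Nk k * Nk k | leNk x.1 x.2}.
HB.instance Definition _ := Countable.on omega_path.

Definition omega_seg (m n : Nk k) (mn : leNk m n) : omega_path :=
  exist (fun x : Nk k * Nk k => leNk x.1 x.2) (m, n) mn.

Definition omega_id (m : Nk k) : omega_path := omega_seg (leNk_refl m).

Definition omega_comp (x y : omega_path) : omega_path :=
  insubd x ((val x).1, (val y).2).

Definition omega_deg (x : omega_path) : Nk k := subNk (val x).2 (val x).1.

Lemma val_omega_comp (x y : omega_path) : (val x).2 = (val y).1 ->
  val (omega_comp x y) = ((val x).1, (val y).2).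
Proof.
move=> xy; rewrite insubdK // -topredE /=.
by apply: leNk_trans (valP x) _; rewrite xy; exact: (valP y).
Qed.

Fact omega_rng_comp (x y : omega_path) : (val x).2 = (val y).1 ->
  (val (omega_comp x y)).1 = (val x).1.
Proof. by move=> /val_omega_comp ->. Qed.

Fact omega_src_comp (x y : omega_path) : (val x).2 = (val y).1 ->
  (val (omega_comp x y)).2 = (val y).2.
Proof. by move=> /val_omega_comp ->. Qed.

Fact omega_comp_idl (x : omega_path) : omega_comp (omega_id (val x).1) x = x.
Proof. by apply: val_inj; rewrite val_omega_comp //=; case: (val x). Qed.

Fact omega_comp_idr (x : omega_path) : omega_comp x (omega_id (val x).2) = x.
Proof. by apply: val_inj; rewrite val_omega_comp //=; case: (val x). Qed.

Fact omega_compA (x y z : omega_path) :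
  (val x).2 = (val y).1 -> (val y).2 = (val z).1 ->
  omega_comp x (omega_comp y z) = omega_comp (omega_comp x y) z.
Proof.
move=> xy yz; apply: val_inj.
by rewrite !val_omega_comp //= ?omega_rng_comp ?omega_src_comp.
Qed.

Fact omega_deg_id (m : Nk k) : omega_deg (omega_id m) = 0.
Proof. by apply/ffunP => i; rewrite !ffunE /= subnn. Qed.

Fact omega_deg_comp (x y : omega_path) : (val x).2 = (val y).1 ->
  omega_deg (omega_comp x y) = omega_deg x + omega_deg y.
Proof.
move=> xy; apply/ffunP => i; rewrite !ffunE val_omega_comp //= -xy.
have /leNkP/(_ i) h1 := valP x; have /leNkP/(_ i) := valP y; rewrite -xy => h2.
by apply/esym; rewrite [LHS]addnC addnBA // subnK.
Qed.

Fact omega_factor (x : omega_path) (m n : Nk k) : omega_deg x = m + n ->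
  exists! p : omega_path * omega_path,
    [/\ (val p.1).2 = (val p.2).1, omega_deg p.1 = m, omega_deg p.2 = n &
        x = omega_comp p.1 p.2].
Proof.
case: x => -[a b] ab /ffunP dx; have /leNkP /= ab' := ab.
have dxi i : b i = (a i + m i + n i)%N.
  have := dx i; rewrite !ffunE /= => e.
  by rewrite -addnA -[(m i + n i)%N]e subnKC.
have am : leNk a (a + m).
  by apply/leNkP => i; rewrite !ffunE; exact: leq_addr.
have mb : leNk (a + m) b.
  by apply/leNkP => i; rewrite !ffunE dxi; exact: leq_addr.
exists (omega_seg am, omega_seg mb); split.
  split=> //=.
  - by apply/ffunP => i; rewrite !ffunE /=; exact: addKn.
  - by apply/ffunP => i; rewrite !ffunE /= dxi; exact: addKn.
  - by apply: val_inj; rewrite val_omega_comp.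
move=> [[[c d] cd] [[e f] ef]] [/= de /ffunP dm /ffunP dn xE].
subst e; have := congr1 val xE; rewrite val_omega_comp //= => -[ac bf].
subst c f; have dE : a + m = d.
  apply/ffunP => i; rewrite !ffunE -(dm i) !ffunE /=.
  by have /leNkP /= cd' := cd; exact: subnKC.
by subst d; congr pair; apply: val_inj.
Qed.

Definition Omega : kGraph k :=
  @KGraph k (Nk k) omega_path (fun x => (val x).1) (fun x => (val x).2)
    omega_id omega_comp omega_deg
    (fun=> erefl) (fun=> erefl) omega_rng_comp omega_src_comp
    omega_comp_idl omega_comp_idr omega_compA omega_deg_id omega_deg_comp
    omega_factor.

Lemma leNk_add (p m n : Nk k) : leNk m n -> leNk (m + p) (n + p).
Proof.
by move=> /leNkP mn; apply/leNkP => i; rewrite !ffunE; exact: leq_add.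
Qed.

Definition omega_shift (p : Nk k) (x : omega_path) : omega_path :=
  omega_seg (leNk_add p (valP x)).

End Omega.

Section InfinitePaths.
Variables (k : nat) (G : kGraph k).

Definition infpath : Type := kGraph_morph (Omega k) G.

(* [x(m)] is the vertex to which the functor [x] sends the object [m]; by
   [kmorph_id], the path [x(m, m)] is the identity at this vertex. *)
Definition infpath_at (x : infpath) (m : Nk k) : kvert G := kmorph_vert x m.

Fact sigma_id (p : Nk k) (x : infpath) (m : Nk k) :
  x (omega_shift p (omega_id m)) = kid (infpath_at x (m + p)).
Proof.
rewrite -[RHS](kmorph_id x).
by apply: (congr1 (kmorph_path x)); exact: val_inj.
Qed.

Fact sigma_comp (p : Nk k) (x : infpath) (l m : Omega k) : ksrc l = krng m ->
  x (omega_shift p (kcomp l m)) =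
  kcomp (x (omega_shift p l)) (x (omega_shift p m)).
Proof.
move=> lm; have lm' : (val l).2 = (val m).1 by [].
rewrite -(kmorph_comp x); last by rewrite /= lm'.
apply: (congr1 (kmorph_path x)); apply: val_inj.
rewrite [RHS]val_omega_comp; last by rewrite /= lm'.
by rewrite /= val_omega_comp.
Qed.

Fact sigma_deg (p : Nk k) (x : infpath) (l : Omega k) :
  kdeg (x (omega_shift p l)) = kdeg l.
Proof.
rewrite (kmorph_deg x); apply/ffunP => i; rewrite !subNkE !addNkE.
exact: subnDr.
Qed.

Definition sigma (p : Nk k) (x : infpath) : infpath :=
  @KMorph k (Omega k) G
    (fun m : Nk k => infpath_at x (m + p)) (fun l => x (omega_shift p l))
    (fun l => kmorph_rng x (omega_shift p l))
    (fun l => kmorph_src x (omega_shift p l))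
    (sigma_id p x) (@sigma_comp p x) (sigma_deg p x).

Definition periodic (x : infpath) : Prop :=
  exists p q : Nk k, p <> q /\ sigma p x = sigma q x.

Definition infpaths_from (v : kvert G) : set infpath :=
  [set x | infpath_at x 0 = v].

Definition line_point (v : kvert G) : Prop :=
  exists x : infpath, infpaths_from v = [set x] /\ ~ periodic x.

Definition paths_from (v : kvert G) (n : Nk k) : set G :=
  [set l | krng l = v /\ kdeg l = n].

Definition row_finite_no_sources : Prop :=
  forall v n, finite_set (paths_from v n) /\ paths_from v n !=set0.

End InfinitePaths.

Section KumjianPask.
Variables (k : nat) (G : kGraph k) (K : fieldType).

Definition nzpath : Type := {l : G | kdeg l != 0}.
HB.instance Definition _ := Countable.on nzpath.

(* [KPt l] is the generator attached to the ghost path of [l].  In [KP4], the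
   sum over [[set l | ...]] is the intended one only when this set is finite,
   as it is when [G] is row-finite. *)
Record KPfamily (A : nuAlgType K) := KPFamily {
  KPp : kvert G -> A;
  KPs : nzpath -> A;
  KPt : nzpath -> A;
  KP1 : forall v w, KPp v ** KPp w = if v == w then KPp v else 0;
  KP2s : forall l m n : nzpath, ksrc (val l) = krng (val m) ->
    val n = kcomp (val l) (val m) -> KPs l ** KPs m = KPs n;
  KP2t : forall l m n : nzpath, ksrc (val l) = krng (val m) ->
    val n = kcomp (val l) (val m) -> KPt m ** KPt l = KPt n;
  KP2rs : forall l, KPp (krng (val l)) ** KPs l = KPs l;
  KP2ss : forall l, KPs l ** KPp (ksrc (val l)) = KPs l;
  KP2st : forall l, KPp (ksrc (val l)) ** KPt l = KPt l;
  KP2rt : forall l, KPt l ** KPp (krng (val l)) = KPt l;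
  KP3 : forall l m, kdeg (val l) = kdeg (val m) ->
    KPt l ** KPs m = if l == m then KPp (ksrc (val l)) else 0;
  KP4 : forall v (n : Nk k), n != 0 ->
    KPp v = \sum_(l \in [set l : nzpath | paths_from v n (val l)])
              KPs l ** KPt l
}.

(* Formal expressions in the generators, identified when they take the same
   value on every family satisfying the relations, in every algebra: the
   quotient is the universal algebra [KP], see [KP_universal]. *)
Inductive kpterm : Type :=
  | TP of kvert G
  | TS of nzpath
  | TT of nzpath
  | TZero
  | TAdd of kpterm & kpterm
  | TOpp of kpterm
  | TScale of K & kpterm
  | TMul of kpterm & kpterm.

HB.instance Definition _ := gen_eqMixin kpterm.
HB.instance Definition _ := gen_choiceMixin kpterm.

Fixpoint kpeval (A : nuAlgType K) (F : KPfamily A) (t : kpterm) : A :=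
  match t with
  | TP v => KPp F v
  | TS l => KPs F l
  | TT l => KPt F l
  | TZero => 0
  | TAdd t u => kpeval F t + kpeval F u
  | TOpp t => - kpeval F t
  | TScale a t => a *: kpeval F t
  | TMul t u => kpeval F t ** kpeval F u
  end.

Definition kpeq (t u : kpterm) : Prop :=
  forall (A : nuAlgType K) (F : KPfamily A), kpeval F t = kpeval F u.

Definition kpeqb (t u : kpterm) : bool := `[< kpeq t u >].

Fact kpeqb_refl : reflexive kpeqb.
Proof. by move=> t; apply/asboolP => A F. Qed.
Fact kpeqb_sym : symmetric kpeqb.
Proof.
by move=> t u; apply/asboolP/asboolP => tu A F; apply/esym; exact: tu.
Qed.
Fact kpeqb_trans : transitive kpeqb.
Proof.
move=> u t v /asboolP tu /asboolP uv; apply/asboolP => A F.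
by rewrite tu uv.
Qed.

Definition kpequiv := EquivRel kpeqb kpeqb_refl kpeqb_sym kpeqb_trans.

Definition KP : Type := {eq_quot kpequiv}.
HB.instance Definition _ := Choice.on KP.

Definition kpclass (t : kpterm) : KP := \pi_{eq_quot kpequiv} t.

Lemma kpclass_eq t u : kpclass t = kpclass u <-> kpeq t u.
Proof.
by split=> [/eqmodP/asboolP //|tu]; apply/eqmodP/asboolP.
Qed.

Definition kprepr (x : KP) : kpterm := repr (x : {eq_quot kpequiv}).

Lemma kpreprK x : kpclass (kprepr x) = x.
Proof. exact: reprK. Qed.

Lemma kpclass_surj x : exists t, x = kpclass t.
Proof. by exists (kprepr x); rewrite kpreprK. Qed.

Lemma kpeval_repr (A : nuAlgType K) (F : KPfamily A) t :
  kpeval F (kprepr (kpclass t)) = kpeval F t.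
Proof. by have /kpclass_eq := kpreprK (kpclass t); apply. Qed.

Definition kpadd (x y : KP) : KP := kpclass (TAdd (kprepr x) (kprepr y)).
Definition kpopp (x : KP) : KP := kpclass (TOpp (kprepr x)).
Definition kpscale (a : K) (x : KP) : KP := kpclass (TScale a (kprepr x)).
Definition kpmul (x y : KP) : KP := kpclass (TMul (kprepr x) (kprepr y)).

Lemma kpaddE t u : kpadd (kpclass t) (kpclass u) = kpclass (TAdd t u).
Proof. by apply/kpclass_eq => A F /=; rewrite !kpeval_repr. Qed.
Lemma kpoppE t : kpopp (kpclass t) = kpclass (TOpp t).
Proof. by apply/kpclass_eq => A F /=; rewrite !kpeval_repr. Qed.
Lemma kpscaleE a t : kpscale a (kpclass t) = kpclass (TScale a t).
Proof. by apply/kpclass_eq => A F /=; rewrite !kpeval_repr. Qed.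
Lemma kpmulE t u : kpmul (kpclass t) (kpclass u) = kpclass (TMul t u).
Proof. by apply/kpclass_eq => A F /=; rewrite !kpeval_repr. Qed.

Fact kp_addA : associative kpadd.
Proof.
move=> x y z; have [t ->] := kpclass_surj x; have [u ->] := kpclass_surj y.
have [w ->] := kpclass_surj z; rewrite !kpaddE.
by apply/kpclass_eq => A F /=; rewrite addrA.
Qed.
Fact kp_addC : commutative kpadd.
Proof.
move=> x y; have [t ->] := kpclass_surj x; have [u ->] := kpclass_surj y.
by rewrite !kpaddE; apply/kpclass_eq => A F /=; rewrite addrC.
Qed.
Fact kp_add0 : left_id (kpclass TZero) kpadd.
Proof.
move=> x; have [t ->] := kpclass_surj x.
by rewrite !kpaddE; apply/kpclass_eq => A F /=; rewrite add0r.
Qed.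
Fact kp_addN : left_inverse (kpclass TZero) kpopp kpadd.
Proof.
move=> x; have [t ->] := kpclass_surj x.
by rewrite kpoppE !kpaddE; apply/kpclass_eq => A F /=; rewrite addNr.
Qed.

HB.instance Definition _ :=
  GRing.isZmodule.Build KP kp_addA kp_addC kp_add0 kp_addN.

Fact kp_mulA : associative kpmul.
Proof.
move=> x y z; have [t ->] := kpclass_surj x; have [u ->] := kpclass_surj y.
have [w ->] := kpclass_surj z; rewrite !kpmulE.
by apply/kpclass_eq => A F /=; rewrite nmulA.
Qed.
Fact kp_mulDl : left_distributive kpmul kpadd.
Proof.
move=> x y z; have [t ->] := kpclass_surj x; have [u ->] := kpclass_surj y.
have [w ->] := kpclass_surj z; rewrite kpaddE !kpmulE kpaddE.
by apply/kpclass_eq => A F /=; rewrite nmulDl.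
Qed.
Fact kp_mulDr : right_distributive kpmul kpadd.
Proof.
move=> x y z; have [t ->] := kpclass_surj x; have [u ->] := kpclass_surj y.
have [w ->] := kpclass_surj z; rewrite kpaddE !kpmulE kpaddE.
by apply/kpclass_eq => A F /=; rewrite nmulDr.
Qed.

HB.instance Definition _ :=
  Zmodule_isNonUnitalRing.Build KP kp_mulA kp_mulDl kp_mulDr.

Fact kp_scaleA a b x : kpscale a (kpscale b x) = kpscale (a * b) x.
Proof.
have [t ->] := kpclass_surj x.
by rewrite !kpscaleE; apply/kpclass_eq => A F /=; rewrite scalerA.
Qed.
Fact kp_scale1 : left_id 1 kpscale.
Proof.
move=> x; have [t ->] := kpclass_surj x.
by rewrite !kpscaleE; apply/kpclass_eq => A F /=; rewrite scale1r.
Qed.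
Fact kp_scaleDr : right_distributive kpscale kpadd.
Proof.
move=> a x y; have [t ->] := kpclass_surj x; have [u ->] := kpclass_surj y.
rewrite kpaddE !kpscaleE kpaddE.
by apply/kpclass_eq => A F /=; rewrite scalerDr.
Qed.
Fact kp_scaleDl x a b : kpscale (a + b) x = kpadd (kpscale a x) (kpscale b x).
Proof.
have [t ->] := kpclass_surj x; rewrite !kpscaleE kpaddE.
by apply/kpclass_eq => A F /=; rewrite scalerDl.
Qed.

HB.instance Definition _ :=
  GRing.Zmodule_isLmodule.Build K KP kp_scaleA kp_scale1 kp_scaleDr kp_scaleDl.

Fact kp_scaleAl (a : K) (x y : KP) : a *: (x ** y) = (a *: x) ** y.
Proof.
rewrite -[LHS]/(kpscale a (kpmul x y)) -[RHS]/(kpmul (kpscale a x) y).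
have [t ->] := kpclass_surj x; have [u ->] := kpclass_surj y.
rewrite kpscaleE !kpmulE kpscaleE.
by apply/kpclass_eq => A F /=; rewrite nscaleAl.
Qed.
Fact kp_scaleAr (a : K) (x y : KP) : a *: (x ** y) = x ** (a *: y).
Proof.
rewrite -[LHS]/(kpscale a (kpmul x y)) -[RHS]/(kpmul x (kpscale a y)).
have [t ->] := kpclass_surj x; have [u ->] := kpclass_surj y.
rewrite kpscaleE !kpmulE kpscaleE.
by apply/kpclass_eq => A F /=; rewrite nscaleAr.
Qed.

HB.instance Definition _ :=
  NonUnitalRing_isAlgebra.Build K KP kp_scaleAl kp_scaleAr.

Definition kpp (v : kvert G) : KP := kpclass (TP v).
Definition kps (l : nzpath) : KP := kpclass (TS l).
Definition kpt (l : nzpath) : KP := kpclass (TT l).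

Lemma kpclass_sum (I : Type) (s : seq I) (f : I -> kpterm) :
  \sum_(i <- s) kpclass (f i) =
  kpclass (foldr (fun i t => TAdd (f i) t) TZero s).
Proof.
elim: s => [|i s IH]; first by rewrite big_nil.
by rewrite big_cons IH -[LHS]/(kpadd _ _) kpaddE.
Qed.

Lemma kpeval_sum (A : nuAlgType K) (F : KPfamily A) (I : Type) (s : seq I)
    (f : I -> kpterm) :
  kpeval F (foldr (fun i t => TAdd (f i) t) TZero s) =
  \sum_(i <- s) kpeval F (f i).
Proof. by elim: s => [|i s IH]; rewrite ?big_nil // big_cons /= IH. Qed.

Lemma nmulE t u : kpclass t ** kpclass u = kpclass (TMul t u).
Proof. exact: kpmulE. Qed.

Hypothesis G_rf : row_finite_no_sources G.

Fact finite_nzpaths v n :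
  finite_set [set l : nzpath | paths_from v n (val l)].
Proof.
have [fin _] := G_rf v n.
apply: (@finite_preimage _ _ [set l : G | paths_from v n l] val) => //.
by move=> l m _ _; exact: val_inj.
Qed.

Fact kpP1 v w : kpp v ** kpp w = if v == w then kpp v else 0.
Proof.
rewrite nmulE; have [->|vw] := eqVneq v w.
  by apply/kpclass_eq => A F /=; rewrite (KP1 F) eqxx.
by apply/kpclass_eq => A F /=; rewrite (KP1 F) (negPf vw).
Qed.
Fact kpP3 l m : kdeg (val l) = kdeg (val m) ->
  kpt l ** kps m = if l == m then kpp (ksrc (val l)) else 0.
Proof.
move=> lm; rewrite nmulE; have [e|ne] := eqVneq l m.
  by apply/kpclass_eq => A F /=; rewrite (KP3 F lm) e eqxx.
by apply/kpclass_eq => A F /=; rewrite (KP3 F lm) (negPf ne).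
Qed.
Fact kpP4 v (n : Nk k) : n != 0 ->
  kpp v = \sum_(l \in [set l : nzpath | paths_from v n (val l)]) kps l ** kpt l.
Proof.
move=> n0; have fin := finite_nzpaths v n.
rewrite (@fsbig_finite _ _ _ _ _ _ fin) /=.
under eq_bigr do rewrite nmulE.
rewrite kpclass_sum; apply/kpclass_eq => A F.
by rewrite kpeval_sum /= (KP4 F v n0) (@fsbig_finite _ _ _ _ _ _ fin).
Qed.

Definition KP_family : KPfamily KP.
Proof.
refine (@KPFamily KP kpp kps kpt kpP1 _ _ _ _ _ _ kpP3 kpP4) => *;
  rewrite nmulE; apply/kpclass_eq => A F /=.
- exact: KP2s.
- exact: KP2t.
- exact: KP2rs.
- exact: KP2ss.
- exact: KP2st.
- exact: KP2rt.
Defined.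

Lemma KP_universal (A : nuAlgType K) (F : KPfamily A) :
  exists! f : KP -> A,
    [/\ linear f, {morph f : x y / x ** y} &
      [/\ forall v, f (kpp v) = KPp F v, forall l, f (kps l) = KPs F l &
          forall l, f (kpt l) = KPt F l]].
Proof.
pose f x := kpeval F (kprepr x); have fE t : f (kpclass t) = kpeval F t.
  exact: kpeval_repr.
exists f; split.
  split; last by split=> *; exact: fE.
    move=> a x y; rewrite -[a *: x + y]/(kpadd (kpscale a x) y).
    have [t ->] := kpclass_surj x; have [u ->] := kpclass_surj y.
    by rewrite kpscaleE kpaddE !fE.
  move=> x y; have [t ->] := kpclass_surj x; have [u ->] := kpclass_surj y.
  by rewrite nmulE !fE.
move=> g [gL gM [gp gs gt]]; apply/funext => x.
have [t ->] := kpclass_surj x; rewrite fE.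
have g0 : g 0 = 0.
  have := gL 0 0 0; rewrite !scale0r !addr0 => g00.
  by have := gL 1 0 0; rewrite !scale1r addr0 => /(congr1 (+%R^~ (- g 0)));
     rewrite addrK subrr => <-.
have gD y z : g (y + z) = g y + g z by have := gL 1 y z; rewrite !scale1r.
have gZ a y : g (a *: y) = a *: g y by have := gL a y 0; rewrite g0 !addr0.
have gN y : g (- y) = - g y by rewrite -scaleN1r gZ scaleN1r.
elim: t => [v|l|l||t IHt u IHu|t IHt|a t IHt|t IHt u IHu] /=.
- by rewrite -gp.
- by rewrite -gs.
- by rewrite -gt.
- by rewrite -[LHS]g0.
- by rewrite IHt IHu -gD -[kpclass t + _]/(kpadd _ _) kpaddE.
- by rewrite IHt -gN -[- _]/(kpopp _) kpoppE.
- by rewrite IHt -gZ -[a *: _]/(kpscale _ _) kpscaleE.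
- by rewrite IHt IHu -gM nmulE.
Qed.

End KumjianPask.

(* Main.v *)
(* Call a family [e x y], for [x] and [y] in the same block of a countable set,
   a matrix-unit basis if [e x y e z w = delta_(y,z) e x w], no [e x x] vanishes
   and the [e x y] span.  Such an algebra is a direct sum of matrix algebras
   over [K], is semisimple, hence von Neumann regular, and each finitely
   generated unital module over it is a finite direct sum of simple modules
   [A (e x x)], with multiplicities counted by the dimensions of the corners.

   If every infinite path meets a line point, KP has such a basis, indexed by
   the infinite paths with tail equivalence as blocks: when [x = l z] and
   [y = m z] with [z] the only path out of a line point, [e x y = s_l s_m^*];
   aperiodicity of [z] makes this independent of [l] and [m].

   Conversely, if KP equals its socle, it is von Neumann regular and each [p_v]
   lies in a finite sum of minimal left ideals.  The descending chain condition
   in that sum forces every infinite path to reach a vertex with a single path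
   out of it, and regularity makes that path aperiodic.  Finally, over a regular
   ring the atoms of V are zero or classes of simple modules, so atomicity of V
   and regularity put every idempotent in the socle. *)
Require Import Defs.
From HB Require Import structures.
From mathcomp Require Import all_boot all_order all_algebra finmap.
From mathcomp Require Import boolp classical_sets functions cardinality fsbigop.

Set Implicit Arguments.
Unset Strict Implicit.
Unset Printing Implicit Defensive.

Import GRing.Theory.
Local Open Scope ring_scope.
Local Notation "x ** y" := (nmul x y) (at level 40, left associativity).

(** * Paths and infinite paths *)

(** KP is given only by a universal property, so nothing in it is known to be nonzero until it acts
    on something. Functions on infinite paths would do, except that if [x] is the only path out of
    [v] and [sigma p x = sigma q x], then [p_v] and [s_(x(0,p)) s_(x(0,q))^*] act on them in the
    same way: periodicity is invisible. The extra integer coordinate of the representation separates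
    the two.

    Matrix units are stated as a property of a family rather than as an isomorphism, so that one
    notion serves KP and the direct sums alike and transports along isomorphisms. Simplicity,
    semiprimeness and the structure of modules then rest on a single fact: a nonzero element of
    [A (e y y)] can be multiplied on the left back to [e y y].

    Neither a span nor V comes with chosen coordinates. The isomorphisms are therefore obtained from
    relations that compare invariants (corner coefficients, multiplicities), shown total and
    functional in both directions. *)

Section DegreeMonoid.
Variable k : nat.
Implicit Types m n p : Nk k.

Lemma addNkI m : injective (+%R m : Nk k -> Nk k).
Proof.
move=> n p /ffunP e; apply/ffunP => i; have := e i.
by rewrite !addNkE => /addnI.
Qed.

Lemma le0Nk n : leNk 0 n.
Proof. by apply/leNkP => i; rewrite ffunE. Qed.

Lemma leNk_addr m n : leNk m (m + n).
Proof. by apply/leNkP => i; rewrite addNkE leq_addr. Qed.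

Lemma leNk_addl m n : leNk m (n + m).
Proof. by rewrite addrC leNk_addr. Qed.

Lemma subNkKC m n : leNk m n -> m + subNk n m = n.
Proof.
by move=> /leNkP mn; apply/ffunP => i; rewrite addNkE subNkE subnKC.
Qed.

Lemma subNk0 n : subNk n 0 = n.
Proof. by apply/ffunP => i; rewrite !ffunE subn0. Qed.

End DegreeMonoid.

Section Factorisations.
Variables (k : nat) (G : kGraph k).
Implicit Types (a b l : G) (m n : Nk k).

(** Unique factorisation as a cancellation law: once the left factors have equal degrees,
    cancellation in [Nk k] equates the degrees of the right ones. *)
Lemma kcomp_inj a b a' b' : ksrc a = krng b -> ksrc a' = krng b' ->
  kdeg a = kdeg a' -> kcomp a b = kcomp a' b' -> a = a' /\ b = b'.
Proof.
move=> ab ab' d e.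
have db : kdeg b = kdeg b'.
  apply: (@addNkI _ (kdeg a)); rewrite -kdeg_comp // e kdeg_comp //.
  by rewrite d.
have [p [_ pu]] := kfactor (kdeg_comp ab).
by have [<- <-] : (a, b) = (a', b');
   [rewrite -(pu (a, b)) // -(pu (a', b')) | ].
Qed.

Definition factor_at n l : set (G * G) :=
  [set p | [/\ ksrc p.1 = krng p.2, kdeg p.1 = n & l = kcomp p.1 p.2]]%classic.

(* For [n] not below [kdeg l], [pre n l] and [suf n l] are the junk value [l]. *)
Definition pre n l : G := (xget (l, l) (factor_at n l)).1.
Definition suf n l : G := (xget (l, l) (factor_at n l)).2.

Lemma presufP n l : leNk n (kdeg l) ->
  [/\ ksrc (pre n l) = krng (suf n l), kdeg (pre n l) = n &
      l = kcomp (pre n l) (suf n l)].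
Proof.
move=> nl; have /esym dl := subNkKC nl; have [p [[]]] := kfactor dl.
move=> h1 h2 _ h3 _; rewrite /pre /suf; case: xgetP => [q _ //|].
by move=> /(_ p) [].
Qed.

Lemma pre_comp a b : ksrc a = krng b -> pre (kdeg a) (kcomp a b) = a.
Proof.
move=> ab; have []// := @presufP (kdeg a) (kcomp a b).
  by rewrite kdeg_comp // leNk_addr.
by move=> h1 h2 /esym /kcomp_inj[].
Qed.

Lemma suf_comp a b : ksrc a = krng b -> suf (kdeg a) (kcomp a b) = b.
Proof.
move=> ab; have []// := @presufP (kdeg a) (kcomp a b).
  by rewrite kdeg_comp // leNk_addr.
by move=> h1 h2 /esym /kcomp_inj[].
Qed.

Lemma pre_kcomp n a b : ksrc a = krng b -> leNk n (kdeg a) ->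
  pre n (kcomp a b) = pre n a.
Proof.
move=> ab /presufP[h1 h2 h3].
have h4 : ksrc (suf n a) = krng b by rewrite -ab {2}h3 ksrc_comp.
rewrite {1}h3 -kcompA // -{1}h2 pre_comp // krng_comp //.
Qed.

Lemma pre_pre m n l : leNk m n -> leNk n (kdeg l) ->
  pre m (pre n l) = pre m l.
Proof.
move=> mn /presufP[h1 h2 h3]; rewrite [in RHS]h3 pre_kcomp //.
by rewrite h2.
Qed.

Lemma pre_full l : pre (kdeg l) l = l.
Proof. by rewrite -{2}(kcomp_idr l) pre_comp // krng_id. Qed.

(** [l] followed by the identity of its source and the identity of its range followed by [l] are the
    same path, with left factors of degree 0; uniqueness equates these factors. *)
Lemma kid_deg0 l : kdeg l = 0 -> l = kid (krng l).
Proof.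
move=> l0; have [] := @kcomp_inj l (kid (ksrc l)) (kid (krng l)) l => //.
- by rewrite krng_id.
- by rewrite ksrc_id.
- by rewrite l0 kdeg_id.
- by rewrite kcomp_idl kcomp_idr.
Qed.

End Factorisations.

Section InfinitePaths.
Variables (k : nat) (G : kGraph k).
Implicit Types (x y z : infpath G) (l : G) (m n p q : Nk k).

Definition ini x n : G := x (omega_seg (le0Nk n)).

Lemma krng_ini x n : krng (ini x n) = infpath_at x 0.
Proof. exact: kmorph_rng. Qed.

Lemma ksrc_ini x n : ksrc (ini x n) = infpath_at x n.
Proof. exact: kmorph_src. Qed.

Lemma kdeg_ini x n : kdeg (ini x n) = n.
Proof. by rewrite kmorph_deg /= /omega_deg /= subNk0. Qed.

Lemma ini0 x : ini x 0 = kid (infpath_at x 0).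
Proof. by rewrite [LHS]kid_deg0 ?kdeg_ini ?krng_ini. Qed.

Lemma ini_seg x m n (mn : leNk m n) :
  ini x n = kcomp (ini x m) (x (omega_seg mn)).
Proof.
rewrite -kmorph_comp //; apply: (congr1 (kmorph_path x)).
by apply: val_inj; rewrite val_omega_comp.
Qed.

Lemma seg_src x m n (mn : leNk m n) :
  ksrc (ini x m) = krng (x (omega_seg mn)).
Proof. by rewrite ksrc_ini kmorph_rng. Qed.

Lemma pre_ini x m n : leNk m n -> pre m (ini x n) = ini x m.
Proof.
move=> mn; rewrite (ini_seg x mn) -{1}(kdeg_ini x m) pre_comp //.
exact: seg_src.
Qed.

Lemma ini_add x p n : ini x (p + n) = kcomp (ini x p) (ini (sigma p x) n).
Proof.
rewrite (ini_seg x (leNk_addr p n)); congr kcomp.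
apply: (congr1 (kmorph_path x)); apply: val_inj.
by rewrite /= add0r addrC.
Qed.

Lemma ini_add_src x p n : ksrc (ini x p) = krng (ini (sigma p x) n).
Proof. by rewrite ksrc_ini krng_ini /infpath_at /= add0r. Qed.

Lemma infpath_at_sigma p x n : infpath_at (sigma p x) n = infpath_at x (n + p).
Proof. by []. Qed.

Lemma infpath_at_sigma0 p x : infpath_at (sigma p x) 0 = infpath_at x p.
Proof. by rewrite infpath_at_sigma add0r. Qed.

Lemma sigma_sigma p q x : sigma p (sigma q x) = sigma (p + q) x.
Proof.
apply: kGraph_morphP => l; apply: (congr1 (kmorph_path x)).
by apply: val_inj; rewrite /= !addrA.
Qed.

(** A segment [x(m, n)] is recovered by cancelling [ini x m] in [ini x n], and a long common segment
    restricts to all shorter ones. *)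
Lemma ini_cofinal x y :
  (forall n, exists2 m, leNk n m & ini x m = ini y m) -> x = y.
Proof.
move=> xy.
have h n : ini x n = ini y n.
  by have [m nm e] := xy n; rewrite -(pre_ini x nm) e pre_ini.
apply: kGraph_morphP => -[[m n] mn].
have := h n; rewrite (ini_seg x mn) (ini_seg y mn).
by move=> /kcomp_inj[]; rewrite ?(seg_src _ mn) ?h.
Qed.

Lemma ini_inj x y : (forall n, ini x n = ini y n) -> x = y.
Proof. by move=> xy; apply: ini_cofinal => n; exists n; rewrite ?leNk_refl. Qed.

Lemma sigma0 x : sigma 0 x = x.
Proof.
apply: ini_inj => n; have := ini_add x 0 n; rewrite add0r => e.
rewrite [RHS]e ini0 -(infpath_at_sigma0 0) -(krng_ini _ n).
by rewrite kcomp_idl.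
Qed.

Lemma infpath_eq p x y : ini x p = ini y p -> sigma p x = sigma p y -> x = y.
Proof.
move=> e s; apply: ini_cofinal => n; exists (p + n); first exact: leNk_addl.
by rewrite !ini_add e s.
Qed.

(** [Q n] may be longer than [n], so any convenient cofinal chain of paths can be fed in; only the
    prefix of degree [n] is kept. The value on [(m, n)] is forced to be what remains of the
    [n]-prefix after the [m]-prefix, and functoriality is uniqueness of factorisation. *)
Lemma infpath_coherent (Q : Nk k -> G) :
  (forall n, leNk n (kdeg (Q n))) ->
  (forall m n, leNk m n -> pre m (Q n) = pre m (Q m)) ->
  exists x, forall n, ini x n = pre n (Q n).
Proof.
move=> Qd Qc; pose P n := pre n (Q n).
have dP n : kdeg (P n) = n by case: (presufP (Qd n)).
have dP' m n : leNk m n -> leNk m (kdeg (P n)) by rewrite dP.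
have PP m n : leNk m n -> pre m (P n) = P m.
  by move=> mn; rewrite /P pre_pre // Qc.
have sP m n : leNk m n ->
    ksrc (P m) = krng (suf m (P n)) /\ P n = kcomp (P m) (suf m (P n)).
  by move=> mn; have [] := presufP (dP' _ _ mn); rewrite PP.
have sufE m n b : leNk m n -> ksrc (P m) = krng b -> P n = kcomp (P m) b ->
    suf m (P n) = b.
  by move=> mn mb ->; rewrite -{1}(dP m) suf_comp.
pose f (l : Omega k) := suf (val l).1 (P (val l).2).
have frng (l : Omega k) : krng (f l) = ksrc (P (krng l)).
  by rewrite (sP _ _ (valP l)).1.
have fsrc (l : Omega k) : ksrc (f l) = ksrc (P (ksrc l)).
  by have [h1 h2] := sP _ _ (valP l); rewrite [in RHS]h2 ksrc_comp.
have fid (v : kvert (Omega k)) : f (kid v) = kid (ksrc (P v)).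
  by apply: sufE; rewrite /= ?leNk_refl ?krng_id ?kcomp_idr.
have fcomp (l m : Omega k) : ksrc l = krng m ->
    f (kcomp l m) = kcomp (f l) (f m).
  move=> lm.
  have [h1 h2] := sP _ _ (valP l); have [h3 h4] := sP _ _ (valP m).
  have fE : ksrc (f l) = krng (f m) by rewrite fsrc frng lm.
  rewrite {1}/f val_omega_comp //=; apply: sufE.
  - apply: leNk_trans (valP l) _.
    by rewrite [(val l).2]lm (valP m).
  - by rewrite krng_comp.
  - by rewrite kcompA // -h2 [(val l).2]lm -h4.
have fdeg (l : Omega k) : kdeg (f l) = kdeg l.
  have [h1 h2] := sP _ _ (valP l).
  apply: (@addNkI _ (val l).1); rewrite [RHS]subNkKC; last exact: (valP l).
  by rewrite -[X in X + _]dP -kdeg_comp // -h2 dP.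
exists (KMorph frng fsrc fid fcomp fdeg) => n.
have [h1 h2] := sP _ _ (le0Nk n); have P0 := kid_deg0 (dP 0).
have Pn : krng (P n) = krng (P 0) by rewrite h2 krng_comp.
apply: (sufE 0 n _ (le0Nk n)); first by rewrite Pn P0 ksrc_id krng_id.
by rewrite P0 -Pn kcomp_idl.
Qed.

Lemma prepend_ex l x : ksrc l = infpath_at x 0 ->
  exists y, ini y (kdeg l) = l /\ sigma (kdeg l) y = x.
Proof.
move=> lx; have lxn n : ksrc l = krng (ini x n) by rewrite krng_ini.
pose Q n := kcomp l (ini x n).
have Qd n : kdeg (Q n) = kdeg l + n by rewrite kdeg_comp // kdeg_ini.
have Qseg m n (mn : leNk m n) : Q n = kcomp (Q m) (x (omega_seg mn)).
  by rewrite /Q (ini_seg x mn) kcompA //; exact: seg_src.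
have Qsrc m n (mn : leNk m n) : ksrc (Q m) = krng (x (omega_seg mn)).
  by rewrite /Q ksrc_comp //; exact: seg_src.
have pQ p m n : leNk p (kdeg l + m) -> leNk m n -> pre p (Q n) = pre p (Q m).
  by move=> pm mn; rewrite (Qseg _ _ mn) pre_kcomp ?Qd.
have [y yQ] : exists y, forall n, ini y n = pre n (Q n).
  apply: infpath_coherent => [n|m n mn]; first by rewrite Qd leNk_addl.
  by apply: pQ => //; exact: leNk_addl.
have yl n : ini y (kdeg l + n) = Q n.
  rewrite yQ (pQ _ n) //; [|exact: leNk_refl|exact: leNk_addl].
  by rewrite -Qd pre_full.
have y0 : ini y (kdeg l) = l.
  by rewrite -[kdeg l]addr0 yl /Q ini0 -lx kcomp_idr.
exists y; split=> //; apply: ini_inj => n.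
have := yl n; rewrite ini_add y0 => /kcomp_inj[] //.
by rewrite -{1}y0; exact: ini_add_src.
Qed.

(* Junk value [x] when [l] and [x] are not composable. *)
Definition prepend l x : infpath G :=
  if pselect (ksrc l = infpath_at x 0) is left e
  then projT1 (cid (prepend_ex e)) else x.

Lemma prependP l x : ksrc l = infpath_at x 0 ->
  ini (prepend l x) (kdeg l) = l /\ sigma (kdeg l) (prepend l x) = x.
Proof. by rewrite /prepend; case: pselect => // e _; case: cid. Qed.

Lemma prepend_eq l y : ini y (kdeg l) = l -> prepend l (sigma (kdeg l) y) = y.
Proof.
move=> yl; have [|h1 h2] := @prependP l (sigma (kdeg l) y).
  by rewrite infpath_at_sigma0 -ksrc_ini yl.
by apply: (infpath_eq (p := kdeg l)); rewrite ?yl.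
Qed.

Lemma infpath_at_prepend l x : ksrc l = infpath_at x 0 ->
  infpath_at (prepend l x) 0 = krng l.
Proof. by move=> /prependP[h _]; rewrite -[in RHS]h krng_ini. Qed.

Lemma prepend_comp a b x : ksrc a = krng b -> ksrc b = infpath_at x 0 ->
  prepend (kcomp a b) x = prepend a (prepend b x).
Proof.
move=> ab bx.
have [h1 h2] : ini (prepend (kcomp a b) x) (kdeg (kcomp a b)) = kcomp a b /\
    sigma (kdeg (kcomp a b)) (prepend (kcomp a b) x) = x.
  by apply: prependP; rewrite ksrc_comp.
have [h3 h4] := prependP bx.
have [|h5 h6] := @prependP a (prepend b x); first by rewrite infpath_at_prepend.
apply: (infpath_eq (p := kdeg (kcomp a b))).
  by rewrite h1 kdeg_comp // ini_add h5 h6 h3.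
by rewrite h2 kdeg_comp // addrC -sigma_sigma h6.
Qed.

(** The multiples of this degree are cofinal in [Nk k], so steps of degree [ones] along the diagonal
    pass every degree. *)
Definition ones : Nk k := [ffun=> 1%N].

(** Dependent choice along the diagonal. [P] is controlled at the diagonal vertices alone, hence the
    conclusion promises only some [m] above each [n]. *)
Lemma infpath_choice (P : kvert G -> Prop) (v : kvert G) :
  (forall w, P w ->
    exists l : G, [/\ krng l = w, kdeg l = ones & P (ksrc l)]) ->
  P v -> exists y, infpath_at y 0 = v /\
    forall n, exists2 m, leNk n m & P (infpath_at y m).
Proof.
move=> Pn Pv.
have [nxt nxtP] : {nxt : kvert G -> G & forall w, P w ->
    [/\ krng (nxt w) = w, kdeg (nxt w) = ones & P (ksrc (nxt w))]}.
  apply: (@choice _ _ (fun w l => P w ->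
    [/\ krng l = w, kdeg l = ones & P (ksrc l)])) => w.
  have [Pw|nPw] := pselect (P w); last by exists (kid w).
  by have [l lP] := Pn w Pw; exists l.
pose q := fix q j : G :=
  if j is j'.+1 then kcomp (q j') (nxt (ksrc (q j'))) else kid v.
have qP j : [/\ krng (q j) = v, kdeg (q j) = [ffun=> j] & P (ksrc (q j))].
  elim: j => [|j [h1 h2 h3]] /=.
    by rewrite krng_id ksrc_id kdeg_id; split=> //; apply/ffunP=> i; rewrite !ffunE.
  have [h4 h5 h6] := nxtP _ h3.
  rewrite krng_comp // ksrc_comp // kdeg_comp //; split=> //.
  by rewrite h2 h5; apply/ffunP => i; rewrite addNkE !ffunE addn1.
have qS i j : exists2 b, ksrc (q i) = krng b & q (i + j)%N = kcomp (q i) b.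
  elim: j => [|j [b ib IH]].
    by exists (kid (ksrc (q i))); rewrite ?krng_id // addn0 kcomp_idr.
  have [_ _ /nxtP[h4 h5 h6]] := qP (i + j)%N.
  have e : ksrc b = krng (nxt (ksrc (q (i + j)%N))).
    by rewrite h4 IH ksrc_comp.
  exists (kcomp b (nxt (ksrc (q (i + j)%N)))); first by rewrite krng_comp.
  by rewrite kcompA // -IH addnS.
(* The first diagonal point above [n], so that [q (N n)] has a prefix of degree [n]. *)
pose N (n : Nk k) := (\max_i n i)%N.
have leN m n : leNk m n -> (N m <= N n)%N.
  move=> /leNkP mn; apply/bigmax_leqP => i _.
  by apply: leq_trans (mn i) _; exact: leq_bigmax.
have leNd n : leNk n (kdeg (q (N n))).
  by have [_ -> _] := qP (N n); apply/leNkP => i; rewrite ffunE; exact: leq_bigmax.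
have qpre m i j : leNk m (kdeg (q i)) -> (i <= j)%N -> pre m (q j) = pre m (q i).
  move=> mi /subnKC <-; have [b ib ->] := qS i (j - i)%N.
  by rewrite pre_kcomp.
have [y yQ] : exists y, forall n, ini y n = pre n (q (N n)).
  by apply: infpath_coherent => [//|m n mn]; apply: qpre => //; exact: leN.
exists y; split=> [|n].
  rewrite -(krng_ini y 0) yQ; have [] := presufP (le0Nk (kdeg (q (N 0)))).
  by move=> h1 h2 h3; rewrite -(krng_comp h1) -h3; case: (qP (N 0)).
exists (kdeg (q (N n))) => //; rewrite -ksrc_ini yQ.
rewrite (qpre _ (N n)) ?leNk_refl ?pre_full ?leN //.
by case: (qP (N n)).
Qed.

Lemma infpath_from (G_rf : row_finite_no_sources G) (v : kvert G) :
  exists x : infpath G, infpath_at x 0 = v.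
Proof.
have [|x [xv _]] := @infpath_choice (fun=> True) v _ I; last by exists x.
by move=> w _; have [_ [l [lw ld]]] := G_rf w ones; exists l.
Qed.

End InfinitePaths.

(** * Non-unital rings and algebras of linear operators *)

Section NonUnitalBasics.
Variable R : nuRingType.
Implicit Types x y z : R.

Lemma nmulrN x y : x ** - y = - (x ** y).
Proof. by apply: (addrI (x ** y)); rewrite -nmulDr !subrr nmulr0. Qed.

Lemma nmulNr x y : - x ** y = - (x ** y).
Proof. by apply: (addrI (x ** y)); rewrite -nmulDl !subrr nmul0r. Qed.

Lemma nmulBr x y z : x ** (y - z) = x ** y - x ** z.
Proof. by rewrite nmulDr nmulrN. Qed.

Lemma nmulBl x y z : (x - y) ** z = x ** z - y ** z.
Proof. by rewrite nmulDl nmulNr. Qed.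

Lemma nmul_sumr (I : Type) (s : seq I) (P : pred I) (f : I -> R) x :
  x ** (\sum_(i <- s | P i) f i) = \sum_(i <- s | P i) x ** f i.
Proof. exact: (big_morph _ (nmulDr x) (nmulr0 x)). Qed.

Lemma nmul_suml (I : Type) (s : seq I) (P : pred I) (f : I -> R) x :
  (\sum_(i <- s | P i) f i) ** x = \sum_(i <- s | P i) f i ** x.
Proof.
exact: (big_morph (fun y => y ** x) (fun y z => nmulDl y z x) (nmul0r x)).
Qed.

End NonUnitalBasics.

Section LinearOperators.
Variables (K : comPzRingType) (V : lmodType K).

Record linop := LinOp { linop_fun :> V -> V; _ : linear linop_fun }.

HB.instance Definition _ := gen_eqMixin linop.
HB.instance Definition _ := gen_choiceMixin linop.

Lemma linopP (f g : linop) : (forall x, f x = g x) -> f = g.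
Proof.
case: f g => [f fP] [g gP] /= fg.
have e : f = g by apply/funext.
by case: _ / e gP => gP; congr LinOp; exact: Prop_irrelevance.
Qed.

Fact linop_linear (f : linop) : linear f.
Proof. by case: f. Qed.

Lemma linopD (f : linop) : {morph f : x y / x + y}.
Proof. by move=> x y; have := linop_linear f 1 x y; rewrite !scale1r. Qed.

Lemma linop0 (f : linop) : f 0 = 0.
Proof. by apply: (addrI (f 0)); rewrite -linopD !addr0. Qed.

Lemma linopZ (f : linop) a x : f (a *: x) = a *: f x.
Proof. by have := linop_linear f a x 0; rewrite linop0 !addr0. Qed.

Fact linop_zero_subproof : linear (fun _ : V => 0 : V).
Proof. by move=> a x y; rewrite scaler0 addr0. Qed.
Definition linop_zero := LinOp linop_zero_subproof.

Fact linop_add_subproof (f g : linop) : linear (fun x => f x + g x).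
Proof. by move=> a x y; rewrite !linopD !linopZ scalerDr addrACA. Qed.
Definition linop_add f g := LinOp (linop_add_subproof f g).

Fact linop_opp_subproof (f : linop) : linear (fun x => - f x).
Proof. by move=> a x y; rewrite linopD linopZ opprD scalerN. Qed.
Definition linop_opp f := LinOp (linop_opp_subproof f).

Fact linop_scale_subproof (b : K) (f : linop) : linear (fun x => b *: f x).
Proof.
by move=> a x y; rewrite linopD linopZ scalerDr !scalerA mulrC.
Qed.
Definition linop_scale b f := LinOp (linop_scale_subproof b f).

Fact linop_mul_subproof (f g : linop) : linear (fun x => f (g x)).
Proof. by move=> a x y; rewrite !(linopD, linopZ). Qed.
Definition linop_mul f g := LinOp (linop_mul_subproof f g).

Fact linop_addA : associative linop_add.
Proof. by move=> f g h; apply: linopP => x /=; rewrite addrA. Qed.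
Fact linop_addC : commutative linop_add.
Proof. by move=> f g; apply: linopP => x /=; rewrite addrC. Qed.
Fact linop_add0 : left_id linop_zero linop_add.
Proof. by move=> f; apply: linopP => x /=; rewrite add0r. Qed.
Fact linop_addN : left_inverse linop_zero linop_opp linop_add.
Proof. by move=> f; apply: linopP => x /=; rewrite addNr. Qed.

HB.instance Definition _ :=
  GRing.isZmodule.Build linop linop_addA linop_addC linop_add0 linop_addN.

Fact linop_mulA : associative linop_mul.
Proof. by move=> f g h; exact: linopP. Qed.
Fact linop_mulDl : left_distributive linop_mul +%R.
Proof. by move=> f g h; exact: linopP. Qed.
Fact linop_mulDr : right_distributive linop_mul +%R.
Proof. by move=> f g h; apply: linopP => x /=; rewrite linopD. Qed.

HB.instance Definition _ :=
  Zmodule_isNonUnitalRing.Build linop linop_mulA linop_mulDl linop_mulDr.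

Fact linop_scaleA a b f : linop_scale a (linop_scale b f) = linop_scale (a * b) f.
Proof. by apply: linopP => x /=; rewrite scalerA. Qed.
Fact linop_scale1 : left_id 1 linop_scale.
Proof. by move=> f; apply: linopP => x /=; rewrite scale1r. Qed.
Fact linop_scaleDr : right_distributive linop_scale +%R.
Proof. by move=> a f g; apply: linopP => x /=; rewrite scalerDr. Qed.
Fact linop_scaleDl f : {morph linop_scale^~ f : a b / a + b}.
Proof. by move=> a b; apply: linopP => x /=; rewrite scalerDl. Qed.

HB.instance Definition _ :=
  GRing.Zmodule_isLmodule.Build K linop
    linop_scaleA linop_scale1 linop_scaleDr linop_scaleDl.

Fact linop_scaleAl (a : K) (f g : linop) : a *: (f ** g) = (a *: f) ** g.
Proof. exact: linopP. Qed.
Fact linop_scaleAr (a : K) (f g : linop) : a *: (f ** g) = f ** (a *: g).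
Proof. by apply: linopP => x /=; rewrite linopZ. Qed.

HB.instance Definition _ :=
  NonUnitalRing_isAlgebra.Build K linop linop_scaleAl linop_scaleAr.

Lemma linop_sumE (I : Type) (s : seq I) (f : I -> linop) x :
  (\sum_(i <- s) f i) x = \sum_(i <- s) f i x.
Proof. exact: (big_morph (fun g : linop => g x)). Qed.

End LinearOperators.

(** * Kumjian-Pask families and the graded infinite-path representation *)

Section FamilyOnPaths.
Variables (k : nat) (G : kGraph k) (K : fieldType) (A : nuAlgType K).
Variable F : KPfamily G A.
Implicit Types (a b l : G) (v w : kvert G).

(** The generators are indexed by paths of nonzero degree. Letting a path of degree 0 stand for its
    vertex idempotent makes the relations uniform in the degree. *)
Definition Sx l : A :=
  if insub l is Some l' then KPs F l' else KPp F (krng l).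
Definition Tx l : A :=
  if insub l is Some l' then KPt F l' else KPp F (krng l).

Lemma Sx_val (l : nzpath G) : Sx (val l) = KPs F l.
Proof. by rewrite /Sx valK. Qed.
Lemma Tx_val (l : nzpath G) : Tx (val l) = KPt F l.
Proof. by rewrite /Tx valK. Qed.

Lemma Sx0 l : kdeg l = 0 -> Sx l = KPp F (krng l).
Proof. by move=> l0; rewrite /Sx insubF // l0 eqxx. Qed.
Lemma Tx0 l : kdeg l = 0 -> Tx l = KPp F (krng l).
Proof. by move=> l0; rewrite /Tx insubF // l0 eqxx. Qed.

Lemma deg0_src l : kdeg l = 0 -> ksrc l = krng l.
Proof. by move=> /kid_deg0 ->; rewrite ksrc_id krng_id. Qed.

Variant path_spec l : Prop :=
  | PathNz (n : nzpath G) of l = val n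
  | PathId of kdeg l = 0.

Lemma nzpathP l : path_spec l.
Proof.
have [|l0] := eqVneq (kdeg l) 0; first exact: PathId.
exact: (@PathNz _ (exist _ l l0 : nzpath G)).
Qed.

Lemma ppE v : KPp F v ** KPp F v = KPp F v.
Proof. by rewrite KP1 eqxx. Qed.

Lemma pSx l : KPp F (krng l) ** Sx l = Sx l.
Proof.
case: (nzpathP l) => [n ->|l0]; first by rewrite Sx_val KP2rs.
by rewrite Sx0 // ppE.
Qed.
Lemma Sxp l : Sx l ** KPp F (ksrc l) = Sx l.
Proof.
case: (nzpathP l) => [n ->|l0]; first by rewrite Sx_val KP2ss.
by rewrite Sx0 // deg0_src // ppE.
Qed.
Lemma pTx l : KPp F (ksrc l) ** Tx l = Tx l.
Proof.
case: (nzpathP l) => [n ->|l0]; first by rewrite Tx_val KP2st.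
by rewrite Tx0 // deg0_src // ppE.
Qed.
Lemma Txp l : Tx l ** KPp F (krng l) = Tx l.
Proof.
case: (nzpathP l) => [n ->|l0]; first by rewrite Tx_val KP2rt.
by rewrite Tx0 // ppE.
Qed.

Lemma kcomp_deg0l a b : ksrc a = krng b -> kdeg a = 0 -> kcomp a b = b.
Proof. by move=> ab a0; rewrite (kid_deg0 a0) -deg0_src // ab kcomp_idl. Qed.
Lemma kcomp_deg0r a b : ksrc a = krng b -> kdeg b = 0 -> kcomp a b = a.
Proof. by move=> ab b0; rewrite (kid_deg0 b0) -ab kcomp_idr. Qed.

Lemma kcomp_nz (a : nzpath G) b : ksrc (val a) = krng b ->
  exists n : nzpath G, val n = kcomp (val a) b.
Proof.
move=> ab; have h : kdeg (kcomp (val a) b) != 0.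
  rewrite kdeg_comp //; apply: contra (valP a) => /eqP/ffunP e.
  apply/eqP/ffunP => i; have := e i; rewrite addNkE => /eqP.
  by rewrite [X in _ == X]ffunE addn_eq0 => /andP[/eqP -> _]; rewrite ffunE.
by exists (exist _ (kcomp (val a) b) h : nzpath G).
Qed.

Lemma SxM a b : ksrc a = krng b -> Sx a ** Sx b = Sx (kcomp a b).
Proof.
move=> ab; case: (nzpathP a) ab => [a' ->|a0] ab; last first.
  by rewrite kcomp_deg0l // Sx0 // -deg0_src // ab pSx.
case: (nzpathP b) ab => [b' ->|b0] ab; last first.
  by rewrite kcomp_deg0r // [Sx b]Sx0 // -ab Sxp.
by have [n nE] := kcomp_nz ab; rewrite -nE !Sx_val; exact: KP2s.
Qed.

Lemma TxM a b : ksrc a = krng b -> Tx b ** Tx a = Tx (kcomp a b).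
Proof.
move=> ab; case: (nzpathP a) ab => [a' ->|a0] ab; last first.
  by rewrite kcomp_deg0l // (Tx0 a0) // -deg0_src // ab Txp.
case: (nzpathP b) ab => [b' ->|b0] ab; last first.
  by rewrite kcomp_deg0r // [Tx b]Tx0 // -ab pTx.
by have [n nE] := kcomp_nz ab; rewrite -nE !Tx_val; exact: KP2t.
Qed.

Lemma TxSx a b : kdeg a = kdeg b ->
  Tx a ** Sx b = if a == b then KPp F (ksrc a) else 0.
Proof.
case: (nzpathP a) => [a' ->|a0] ab.
  case: (nzpathP b) ab => [b' ->|b0] ab; last first.
    by have := valP a'; rewrite /= ab b0 eqxx.
  by rewrite Tx_val Sx_val KP3 // val_eqE.
have b0 : kdeg b = 0 by rewrite -ab.
rewrite Tx0 // Sx0 // KP1 deg0_src //; case: (a =P b) => [->|ne].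
  by rewrite eqxx.
by case: eqP => // e; case: ne; rewrite (kid_deg0 a0) (kid_deg0 b0) e.
Qed.

Lemma TxSx_id a : Tx a ** Sx a = KPp F (ksrc a).
Proof. by rewrite TxSx // eqxx. Qed.

Definition psum (s : seq (kvert G)) : A := \sum_(v <- s) KPp F v.

Lemma psum_absl s v (x : A) : uniq s -> v \in s -> KPp F v ** x = x ->
  psum s ** x = x.
Proof.
move=> us vs vx; rewrite -vx nmulA /psum nmul_suml (bigD1_seq v) //= ppE.
by rewrite big1 ?addr0 // => w /negPf wv; rewrite KP1 wv.
Qed.

Lemma psum_absr s v (x : A) : uniq s -> v \in s -> x ** KPp F v = x ->
  x ** psum s = x.
Proof.
move=> us vs vx; rewrite -vx -nmulA /psum nmul_sumr (bigD1_seq v) //= ppE.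
by rewrite big1 ?addr0 // => w /negPf wv; rewrite KP1 eq_sym wv.
Qed.

Hypothesis G_rf : row_finite_no_sources G.

Lemma pSxTx v (n : Nk k) : exists s : seq G,
  [/\ uniq s, forall l, l \in s <-> paths_from v n l &
      KPp F v = \sum_(l <- s) Sx l ** Tx l].
Proof.
have [n0|n0] := eqVneq n 0.
  exists [:: kid v]; split=> //.
    move=> l; rewrite inE n0; split=> [/eqP ->|[lv l0]].
      by split; rewrite ?krng_id ?kdeg_id.
    by rewrite (kid_deg0 l0) lv.
  by rewrite big_seq1 Sx0 ?Tx0 ?kdeg_id // krng_id ppE.
have fin := finite_nzpaths G_rf v n.
exists (map (fun l : nzpath G => val l : G)
  (fset_set [set l : nzpath G | paths_from v n (val l)]%classic)).
split.
- by rewrite map_inj_uniq; [exact: fset_uniq | exact: val_inj].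
- move=> l; split=> [/mapP[l' + ->]|[lv ln]].
    by rewrite in_fset_set // => /set_mem.
  have l0 : kdeg l != 0 by rewrite ln.
  apply/mapP; exists (exist _ l l0 : nzpath G) => //.
  by rewrite in_fset_set //; apply: mem_set.
rewrite big_map (KP4 F v n0) fsbig_finite //.
by apply: eq_bigr => l _; rewrite Sx_val Tx_val.
Qed.

End FamilyOnPaths.

Section GradedRepresentation.
Variables (k : nat) (G : kGraph k) (K : fieldType) (i : 'I_k).
Hypothesis G_rf : row_finite_no_sources G.

(* The integer argument records the degree in direction [i]; it makes the
   return along a periodic path act as a translation of infinite order. *)
Definition gspace : lmodType K := (infpath G -> int -> K^o)%type.
Implicit Types (f : gspace) (a b l : G) (v w : kvert G).

Definition dg l : int := (kdeg l i)%:Z.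

Definition shiftS l f : gspace := fun y n =>
  if ini y (kdeg l) == l then f (sigma (kdeg l) y) (n + dg l) else 0.
Definition shiftT l f : gspace := fun x n =>
  if ksrc l == infpath_at x 0 then f (prepend l x) (n - dg l) else 0.
Definition shiftP (v : kvert G) f : gspace := fun x n =>
  if infpath_at x 0 == v then f x n else 0.

Fact shiftS_linear l : linear (shiftS l).
Proof.
move=> a f g; apply/funext => y; apply/funext => n.
rewrite /shiftS [RHS]/GRing.add /= /GRing.scale /=.
by case: ifP => // _; rewrite -[RHS]/(a * 0 + 0 : K) mulr0 addr0.
Qed.
Fact shiftT_linear l : linear (shiftT l).
Proof.
move=> a f g; apply/funext => y; apply/funext => n.
rewrite /shiftT [RHS]/GRing.add /= /GRing.scale /=.
by case: ifP => // _; rewrite -[RHS]/(a * 0 + 0 : K) mulr0 addr0.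
Qed.
Fact shiftP_linear v : linear (shiftP v).
Proof.
move=> a f g; apply/funext => y; apply/funext => n.
rewrite /shiftP [RHS]/GRing.add /= /GRing.scale /=.
by case: ifP => // _; rewrite -[RHS]/(a * 0 + 0 : K) mulr0 addr0.
Qed.

Definition gopS l : linop gspace := LinOp (shiftS_linear l).
Definition gopT l : linop gspace := LinOp (shiftT_linear l).
Definition gopP v : linop gspace := LinOp (shiftP_linear v).

Lemma gopE (g h : linop gspace) : (forall f x n, g f x n = h f x n) -> g = h.
Proof.
by move=> gh; apply: linopP => f; apply/funext => x; apply/funext => n.
Qed.

Lemma gopDE (g h : linop gspace) f x n : (g + h) f x n = g f x n + h f x n.
Proof. by []. Qed.
Lemma gopNE (g : linop gspace) f x n : (- g) f x n = - g f x n.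
Proof. by []. Qed.
Lemma gopZE (g : linop gspace) (a : K) f x n : (a *: g) f x n = a * g f x n.
Proof. by []. Qed.

Lemma ini_comp y a b : ksrc a = krng b ->
  (ini y (kdeg (kcomp a b)) == kcomp a b) =
  (ini y (kdeg a) == a) && (ini (sigma (kdeg a) y) (kdeg b) == b).
Proof.
move=> ab; rewrite kdeg_comp // ini_add.
apply/eqP/andP => [|[/eqP -> /eqP ->]] //.
move=> /kcomp_inj[] //; first by rewrite -ini_add_src.
  by rewrite kdeg_ini.
by move=> -> ->; rewrite !eqxx.
Qed.

Lemma dg_comp a b : ksrc a = krng b -> dg (kcomp a b) = dg a + dg b.
Proof. by move=> ab; rewrite /dg kdeg_comp // addNkE PoszD. Qed.

Fact gop1 v w : gopP v ** gopP w = if v == w then gopP v else 0.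
Proof.
apply: gopE => f x n /=; rewrite /shiftP.
case: (v =P w) => [<-|vw] /=; rewrite /shiftP; first by case: (_ == v).
by case: eqP => // ->; case: eqP.
Qed.

Fact gop2s a b : ksrc a = krng b -> gopS a ** gopS b = gopS (kcomp a b).
Proof.
move=> ab; apply: gopE => f x n /=; rewrite /shiftS ini_comp //.
case: eqP => //= ea; case: eqP => //= eb.
by rewrite sigma_sigma kdeg_comp // dg_comp // [kdeg b + _]addrC addrA.
Qed.

Fact gop2t a b : ksrc a = krng b -> gopT b ** gopT a = gopT (kcomp a b).
Proof.
move=> ab; apply: gopE => f x n /=; rewrite /shiftT ksrc_comp //.
case: eqP => // e; rewrite infpath_at_prepend // ab eqxx prepend_comp //.
by rewrite dg_comp // opprD addrA addrAC.
Qed.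

Fact gop2rs l : gopP (krng l) ** gopS l = gopS l.
Proof.
apply: gopE => f x n /=; rewrite /shiftP /shiftS.
case: (ini x (kdeg l) =P l) => [e|]; last by case: ifP.
by rewrite -{1}e krng_ini eqxx.
Qed.
Fact gop2ss l : gopS l ** gopP (ksrc l) = gopS l.
Proof.
apply: gopE => f x n /=; rewrite /shiftP /shiftS.
case: (ini x (kdeg l) =P l) => [e|] //.
by rewrite infpath_at_sigma0 -ksrc_ini e eqxx.
Qed.
Fact gop2st l : gopP (ksrc l) ** gopT l = gopT l.
Proof.
apply: gopE => f x n /=; rewrite /shiftP /shiftT eq_sym.
by case: (_ == infpath_at x 0).
Qed.
Fact gop2rt l : gopT l ** gopP (krng l) = gopT l.
Proof.
apply: gopE => f x n /=; rewrite /shiftP /shiftT.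
by case: eqP => // e; rewrite infpath_at_prepend // eqxx.
Qed.

Fact gop3 a b : kdeg a = kdeg b ->
  gopT a ** gopS b = if a == b then gopP (ksrc a) else 0.
Proof.
move=> d; apply: gopE => f x n; case: (a =P b) => [<-|ne] /=.
  rewrite /shiftT /shiftS /shiftP eq_sym; case: eqP => // e.
  by have [-> ->] := prependP (esym e); rewrite eqxx subrK.
rewrite /shiftT /shiftS; case: eqP => // e.
by have [h _] := prependP e; rewrite -d h; case: eqP.
Qed.

Fact gopST l f x n :
  (gopS l ** gopT l) f x n = if ini x (kdeg l) == l then f x n else 0.
Proof.
rewrite /= /shiftS /shiftT; case: eqP => // e.
by rewrite infpath_at_sigma0 -ksrc_ini e eqxx prepend_eq // addrK.
Qed.

(** By [gopST], [s_l s_l^*] is restriction to the paths that begin with [l], and an infinite path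
    out of [v] begins with exactly one path of degree [d]. *)
Fact gop4 v (d : Nk k) : d != 0 ->
  gopP v = \sum_(l \in [set l : nzpath G | paths_from v d (val l)]%classic)
             gopS (val l) ** gopT (val l).
Proof.
move=> d0; have fin := finite_nzpaths G_rf v d.
rewrite fsbig_finite //; set s := fset_set _.
have sP (l : nzpath G) : (l \in s) = `[< paths_from v d (val l) >].
  by rewrite in_fset_set.
apply: gopE => f x n; rewrite linop_sumE !fct_sumE.
under eq_bigr do rewrite gopST.
rewrite /= /shiftP; case: eqP => [xv|xv]; last first.
  rewrite big1_seq // => l; rewrite sP => /andP[_ /asboolP[h1 h2]].
  by case: eqP => // e; case: xv; rewrite -h1 -(krng_ini x (kdeg (val l))) e.
have id0 : kdeg (ini x d) != 0 by rewrite kdeg_ini.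
pose l0 : nzpath G := exist _ (ini x d) id0.
have l0s : l0 \in s.
  by rewrite sP; apply/asboolP; split; rewrite /= ?krng_ini ?kdeg_ini.
rewrite (bigD1_seq l0) //= ?fset_uniq // kdeg_ini eqxx big1_seq ?addr0 //.
move=> l /andP[ne]; rewrite sP => /asboolP[h1 h2].
case: eqP => // e; case/eqP: ne; apply: val_inj.
by rewrite /= -h2.
Qed.

Definition gfamily : KPfamily G (linop gspace).
Proof.
refine (@KPFamily k G K (linop gspace) gopP
  (fun l : nzpath G => gopS (val l)) (fun l : nzpath G => gopT (val l))
  gop1 _ _ _ _ _ _ _ gop4).
- by move=> l m n lm ->; exact: gop2s.
- by move=> l m n lm ->; exact: gop2t.
- by move=> l; exact: gop2rs.
- by move=> l; exact: gop2ss.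
- by move=> l; exact: gop2st.
- by move=> l; exact: gop2rt.
- by move=> l m lm; rewrite gop3 // val_eqE.
Defined.

End GradedRepresentation.

(** * Local units, nonvanishing and periodic paths *)

Section KumjianPaskBasics.
Variables (k : nat) (G : kGraph k) (K : fieldType).
Hypothesis G_rf : row_finite_no_sources G.
Local Notation R := (KP G K).
Local Notation F := (KP_family K G_rf).

Lemma KP_ind (P : R -> Prop) :
  (forall v, P (kpp K v)) -> (forall l, P (kps K l)) ->
  (forall l, P (kpt K l)) -> P 0 ->
  (forall x y, P x -> P y -> P (x + y)) -> (forall x, P x -> P (- x)) ->
  (forall (a : K) x, P x -> P (a *: x)) ->
  (forall x y, P x -> P y -> P (x ** y)) -> forall x, P x.
Proof.
move=> Pp Ps Pt P0 PD PN PZ PM x; have [t ->] := kpclass_surj x.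
elim: t => [v|l|l||t IHt u IHu|t IHt|a t IHt|t IHt u IHu].
- exact: Pp.
- exact: Ps.
- exact: Pt.
- exact: P0.
- by have := PD _ _ IHt IHu; rewrite -[_ + _]/(kpadd _ _) kpaddE.
- by have := PN _ IHt; rewrite -[- _]/(kpopp _) kpoppE.
- by have := PZ a _ IHt; rewrite -[_ *: _]/(kpscale _ _) kpscaleE.
- by have := PM _ _ IHt IHu; rewrite nmulE.
Qed.

Lemma KP_local_units (x : R) : exists s : seq (kvert G),
  psum F s ** x = x /\ x ** psum F s = x.
Proof.
(* The induction needs every larger set of vertices to work as well, because sums and products merge
   the sets of their two terms. *)
suff [s sP] : exists s : seq (kvert G), forall s', uniq s' -> {subset s <= s'} ->
    psum F s' ** x = x /\ x ** psum F s' = x.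
  exists (undup s); apply: sP; first exact: undup_uniq.
  by move=> v; rewrite mem_undup.
elim/KP_ind: x => [v|l|l||x y [s hs] [t ht]|x [s hs]|a x [s hs]|x y [s hs] [t ht]].
- exists [:: v] => s us sub; have vs : v \in s by apply: sub; rewrite inE.
  by split; [apply: psum_absl vs _|apply: psum_absr vs _] => //; exact: (ppE F).
- exists [:: krng (val l); ksrc (val l)] => s us sub.
  split; [apply: (psum_absl (v := krng (val l)))|
          apply: (psum_absr (v := ksrc (val l)))] => //.
  + by apply: sub; rewrite !inE eqxx.
  + exact: (KP2rs F).
  + by apply: sub; rewrite !inE eqxx orbT.
  + exact: (KP2ss F).
- exists [:: krng (val l); ksrc (val l)] => s us sub.
  split; [apply: (psum_absl (v := ksrc (val l)))|
          apply: (psum_absr (v := krng (val l)))] => //.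
  + by apply: sub; rewrite !inE eqxx orbT.
  + exact: (KP2st F).
  + by apply: sub; rewrite !inE eqxx.
  + exact: (KP2rt F).
- by exists [::] => s _ _; rewrite nmul0r nmulr0.
- exists (s ++ t) => u uu sub.
  have [|h1 h2] := hs u uu; first by move=> v vs; apply: sub; rewrite mem_cat vs.
  have [|h3 h4] := ht u uu.
    by move=> v vs; apply: sub; rewrite mem_cat vs orbT.
  by rewrite nmulDr nmulDl h1 h2 h3 h4.
- exists s => u uu sub; have [h1 h2] := hs u uu sub.
  by rewrite nmulrN nmulNr h1 h2.
- exists s => u uu sub; have [h1 h2] := hs u uu sub.
  by rewrite -nscaleAr -nscaleAl h1 h2.
exists (s ++ t) => u uu sub.
have [|h1 h2] := hs u uu; first by move=> v vs; apply: sub; rewrite mem_cat vs.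
have [|h3 h4] := ht u uu.
  by move=> v vs; apply: sub; rewrite mem_cat vs orbT.
by rewrite nmulA h1 -nmulA h4.
Qed.

(** The last clause, invariance under translation of the integer argument, holds on generators
    because they shift it by a constant, and it passes to sums and composites. It serves to evaluate
    one operator at two levels of the grading. *)
Lemma KP_rep (i : 'I_k) : exists pi : R -> linop (gspace G K),
  [/\ linear pi, {morph pi : x y / x ** y},
      forall v, pi (KPp F v) = gopP K v,
      forall l, pi (Sx F l) = gopS K i l /\ pi (Tx F l) = gopT K i l &
      forall x f (j n : int) y,
        pi x (fun y n => f y (n + j)) y n = pi x f y (n + j)].
Proof.
have [pi [[piL piM [pip pis pit]] _]] := KP_universal (gfamily K i G_rf).
exists pi.
have pi0 : pi 0 = 0.
  have := piL 0 0 0; rewrite !scale0r !addr0 => g00.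
  by have := piL 1 0 0; rewrite !scale1r addr0 => /(congr1 (+%R^~ (- pi 0)));
     rewrite addrK subrr => <-.
have piD y z : pi (y + z) = pi y + pi z by have := piL 1 y z; rewrite !scale1r.
have piZ a y : pi (a *: y) = a *: pi y by have := piL a y 0; rewrite pi0 !addr0.
have piN y : pi (- y) = - pi y by rewrite -scaleN1r piZ scaleN1r.
split=> //.
- move=> l; case: (nzpathP l) => [m ->|l0]; first by rewrite Sx_val Tx_val pis pit.
  rewrite Sx0 // Tx0 // pip; have d0 : dg i l = 0 by rewrite /dg l0 ffunE.
  split; apply: gopE => f y n /=; rewrite /shiftP /shiftS /shiftT d0.
    rewrite addr0 l0 sigma0 ini0; congr (if _ then _ else _).
    rewrite [l]kid_deg0 // krng_id; apply/eqP/eqP => [->//|e].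
    by rewrite -[LHS]krng_id e krng_id.
  rewrite subr0 deg0_src // eq_sym; case: eqP => // e.
  have := @prepend_eq _ _ l y; rewrite l0 sigma0 => -> //.
  by rewrite ini0 -e -kid_deg0.
elim/KP_ind=> [v|l|l||x y IHx IHy|x IHx|a x IHx|x y IHx IHy] f j n z.
- by rewrite pip.
- by rewrite pis /= /shiftS addrAC.
- by rewrite pit /= /shiftT addrAC.
- by rewrite pi0.
- by rewrite piD !gopDE IHx IHy.
- by rewrite piN !gopNE IHx.
- by rewrite piZ !gopZE IHx.
rewrite piM /= -IHx; congr (pi x _ z n).
by apply/funext => y'; apply/funext => n'; rewrite IHy.
Qed.

Hypothesis k_gt0 : (0 < k)%N.

(** An algebra given by relations might collapse. Here [p_v] keeps the value of the constant
    function 1 at a path out of [v], and the absence of sources provides such a path. *)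
Lemma pp_neq0 v : KPp F v != 0.
Proof.
have [pi [piL _ pip _ _]] := KP_rep (Ordinal k_gt0).
have [x xv] := infpath_from G_rf v.
apply/eqP => p0; have := pip v; rewrite p0.
have -> : pi 0 = 0.
  have := piL 1 0 0; rewrite !scale1r addr0 => /(congr1 (+%R^~ (- pi 0))).
  by rewrite addrK subrr => <-.
move=> /(congr1 (fun g : linop (gspace G K) => g (fun _ _ => 1) x 0)) /=.
by rewrite /shiftP xv eqxx => /esym/eqP; rewrite oner_eq0.
Qed.

(* If [sigma p x = sigma q x], then [T = p_v - s_(x(0,p)) s_(x(0,q))^*] acts at
   [x] as [f n |-> f n - f (n + j)] with [j != 0].  It sends [n |-> n %/ j] to
   the constant [-1], which it kills; as the representation commutes with
   translations, [T b T = T] would force [-1 = 0]. *)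
Lemma periodic_not_regular v (x : infpath G) : infpaths_from v = [set x]%classic ->
  von_neumann_regular R -> ~ periodic x.
Proof.
move=> vx reg [p [q [pq spq]]].
have [i ij] : exists i, p i != q i.
  by apply/existsP; rewrite -negb_forall; apply/negP => /forallP e;
     apply: pq; apply/ffunP => i; apply/eqP.
have [pi [piL piM pip piST tau]] := KP_rep i.
have piB y z : pi (y - z) = pi y - pi z.
  by rewrite addrC -scaleN1r piL scaleN1r addrC.
pose j : int := (p i)%:Z - (q i)%:Z.
have j0 : j != 0 by rewrite subr_eq0 eqz_nat.
have x0 : infpath_at x 0 = v by rewrite -[_ = v]/(infpaths_from v x) vx.
pose T : R := KPp F v - Sx F (ini x p) ** Tx F (ini x q).
have piT f y n : pi T f y n = if infpath_at y 0 == v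
    then f x n - f x (n + j) else 0.
  rewrite piB piM pip (piST _).1 (piST _).2.
  rewrite -[LHS]/(gopP K v f y n - gopS K i _ (gopT K i _ f) y n) /=.
  rewrite /shiftP; case: eqP => yv; last first.
    rewrite /shiftS; case: eqP => [e|]; rewrite ?subr0 //; case: yv.
    by rewrite -(krng_ini y (kdeg (ini x p))) e krng_ini.
  have -> : y = x by have : infpaths_from v y by []; rewrite vx.
  rewrite /shiftS kdeg_ini eqxx /shiftT infpath_at_sigma0.
  have -> : prepend (ini x q) (sigma p x) = x.
    rewrite spq; have := @prepend_eq _ _ (ini x q) x.
    by rewrite kdeg_ini => ->.
  rewrite ksrc_ini -(infpath_at_sigma0 q) -spq infpath_at_sigma0 eqxx.
  by rewrite /dg !kdeg_ini -addrA.
have [b TbT] := reg T.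
pose f0 : gspace G K := fun _ n => ((n %/ j)%Z)%:~R.
have Tf0 y n : pi T f0 y n = if infpath_at y 0 == v then -1 else 0.
  rewrite piT /f0; case: ifP => // _.
  have -> : ((n + j) %/ j)%Z = 1 + (n %/ j)%Z.
    by rewrite addrC -{1}[j]mul1r divzMDl.
  by rewrite intrD opprD addrCA subrr addr0.
have := Tf0 x 0; rewrite x0 eqxx -TbT !piM.
rewrite -[X in X -> _]/(pi T (pi b (pi T f0)) x 0 = -1) piT x0 eqxx.
rewrite -tau; set g := (fun _ _ => _); have -> : g = pi T f0.
  by apply/funext => y; apply/funext => n; rewrite /g !Tf0.
by rewrite subrr => /eqP; rewrite eq_sym oppr_eq0 oner_eq0.
Qed.

End KumjianPaskBasics.

(** * Left ideals inside finite sums of minimal ones *)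

Section LeftIdeals.
Variable R : nuRingType.
Implicit Types (I J L M N W : set R) (s : seq (set R)).

Lemma left_idealD I : left_ideal I -> forall x y, I x -> I y -> I (x + y).
Proof. by case=> -[]. Qed.
Lemma left_idealN I : left_ideal I -> forall x, I x -> I (- x).
Proof. by case=> -[]. Qed.
Lemma left_ideal0 I : left_ideal I -> I 0.
Proof. by case=> -[]. Qed.
Lemma left_idealM I : left_ideal I -> forall r x, I x -> I (r ** x).
Proof. by case. Qed.
Lemma left_idealB I : left_ideal I -> forall x y, I x -> I y -> I (x - y).
Proof. by move=> hI x y Ix Iy; apply: left_idealD => //; exact: left_idealN. Qed.

Definition add_ideal I J : set R :=
  [set z | exists x y, [/\ I x, J y & z = x + y]]%classic.

Lemma add_idealP I J : left_ideal I -> left_ideal J -> left_ideal (add_ideal I J).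
Proof.
move=> hI hJ; split; first split.
- by exists 0, 0; rewrite addr0; split=> //; exact: left_ideal0.
- move=> _ _ [a [b [Ia Jb ->]]] [c [d [Ic Jd ->]]].
  by exists (a + c), (b + d); rewrite addrACA; split=> //; exact: left_idealD.
- move=> _ [a [b [Ia Jb ->]]]; exists (- a), (- b); rewrite opprD.
  by split=> //; exact: left_idealN.
move=> r _ [a [b [Ia Jb ->]]]; exists (r ** a), (r ** b); rewrite nmulDr.
by split=> //; exact: left_idealM.
Qed.

Lemma left_ideal_zero : left_ideal ([set 0]%classic : set R).
Proof.
split; first split=> //.
- by move=> x y -> ->; rewrite addr0.
- by move=> x ->; rewrite oppr0.
by move=> r x ->; rewrite /= nmulr0.
Qed.

Lemma setI_idealP I J : left_ideal I -> left_ideal J -> left_ideal (I `&` J)%classic.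
Proof.
move=> hI hJ; split; first split.
- by split; exact: left_ideal0.
- by move=> x y [? ?] [? ?]; split; exact: left_idealD.
- by move=> x [? ?]; split; exact: left_idealN.
by move=> r x [? ?]; split; exact: left_idealM.
Qed.

Fixpoint all_minimal s : Prop :=
  if s is L :: s' then minimal_left_ideal L /\ all_minimal s' else True.

Definition sum_ideals s : set R := foldr add_ideal [set 0]%classic s.

Lemma sum_idealsP s : all_minimal s -> left_ideal (sum_ideals s).
Proof.
elim: s => [_|L s IH [[hL _ _] /IH hs]]; first exact: left_ideal_zero.
exact: add_idealP.
Qed.

Lemma socle_sum_ideals x : socle x ->
  exists s, all_minimal s /\ sum_ideals s x.
Proof.
move=> [s [hs ->]]; elim: s hs => [_|y s IH hs].
  by exists [::]; rewrite big_nil.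
have [|t [ht tx]] := IH; first by move=> z zs; apply: hs; rewrite inE zs orbT.
have [|L hL Ly] := hs y; first by rewrite inE eqxx.
exists (L :: t); split=> //; rewrite big_cons.
by exists y, (\sum_(z <- s) z).
Qed.

Lemma socle_left_ideal : left_ideal (@socle R).
Proof.
split; first split.
- by exists [::]; rewrite big_nil.
- move=> _ _ [s [hs ->]] [t [ht ->]]; exists (s ++ t); rewrite big_cat.
  by split=> // y; rewrite mem_cat => /orP[/hs|/ht].
- move=> _ [s [hs ->]]; exists [seq - y | y <- s]; rewrite big_map sumrN.
  split=> // _ /mapP[y /hs[L hL Ly] ->]; exists L => //.
  by case: hL => hL _ _; exact: left_idealN.
move=> r _ [s [hs ->]]; exists [seq r ** y | y <- s]; rewrite big_map nmul_sumr.
split=> // _ /mapP[y /hs[L hL Ly] ->]; exists L => //.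
by case: hL => hL _ _; exact: left_idealM.
Qed.

Lemma minimal_ideal_cap L W : minimal_left_ideal L -> left_ideal W ->
  (forall x, L x -> W x -> x = 0) \/ (L `<=` W)%classic.
Proof.
move=> [hL _ Lmin] hW.
have [e|e] := Lmin _ (setI_idealP hL hW) (@subIsetl _ L W).
  left=> x Lx Wx; have : (L `&` W)%classic x by [].
  by rewrite e.
by right; rewrite -e => x [].
Qed.

(** The minimal ideals are tried one at a time: one that meets [M + N] in zero is added to [N] and
    keeps the sum direct, any other is already contained in [M + N]. *)
Lemma sum_ideals_complement s M : all_minimal s -> left_ideal M ->
  exists N, [/\ left_ideal N, forall x, M x -> N x -> x = 0 &
    (sum_ideals s `<=` add_ideal M N)%classic].
Proof.
move=> + hM; elim: s => [_|L s IH [hL /IH[N [hN MN sN]]]].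
  exists [set 0]%classic; split=> //; first exact: left_ideal_zero.
  by move=> x ->; apply: left_ideal0; apply: add_idealP => //; exact: left_ideal_zero.
have hMN := add_idealP hM hN.
have L_id : left_ideal L by case: hL.
have [LMN|LMN] := minimal_ideal_cap hL hMN; last first.
  exists N; split=> // x [y [z [/LMN Ly /sN sz ->]]].
  exact: left_idealD.
exists (add_ideal N L); split; first exact: add_idealP.
  move=> x Mx [n [l [Nn Ll xE]]].
  have l0 : l = 0.
    apply: LMN => //; exists x, (- n); split=> //; first exact: left_idealN.
    by rewrite xE addrC addKr.
  by apply: MN => //; rewrite xE l0 addr0.
move=> x [y [z [Ly /sN[m [n [Mm Nn ->]]] ->]]].
exists m, (n + y); split=> //; first by exists n, y.
by rewrite addrC addrA.
Qed.

(** Induction on the number of summands, with [W] the sum of the ideals after [L]. If some member of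
    [F] lies in [W], restrict to such members. Otherwise every member [M] satisfies [L <= M + W],
    and by a modular-law argument nested members with the same intersection with [W] are equal; so
    minimise the intersection. *)
Lemma sum_ideals_dcc s (F : set (set R)) : all_minimal s ->
  (F !=set0)%classic ->
  (forall M, F M -> left_ideal M /\ (M `<=` sum_ideals s)%classic) ->
  exists2 M, F M & forall M', F M' -> (M' `<=` M)%classic -> M' = M.
Proof.
elim: s F => [|L s IH] F /=.
  move=> _ [M FM] hF; exists M => // M' FM' M'M; apply/seteqP; split=> // x Mx.
  have [_ /(_ x Mx) ->] := hF _ FM.
  by apply: left_ideal0; case: (hF _ FM').
move=> [hL hs] [M0 FM0] hF; have W_id := sum_idealsP hs.
have L_id : left_ideal L by case: hL.
have [[M1 [FM1 M1W]]|nW] :=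
    pselect (exists M1, F M1 /\ (M1 `<=` sum_ideals s)%classic).
  have [||M [FM MW] Mmin] :=
      IH [set M | F M /\ (M `<=` sum_ideals s)%classic]%classic hs.
  - by exists M1.
  - by move=> M [/hF[hM _]].
  exists M => // M' FM' M'M; apply: Mmin => //; split=> //.
  by move=> x /M'M /MW.
have LM M : F M -> (L `<=` add_ideal M (sum_ideals s))%classic.
  move=> FM; have [M_id MLs] := hF _ FM.
  have [h|//] := minimal_ideal_cap hL (add_idealP M_id W_id).
  case: nW; exists M; split=> // x Mx.
  have [l [w [Ll Ww xE]]] := MLs _ Mx.
  have l0 : l = 0.
    apply: h => //; exists x, (- w); split=> //; first exact: left_idealN.
    by rewrite xE addrK.
  by rewrite xE l0 add0r.
have [||_ [M FM <-] Mmin] :=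
    IH [set (M `&` sum_ideals s)%classic | M in F]%classic hs.
- by exists (M0 `&` sum_ideals s)%classic; exists M0.
- move=> _ [M FM <-]; have [M_id _] := hF _ FM.
  by split; [exact: setI_idealP|exact: subIsetr].
exists M => // M' FM' M'M; apply/seteqP; split=> // x Mx.
have e : (M' `&` sum_ideals s = M `&` sum_ideals s)%classic.
  apply: Mmin; first by exists M'.
  by move=> z [/M'M Mz sz].
have [M_id MLs] := hF _ FM; have [M'_id M'Ls] := hF _ FM'.
have [l [w [Ll Ww xE]]] := MLs _ Mx.
have [m [w' [M'm Ww' lE]]] := LM _ FM' _ Ll.
have xmE : x - m = w' + w by rewrite xE lE [LHS]addrC -addrA addKr.
have : (M' `&` sum_ideals s)%classic (x - m).
  rewrite e; split; first by apply: left_idealB => //; exact: M'M.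
  by rewrite xmE; exact: left_idealD.
by move=> [M'xm _]; rewrite -(subrK m x); exact: left_idealD.
Qed.

Definition local_units := forall a : R, exists u : R, u ** a = a /\ a ** u = a.

(** A local unit [u] of [a] lies in a finite sum of minimal ideals, where [R a] has a complement
    [N]. Writing [u = c a + n] gives [a = a c a + a n], and [a n] lies both in [N] and in [R a]. *)
Lemma socle_regular : local_units -> @socle R = [set: R]%classic ->
  von_neumann_regular R.
Proof.
move=> lu soc a; have [u [ua au]] := lu a.
have [s [hs su]] : exists s, all_minimal s /\ sum_ideals s u.
  by apply: socle_sum_ideals; rewrite soc.
pose M : set R := [set x | exists c, x = c ** a]%classic.
have M_id : left_ideal M.
  split; first split.
  - by exists 0; rewrite nmul0r.
  - by move=> _ _ [c ->] [d ->]; exists (c + d); rewrite nmulDl.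
  - by move=> _ [c ->]; exists (- c); rewrite nmulNr.
  by move=> r _ [c ->]; exists (r ** c); rewrite nmulA.
have [N [N_id MN sMN]] := sum_ideals_complement hs M_id.
have [_ [n [[c ->] Nn uE]]] := sMN _ su.
exists c; have e : a ** n = a - a ** c ** a.
  by rewrite -{2}au uE nmulDr nmulA addrC addKr.
have /eqP : a ** n = 0.
  apply: MN; last exact: left_idealM.
  by rewrite e -{1}ua -nmulBl; exists (u - a ** c).
by rewrite e subr_eq0 => /eqP.
Qed.

(** For an idempotent [e] this is [R e]. *)
Definition principal (e : R) : set R := [set x | x ** e = x]%classic.

Lemma principalP e : left_ideal (principal e).
Proof.
split; first split; rewrite /principal /=.
- by rewrite nmul0r.
- by move=> x y xe ye; rewrite nmulDl xe ye.
- by move=> x xe; rewrite nmulNr xe.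
by move=> r x xe; rewrite -nmulA xe.
Qed.

End LeftIdeals.

(** * Line points from the socle *)

Section SocleLinePoints.
Variables (k : nat) (G : kGraph k) (K : fieldType).
Hypothesis G_rf : row_finite_no_sources G.
Hypothesis k_gt0 : (0 < k)%N.
Local Notation R := (KP G K).
Local Notation F := (KP_family K G_rf).

Lemma KP_has_local_units : local_units R.
Proof. by move=> x; have [s] := KP_local_units G_rf x; exists (psum F s). Qed.

(* The idempotents [q m] attached to the initial segments of [y] generate a
   directed family of left ideals inside a finite sum of minimal ones, hence
   become constant from some [N] on: [y N] then emits a single infinite path. *)
Lemma socle_line_point : @socle R = [set: R]%classic ->
  forall y : infpath G, exists m, line_point (infpath_at y m).
Proof.
move=> soc y; have reg := socle_regular KP_has_local_units soc.
pose q m : R := Sx F (ini y m) ** Tx F (ini y m).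
have TSm m : Tx F (ini y m) ** Sx F (ini y m) = KPp F (infpath_at y m).
  by rewrite TxSx_id ksrc_ini.
have STm m : Sx F (ini y m) ** KPp F (infpath_at y m) = Sx F (ini y m).
  by rewrite -ksrc_ini Sxp.
have pTm m : KPp F (infpath_at y m) ** Tx F (ini y m) = Tx F (ini y m).
  by rewrite -ksrc_ini pTx.
have qseg m n (mn : leNk m n) (c := y (omega_seg mn)) :
    q n = Sx F (ini y m) ** (Sx F c ** Tx F c) ** Tx F (ini y m).
  have mc := seg_src y mn.
  by rewrite /q (ini_seg y mn) -SxM // -TxM // !nmulA.
have qle m n : leNk m n -> q n ** q m = q n /\ q m ** q n = q n.
  move=> mn; rewrite (qseg _ _ mn) /q; set c := y _.
  have cr : krng c = infpath_at y m by rewrite /c kmorph_rng.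
  split.
    by rewrite -!nmulA [Tx F (ini y m) ** _]nmulA TSm pTm.
  rewrite -!nmulA [Tx F (ini y m) ** (Sx F (ini y m) ** _)]nmulA TSm.
  by rewrite [Sx F _ ** (KPp _ _ ** _)]nmulA STm.
have qq m : q m ** q m = q m by have [] := qle m m (leNk_refl m).
have [s [hs sp]] : exists s, all_minimal s /\ sum_ideals s (KPp F (infpath_at y 0)).
  by apply: socle_sum_ideals; rewrite soc.
have qp m : q m ** KPp F (infpath_at y 0) = q m.
  by rewrite /q -nmulA -(krng_ini y m) Txp.
have [||_ [N _ <-] Nmin] := @sum_ideals_dcc _ s
    [set principal (q m) | m in [set: Nk k]]%classic hs.
- by exists (principal (q 0)); exists 0.
- move=> _ [m _ <-]; split; first exact: principalP.
  move=> x; rewrite /principal /= => <-; rewrite -(qp m) nmulA.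
  exact: left_idealM (sum_idealsP hs) _ _ sp.
have qN m : leNk N m -> q m = q N.
  move=> Nm; have [h1 h2] := qle _ _ Nm.
  have e : principal (q m) = principal (q N).
    apply: Nmin; first by exists m.
    by move=> x; rewrite /principal /= => <-; rewrite -nmulA h1.
  have : principal (q N) (q N) by exact: qq.
  by rewrite -e /principal /= h2.
pose w := infpath_at y N; pose x := sigma N y.
(* Multiplying [q (N + n) = q N] by [Tx] and [Sx] of [ini y N] on the two sides strips that segment
   and leaves the tail [x]. *)
have pw n : KPp F w = Sx F (ini x n) ** Tx F (ini x n).
  have e := qN (N + n) (leNk_addr N n).
  have xn := ini_add_src y N n.
  have := congr1 (fun z => Tx F (ini y N) ** z ** Sx F (ini y N)) e.
  have wr : krng (ini x n) = w by rewrite -xn ksrc_ini.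
  have pS : KPp F w ** Sx F (ini x n) = Sx F (ini x n) by rewrite -wr pSx.
  have Tp : Tx F (ini x n) ** KPp F w = Tx F (ini x n) by rewrite -wr Txp.
  rewrite /q ini_add -SxM // -TxM // !nmulA TSm pS.
  by rewrite -!nmulA TSm Tp ppE => ->.
(* For any other path [l], (KP3) makes [Sx F l] orthogonal to the expression just found for [p_w].
   Then [Sx F l] is 0, and so is the idempotent at its source. *)
have wn l n : krng l = w -> kdeg l = n -> l = ini x n.
  move=> lw ln; apply/eqP; rewrite eq_sym; apply/negPn/negP => ne.
  have S0 : Sx F l = 0.
    rewrite -pSx lw (pw n) -nmulA TxSx ?kdeg_ini // (negPf ne).
    by rewrite nmulr0.
  have := pp_neq0 K G_rf k_gt0 (ksrc l).
  by rewrite -(TxSx_id F l) S0 nmulr0 eqxx.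
exists N; exists x.
have vx : infpaths_from w = [set x]%classic.
  apply/seteqP; split=> [z zw|_ ->]; last exact: infpath_at_sigma0.
  by apply: ini_inj => n; apply: wn; rewrite ?krng_ini ?kdeg_ini.
by split=> //; exact: periodic_not_regular vx reg.
Qed.

End SocleLinePoints.

(** * Atoms of V(R) over a regular ring *)

Section PrincipalModules.
Variable R : nuRingType.
Implicit Types (e f g h x y : R).

(** For an idempotent [f] this is the left module [R f], generated by [f]; a boolean fixed-point
    equation makes it a subtype. *)
Definition pmod f : Type := {x : R | x ** f == x}.
HB.instance Definition _ f := Choice.on (pmod f).

Section Operations.
Variable f : R.
Implicit Types u v w : pmod f.

Fact pmod_fix u : val u ** f = val u.
Proof. exact/eqP/(valP u). Qed.

Definition Pmod x (xf : x ** f = x) : pmod f :=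
  exist (fun x => x ** f == x) x (introT eqP xf).

Fact pmod_add_subproof u v : (val u + val v) ** f = val u + val v.
Proof. by rewrite nmulDl !pmod_fix. Qed.
Fact pmod_opp_subproof u : - val u ** f = - val u.
Proof. by rewrite nmulNr pmod_fix. Qed.
Fact pmod_act_subproof x u : x ** val u ** f = x ** val u.
Proof. by rewrite -nmulA pmod_fix. Qed.

Definition pmod_zero := Pmod (nmul0r f).
Definition pmod_add u v := Pmod (pmod_add_subproof u v).
Definition pmod_opp u := Pmod (pmod_opp_subproof u).
Definition pmod_act x u := Pmod (pmod_act_subproof x u).

Fact pmod_addA : associative pmod_add.
Proof. by move=> u v w; apply: val_inj; rewrite /= addrA. Qed.
Fact pmod_addC : commutative pmod_add.
Proof. by move=> u v; apply: val_inj; rewrite /= addrC. Qed.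
Fact pmod_add0 : left_id pmod_zero pmod_add.
Proof. by move=> u; apply: val_inj; rewrite /= add0r. Qed.
Fact pmod_addN : left_inverse pmod_zero pmod_opp pmod_add.
Proof. by move=> u; apply: val_inj; rewrite /= addNr. Qed.

HB.instance Definition _ :=
  GRing.isZmodule.Build (pmod f) pmod_addA pmod_addC pmod_add0 pmod_addN.

Fact pmod_actA x y u : pmod_act x (pmod_act y u) = pmod_act (x ** y) u.
Proof. by apply: val_inj; rewrite /= nmulA. Qed.
Fact pmod_actDl x y u : pmod_act (x + y) u = pmod_act x u + pmod_act y u.
Proof. by apply: val_inj; rewrite /= nmulDl. Qed.
Fact pmod_actDr x u v : pmod_act x (u + v) = pmod_act x u + pmod_act x v.
Proof. by apply: val_inj; rewrite /= nmulDr. Qed.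

HB.instance Definition _ :=
  Zmodule_isNonUnitalModule.Build R (pmod f) pmod_actA pmod_actDl pmod_actDr.

Lemma pmod_actE x u : val (act x u) = x ** val u.
Proof. by []. Qed.
Lemma pmod_addE u v : val (u + v) = val u + val v.
Proof. by []. Qed.

Hypothesis ff : f ** f = f.
Definition pmod_gen := Pmod ff.

Lemma pmod_genP u : u = act (val u) pmod_gen.
Proof. by apply: val_inj; rewrite /= pmod_fix. Qed.

Fact pmod_unital : unital_module (pmod f).
Proof.
by move=> u; exists [:: (val u, pmod_gen)]; rewrite big_seq1 [LHS]pmod_genP.
Qed.

Fact pmod_fg : finitely_generated (pmod f).
Proof.
by exists 1%N, (fun=> pmod_gen) => u; exists (fun=> val u);
   rewrite big_ord1 [LHS]pmod_genP.
Qed.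

Fact pmod_proj : projective_module (pmod f).
Proof.
move=> M N uM uN g t [gD gZ] [tD tZ] gs.
have [m gm] := gs (t pmod_gen); exists (fun u => act (val u) m).
  by split=> [u v|x u]; rewrite ?pmod_addE ?actDl ?pmod_actE ?actA.
by move=> u; rewrite gZ gm -tZ -pmod_genP.
Qed.

Definition pproj : fgProj R := FgProj pmod_unital pmod_fg pmod_proj.

End Operations.

Lemma pproj_unit f (ff : f ** f = f) :
  monoid_unit (@Vadd R) (Vclass (pproj ff)) -> f = 0.
Proof.
move=> [C]; have [N ->] := Vclass_surj C; rewrite /= Vadd_class.
move=> /Vclass_eq[t [_ [t' tK _]]].
have : t (pmod_gen ff, 0) = t (0, 0) by rewrite [RHS]zero_moduleP [LHS]zero_moduleP.
by move=> /(can_inj tK)/(congr1 (fun u => val u.1)).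
Qed.

Lemma pproj_add f g h (ff : f ** f = f) (gg : g ** g = g) (hh : h ** h = h) :
  f = g + h -> g ** h = 0 -> h ** g = 0 ->
  Vclass (pproj ff) = Vadd (Vclass (pproj gg)) (Vclass (pproj hh)).
Proof.
move=> fgh gh0 hg0; rewrite Vadd_class; apply/Vclass_eq.
have mg (u : pmod f) : val u ** g ** g = val u ** g by rewrite -nmulA gg.
have mh (u : pmod f) : val u ** h ** h = val u ** h by rewrite -nmulA hh.
have gf (u : pmod g) : val u ** f = val u.
  by rewrite fgh nmulDr pmod_fix -(pmod_fix u) -nmulA gh0 nmulr0 addr0.
have hf (u : pmod h) : val u ** f = val u.
  by rewrite fgh nmulDr pmod_fix -(pmod_fix u) -nmulA hg0 nmulr0 add0r.
exists (fun u : pmod f => (Pmod (mg u), Pmod (mh u))); split.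
  split=> [u v|x u]; congr pair; apply: val_inj => /=.
  - by rewrite nmulDl.
  - by rewrite nmulDl.
  - by rewrite nmulA.
  - by rewrite nmulA.
have fD (u : pmod g * pmod h) : (val u.1 + val u.2) ** f = val u.1 + val u.2.
  by rewrite nmulDl gf hf.
exists (fun u => Pmod (fD u)) => [u|[u v]].
  by apply: val_inj; rewrite /= -nmulDr -fgh pmod_fix.
congr pair; apply: val_inj; rewrite /= nmulDl pmod_fix.
  by rewrite -(pmod_fix v) -nmulA hg0 nmulr0 addr0.
by rewrite -(pmod_fix u) -nmulA gh0 nmulr0 add0r.
Qed.

(** [g] and [h] are the images in [R f] of the two components of its generator [f]. This lifts
    decompositions in V, which involve arbitrary modules, to decompositions of idempotents inside
    the ring. *)
Lemma pproj_split f (ff : f ** f = f) C D : Vclass (pproj ff) = Vadd C D ->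
  exists g h (gg : g ** g = g) (hh : h ** h = h),
    [/\ C = Vclass (pproj gg), D = Vclass (pproj hh) & f = g + h].
Proof.
have [M ->] := Vclass_surj C; have [N ->] := Vclass_surj D.
rewrite Vadd_class => /Vclass_eq/module_iso_sym[t [[tD tZ] [t' tK t'K]]].
have [m [n mnE]] : exists m n, t (m, n) = pmod_gen ff.
  by exists (t' (pmod_gen ff)).1, (t' (pmod_gen ff)).2; rewrite -surjective_pairing.
have t0 : t 0 = 0 by apply: (addrI (t 0)); rewrite -tD !addr0.
pose g := val (t (m, 0)); pose h := val (t (0, n)).
have fgh : f = g + h.
  rewrite /g /h -pmod_addE -tD.
  by rewrite -[(m, 0) + (0, n)]/(m + 0, 0 + n) addr0 add0r mnE.
have tm x (m' : M) : x ** val (t (m', 0)) = val (t (act x m', 0)).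
  by rewrite -pmod_actE -tZ; congr (val (t _)); rewrite /act /= /prod_act /= act0.
have tn x (n' : N) : x ** val (t (0, n')) = val (t (0, act x n')).
  by rewrite -pmod_actE -tZ; congr (val (t _)); rewrite /act /= /prod_act /= act0.
have tB (m1 m2 : M) (n1 n2 : N) :
    val (t (m1, 0)) = val (t (m2, 0)) + val (t (0, n2)) -> m1 = m2 /\ n2 = 0.
  rewrite -pmod_addE -tD => /val_inj/(can_inj tK).
  by rewrite -[_ + _]/(m2 + 0, 0 + n2) addr0 add0r => -[-> <-].
have tB' (n1 n2 : N) (m2 : M) :
    val (t (0, n1)) = val (t (m2, 0)) + val (t (0, n2)) -> n1 = n2 /\ m2 = 0.
  rewrite -pmod_addE -tD => /val_inj/(can_inj tK).
  by rewrite -[_ + _]/(m2 + 0, 0 + n2) addr0 add0r => -[<- ->].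
(* Right multiplication by [f = g + h] fixes the element; its product with [h] lies in the copy of
   [N], so directness of the sum makes it vanish. *)
have Mg (m' : M) : val (t (m', 0)) ** g = val (t (m', 0)) /\
    val (t (m', 0)) ** h = 0.
  have : val (t (m', 0)) = val (t (m', 0)) ** g + val (t (m', 0)) ** h.
    by rewrite -nmulDr -fgh pmod_fix.
  rewrite tm tn => e; have [e1 e2] := tB _ _ 0 _ e.
  by rewrite -e1 e2 -[(0, 0)]/(0 : M * N) t0.
have Nh (n' : N) : val (t (0, n')) ** h = val (t (0, n')) /\
    val (t (0, n')) ** g = 0.
  have : val (t (0, n')) = val (t (0, n')) ** g + val (t (0, n')) ** h.
    by rewrite -nmulDr -fgh pmod_fix.
  rewrite tm tn => e; have [e1 e2] := tB' _ _ _ e.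
  by rewrite -e1 e2 -[(0, 0)]/(0 : M * N) t0.
have gg : g ** g = g := (Mg m).1; have hh : h ** h = h := (Nh n).1.
exists g, h, gg, hh; split=> //; apply/Vclass_eq.
  exists (fun m' : M => Pmod (Mg m').1); split.
    split=> [m1 m2|x m']; apply: val_inj; rewrite /= ?tm //.
    rewrite -pmod_addE -tD; congr (val (t _)).
    by rewrite -[RHS]/(m1 + m2, 0 + 0) addr0.
  exists (fun u : pmod g => act (val u) m) => [m'|u] /=.
    have e : val (t (m', 0)) = val (t (act (val (t (m', 0))) m, 0)).
      by rewrite -tm (Mg m').1.
    by move/val_inj/(can_inj tK): e => [<-].
  by apply: val_inj; rewrite /= -tm pmod_fix.
exists (fun n' : N => Pmod (Nh n').1); split.
  split=> [n1 n2|x n']; apply: val_inj; rewrite /= ?tn //.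
  rewrite -pmod_addE -tD; congr (val (t _)).
  by rewrite -[RHS]/(0 + 0, n1 + n2) addr0.
exists (fun u : pmod h => act (val u) n) => [n'|u] /=.
  have e : val (t (0, n')) = val (t (0, act (val (t (0, n'))) n)).
    by rewrite -tn (Nh n').1.
  by move/val_inj/(can_inj tK): e => [<-].
by apply: val_inj; rewrite /= -tn pmod_fix.
Qed.

Hypothesis reg : von_neumann_regular R.

(** By regularity a nonzero ideal [L] inside [R f] contains a nonzero idempotent, which splits [f]
    into two orthogonal idempotents. As [f] is an atom one of them vanishes: one case contradicts
    [L] being nonzero, the other puts [R f] inside [L]. *)
Lemma atom_minimal f (ff : f ** f = f) :
  monoid_atom (@Vadd R) (Vclass (pproj ff)) ->
  f = 0 \/ minimal_left_ideal (principal f).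
Proof.
move=> at_f; have [f0|f0] := pselect (f = 0); [by left|right].
have f_in : principal f f by [].
split; [exact: principalP|by move=> e; apply: f0; rewrite e in f_in|].
move=> L hL Lf; have [L0|nL0] := pselect (forall x, L x -> x = 0).
  left; apply/seteqP; split=> [x /L0 //|_ ->]; exact: left_ideal0.
right; apply/seteqP; split=> // x xf.
have [m [Lm m0]] : exists m, L m /\ m <> 0.
  apply: contrapT => nm; apply: nL0 => m Lm; apply: contrapT => m0.
  by apply: nm; exists m.
have [b mbm] := reg m; pose e := b ** m.
have Le : L e by exact: left_idealM.
have ee : e ** e = e by rewrite /e -nmulA [m ** _]nmulA mbm.
have ef : e ** f = e := Lf _ Le.
(* [e] is known to absorb [f] on the right only; [f ** e] absorbs it on both sides, so [h] is an
   idempotent orthogonal to it. *)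
pose g := f ** e; pose h := f - g.
have gg : g ** g = g by rewrite /g -nmulA [e ** _]nmulA ef ee.
have fg : f ** g = g by rewrite /g nmulA ff.
have gf : g ** f = g by rewrite /g -nmulA ef.
have gh : g ** h = 0 by rewrite nmulBr gf gg subrr.
have hg : h ** g = 0 by rewrite nmulBl fg gg subrr.
have hh : h ** h = h by rewrite {1}/h nmulBl gh subr0 nmulBr ff fg.
have fE : f = g + h by rewrite addrC subrK.
have [/pproj_unit g0|/pproj_unit h0] := at_f _ _ (pproj_add ff gg hh fE gh hg).
  case: m0; have me : m ** e = m by rewrite /e nmulA mbm.
  by rewrite -me -ee -{1}ef -nmulA -/g g0 !nmulr0.
have -> : x = (x ** f) ** e.
  by rewrite -nmulA -/g -{1}xf {1}fE h0 addr0.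
exact: left_idealM.
Qed.

(** Atoms are peeled off one by one: [pproj_split] turns each into an idempotent summand of [f],
    which is zero or generates a minimal ideal. *)
Lemma atoms_socle n f (ff : f ** f = f) (a : 'I_n -> Vmon R) :
  (forall i, monoid_atom (@Vadd R) (a i)) ->
  Vclass (pproj ff) = \big[@Vadd R/@V0 R]_i a i -> socle f.
Proof.
elim: n f ff a => [|n IH] f ff a at_a.
  rewrite big_ord0 => e.
  have -> : f = 0.
    by apply: (@pproj_unit f ff); exists (@V0 R); rewrite e /= Vadd0.
  exact: left_ideal0 (@socle_left_ideal R).
rewrite big_ord_recl => /pproj_split[g [h [gg [hh [ag ah ->]]]]].
apply: (left_idealD (@socle_left_ideal R)).
  have := at_a ord0; rewrite ag => /atom_minimal[->|mg].
    exact: left_ideal0 (@socle_left_ideal R).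
  exists [:: g]; rewrite big_seq1; split=> // y; rewrite inE => /eqP ->.
  by exists (principal g).
by apply: IH _ (esym ah) => // i.
Qed.

Lemma atomic_idempotent_socle : atomic_monoid (@Vadd R) ->
  forall f, f ** f = f -> socle f.
Proof.
move=> at_V f ff; have [n [a [h e]]] := at_V (Vclass (pproj ff)).
exact: atoms_socle e.
Qed.

End PrincipalModules.

Lemma KP_atomic_socle (k : nat) (G : kGraph k) (K : fieldType) :
  row_finite_no_sources G -> von_neumann_regular (KP G K) ->
  atomic_monoid (@Vadd (KP G K)) -> @socle (KP G K) = [set: KP G K]%classic.
Proof.
move=> G_rf reg at_V; apply/seteqP; split=> // x _.
have [s [_ <-]] := KP_local_units G_rf x.
apply: (left_idealM (@socle_left_ideal _)); rewrite /psum.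
elim: s => [|v s IH].
  by rewrite big_nil; exact: left_ideal0 (@socle_left_ideal _).
rewrite big_cons; apply: (left_idealD (@socle_left_ideal _)) => //.
by apply: (atomic_idempotent_socle reg at_V); exact: (ppE (KP_family K G_rf)).
Qed.

(** * Algebras with a basis of matrix units *)

Section MatrixUnits.
Variables (K : fieldType) (A : nuAlgType K) (X : countType) (T : Type).
Variables (c : X -> T) (e : X -> X -> A).

(** An inductive span gives directly the induction by which linear statements reduce to a single
    unit within a block. *)
Inductive unit_span : A -> Prop :=
  | Span0 : unit_span 0
  | SpanD a k x y : c x = c y -> unit_span a -> unit_span (a + k *: e x y).

Lemma unit_spanD a b : unit_span a -> unit_span b -> unit_span (a + b).
Proof.
move=> ha; elim=> [|b' k x y xy _ IH]; first by rewrite addr0.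
by rewrite addrA; exact: SpanD.
Qed.

Lemma unit_spanZ k a : unit_span a -> unit_span (k *: a).
Proof.
elim=> [|b k' x y xy _ IH]; first by rewrite scaler0; exact: Span0.
by rewrite scalerDr scalerA; exact: SpanD.
Qed.

Lemma unit_span_unit k x y : c x = c y -> unit_span (k *: e x y).
Proof. by move=> xy; rewrite -[_ *: _]add0r; apply: SpanD => //; exact: Span0. Qed.

Lemma unit_span_sum (I : Type) (s : seq I) (f : I -> A) :
  (forall i, unit_span (f i)) -> unit_span (\sum_(i <- s) f i).
Proof.
move=> hf; elim: s => [|i s IH]; first by rewrite big_nil; exact: Span0.
by rewrite big_cons; exact: unit_spanD.
Qed.

Definition unit_rule : Prop := forall x y z w, c x = c y -> c z = c w ->
  e x y ** e z w = if y == z then e x w else 0.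

Lemma unit_spanM a b : unit_rule -> unit_span a -> unit_span b ->
  unit_span (a ** b).
Proof.
move=> rule; elim=> [|a' k x y xy _ IHa] hb; first by rewrite nmul0r; exact: Span0.
rewrite nmulDl; apply: unit_spanD; first exact: IHa.
elim: hb => [|b' l z w zw _ IHb]; first by rewrite nmulr0; exact: Span0.
rewrite nmulDr; apply: unit_spanD => //.
rewrite -nscaleAl -nscaleAr scalerA rule //; case: eqP => [yz|_].
  by apply: unit_span_unit; rewrite xy yz.
by rewrite scaler0; exact: Span0.
Qed.

(* [T] indexes the blocks: [e x y] is a matrix unit when [x] and [y] lie in the
   same block and is unconstrained otherwise. *)
Record matrix_units : Prop := MatrixUnits {
  munitM : unit_rule;
  munit_neq0 : forall x, e x x != 0;
  munit_span : forall a, unit_span a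
}.

End MatrixUnits.

Section MatrixUnitsTheory.
Variables (K : fieldType) (A : nuAlgType K) (X : countType) (T : Type).
Variables (c : X -> T) (e : X -> X -> A).
Hypothesis mu : matrix_units c e.
Implicit Types (a b : A) (x y z w : X).

Lemma munit_ind (P : A -> Prop) : P 0 -> (forall a b, P a -> P b -> P (a + b)) ->
  (forall k x y, c x = c y -> P (k *: e x y)) -> forall a, P a.
Proof.
move=> P0 PD PE a; elim: (munit_span mu a) => // b k x y xy _ Pb.
by apply: PD => //; exact: PE.
Qed.

Lemma munit_idem x : e x x ** e x x = e x x.
Proof. by rewrite (munitM mu) // eqxx. Qed.

Lemma munitMM x y z : c x = c y -> c y = c z -> e x y ** e y z = e x z.
Proof. by move=> xy yz; rewrite (munitM mu) // eqxx. Qed.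

Lemma munit_nz x y : c x = c y -> e x y != 0.
Proof.
move=> xy; apply/eqP => e0; have := munit_neq0 mu x.
by rewrite -(@munitMM x y x) // e0 nmul0r eqxx.
Qed.

Lemma munit_corner a x y : c x = c y ->
  exists k, e x x ** a ** e y y = k *: e x y.
Proof.
move=> xy; elim/munit_ind: a => [|a b [k ak] [l bl]|k z w zw].
- by exists 0; rewrite scale0r nmulr0 nmul0r.
- by exists (k + l); rewrite nmulDr nmulDl ak bl scalerDl.
rewrite -nscaleAr -nscaleAl (munitM mu) //; case: (x =P z) zw => [<-|xz] zw.
  rewrite (munitM mu) //; case: eqP => [<-|_]; first by exists k.
  by exists 0; rewrite scale0r scaler0.
by exists 0; rewrite nmul0r scale0r scaler0.
Qed.

Lemma munit_corner0 a x y : c x <> c y -> e x x ** a ** e y y = 0.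
Proof.
move=> xy; elim/munit_ind: a => [|a b ha hb|k z w zw].
- by rewrite nmulr0 nmul0r.
- by rewrite nmulDr nmulDl ha hb addr0.
rewrite -nscaleAr -nscaleAl (munitM mu) //; case: (x =P z) zw => [<-|xz] zw.
  rewrite (munitM mu) //; case: eqP => [wy|]; rewrite ?scaler0 //.
  by case: xy; rewrite -wy.
by rewrite nmul0r scaler0.
Qed.

(** The coefficient of [a] on [e x y], well determined when [x] and [y] share a block: the corner is
    then a line spanned by the nonzero [e x y]. *)
Definition ucoef x y a : K := xget 0 [set k | e x x ** a ** e y y = k *: e x y]%classic.

Lemma ucoefP x y a : c x = c y -> e x x ** a ** e y y = ucoef x y a *: e x y.
Proof.
move=> xy; rewrite /ucoef; case: xgetP => [k _ //|h].
by have [k /h] := munit_corner a xy.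
Qed.

Lemma ucoef_eq x y a k : c x = c y -> e x x ** a ** e y y = k *: e x y ->
  ucoef x y a = k.
Proof.
move=> xy ak; apply/eqP; rewrite -subr_eq0; apply/eqP.
have : (ucoef x y a - k) *: e x y == 0 by rewrite scalerBl -ucoefP // ak subrr.
by rewrite scaler_eq0 (negPf (munit_nz xy)) orbF => /eqP.
Qed.

Lemma ucoef_linear x y a b (k : K) : c x = c y ->
  ucoef x y (k *: a + b) = k * ucoef x y a + ucoef x y b.
Proof.
move=> xy; apply: ucoef_eq => //.
by rewrite nmulDr nmulDl -nscaleAr -nscaleAl !ucoefP // scalerDl scalerA.
Qed.

Lemma ucoef0 x y : c x = c y -> ucoef x y 0 = 0.
Proof. by move=> xy; apply: ucoef_eq; rewrite // nmulr0 nmul0r scale0r. Qed.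

Lemma ucoefE x y z w : c x = c y -> c z = c w ->
  ucoef x y (e z w) = ((x == z) && (w == y))%:R.
Proof.
move=> xy zw; apply: ucoef_eq => //; rewrite (munitM mu) //.
case: (x =P z) zw => [<-|xz] zw; last by rewrite nmul0r scale0r.
by rewrite (munitM mu) //; case: (w =P y) => _; rewrite ?scale1r ?scale0r.
Qed.

Definition unit_sum (s : seq X) : A := \sum_(x <- s) e x x.

Lemma unit_sumE s x y : uniq s -> c x = c y ->
  unit_sum s ** e x y = if x \in s then e x y else 0.
Proof.
move=> us xy; rewrite /unit_sum nmul_suml; case: ifP => xs.
  rewrite (bigD1_seq x) //= munitMM // big1 ?addr0 // => z zx.
  by rewrite (munitM mu) // (negPf zx).
rewrite big1_seq // => z /andP[_ zs]; rewrite (munitM mu) //.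
by case: eqP => // zx; rewrite -zx zs in xs.
Qed.

Lemma unit_sumEr s x y : uniq s -> c x = c y ->
  e x y ** unit_sum s = if y \in s then e x y else 0.
Proof.
move=> us xy; rewrite /unit_sum nmul_sumr; case: ifP => ys.
  rewrite (bigD1_seq y) //= munitMM // big1 ?addr0 // => z zy.
  by rewrite (munitM mu) // eq_sym (negPf zy).
rewrite big1_seq // => z /andP[_ zs]; rewrite (munitM mu) //.
by case: eqP => // zy; rewrite zy zs in ys.
Qed.

Lemma munit_local_unit a : exists s : seq X, forall t : seq X,
  uniq t -> {subset s <= t} ->
  unit_sum t ** a = a /\ a ** unit_sum t = a.
Proof.
elim/munit_ind: a => [|a b [s hs] [t ht]|k x y xy].
- by exists [::] => t _ _; rewrite nmul0r nmulr0.
- exists (s ++ t) => u uu sub.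
  have [|h1 h2] := hs u uu; first by move=> v vs; apply: sub; rewrite mem_cat vs.
  have [|h3 h4] := ht u uu.
    by move=> v vs; apply: sub; rewrite mem_cat vs orbT.
  by rewrite nmulDr nmulDl h1 h2 h3 h4.
exists [:: x; y] => t ut sub; rewrite -nscaleAr -nscaleAl unit_sumE // unit_sumEr //.
by rewrite !sub ?inE ?eqxx ?orbT.
Qed.

Lemma munit_local_units : local_units A.
Proof.
move=> a; have [s hs] := munit_local_unit a; exists (unit_sum (undup s)).
by apply: hs; [exact: undup_uniq|move=> x; rewrite mem_undup].
Qed.

Lemma munit_row_neq0 a : a != 0 -> exists x, e x x ** a != 0.
Proof.
move=> a0; apply: contrapT => h; case/eqP: a0.
have [s hs] := munit_local_unit a.
have [||<- _] := hs (undup s); first exact: undup_uniq.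
  by move=> x; rewrite mem_undup.
rewrite /unit_sum nmul_suml big1 // => x _; apply/eqP/negPn/negP => xa.
by apply: h; exists x.
Qed.

Lemma munit_col_neq0 a : a != 0 -> exists x, a ** e x x != 0.
Proof.
move=> a0; apply: contrapT => h; case/eqP: a0.
have [s hs] := munit_local_unit a.
have [||_ <-] := hs (undup s); first exact: undup_uniq.
  by move=> x; rewrite mem_undup.
rewrite /unit_sum nmul_sumr big1 // => x _; apply/eqP/negPn/negP => xa.
by apply: h; exists x.
Qed.

(** Some [e x x ** a] is nonzero; being in a one-dimensional corner it is a nonzero multiple of
    [e x y], which a multiple of [e y x] inverts. *)
Lemma munit_transitive a y : a != 0 -> a ** e y y = a ->
  exists b, b ** a = e y y.
Proof.
move=> a0 ay; have [x xa] := munit_row_neq0 a0.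
have xay : e x x ** a = e x x ** a ** e y y by rewrite -nmulA ay.
have xy : c x = c y.
  by apply: contrapT => xy; rewrite xay munit_corner0 ?eqxx in xa.
have k0 : ucoef x y a != 0.
  by apply: contraNneq xa => k0; rewrite xay ucoefP // k0 scale0r.
exists ((ucoef x y a)^-1 *: e y x).
rewrite -nscaleAl -(@munitMM y x x) // -nmulA xay ucoefP // -nscaleAr scalerA.
by rewrite mulVf // scale1r munitMM.
Qed.

Lemma munit_minimal y : minimal_left_ideal (principal (e y y)).
Proof.
split; first exact: principalP.
  move=> h; have : principal (e y y) (e y y) by exact: munit_idem.
  by rewrite h => /eqP; rewrite (negPf (munit_neq0 mu y)).
move=> L hL Ly; have [L0|nL0] := pselect (forall a, L a -> a = 0).
  left; apply/seteqP; split=> [x /L0 //|_ ->]; exact: left_ideal0.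
right; apply/seteqP; split=> // a ay.
have [m [Lm m0]] : exists m, L m /\ m != 0.
  apply: contrapT => nm; apply: nL0 => m Lm; apply/eqP/negPn/negP => m0.
  by apply: nm; exists m.
have [b bm] := munit_transitive m0 (Ly _ Lm).
by rewrite -ay -bm; apply: left_idealM => //; exact: left_idealM.
Qed.

Lemma munit_socle : @socle A = [set: A]%classic.
Proof.
apply/seteqP; split=> // a _; elim/munit_ind: a => [|a b|k x y xy].
- exact: left_ideal0 (@socle_left_ideal A).
- exact: left_idealD (@socle_left_ideal A) _ _.
exists [:: k *: e x y]; rewrite big_seq1; split=> // z; rewrite inE => /eqP ->.
exists (principal (e y y)); first exact: munit_minimal.
by rewrite /principal /= -nscaleAl munitMM.
Qed.

(** A nonzero element of [I] would bring some [e y y] into [I], and the square of this idempotent is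
    not zero. *)
Lemma munit_semiprime : semiprime A.
Proof.
move=> I [I_id Ir] II; apply/seteqP; split=> [a Ia|_ ->]; last exact: left_ideal0.
suff a0 : a = 0 by [].
apply/eqP/negPn/negP => a0; have [y ay] := munit_col_neq0 a0.
have [|b bay] := @munit_transitive _ y ay; first by rewrite -nmulA munit_idem.
have Iy : I (e y y) by rewrite -bay; apply: left_idealM => //; exact: Ir.
by have := munit_neq0 mu y; rewrite -munit_idem II // eqxx.
Qed.

Lemma munit_semisimple : semisimple A.
Proof. by split; [exact: munit_semiprime|exact: munit_socle]. Qed.

Lemma munit_regular : von_neumann_regular A.
Proof. exact: socle_regular munit_local_units munit_socle. Qed.

End MatrixUnitsTheory.

(** * Matrix entries and direct sums of matrix algebras *)

Section MatrixEntries.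
Variable K : fieldType.

(** With a common type of indices and a common entry function, finite and infinite matrices go
    through the same computations. *)
Definition mxidx (o : option nat) : countType := if o is Some n then 'I_n else nat.

Definition ent (o : option nat) : mx_alg K o -> mxidx o -> mxidx o -> K :=
  match o with Some n => fun M i j => M i j | None => fun M => mxinf_fun M end.

Variable o : option nat.
Implicit Types (M N : mx_alg K o) (s t : mxidx o).

Lemma ent_inj M N : (forall s t, ent M s t = ent N s t) -> M = N.
Proof.
case: o M N => [n|] M N MN; last exact: mxinfP.
by apply/matrixP.
Qed.

Lemma ent_linear (a : K) M N s t : ent (a *: M + N) s t = a * ent M s t + ent N s t.
Proof. by case: o M N s t => [n|] M N s t; rewrite /= ?mxE. Qed.

Lemma ent0 s t : ent 0 s t = 0.
Proof. by case: o s t => [n|] s t; rewrite /= ?mxE. Qed.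

Lemma entD M N s t : ent (M + N) s t = ent M s t + ent N s t.
Proof. by have := ent_linear 1 M N s t; rewrite scale1r mul1r. Qed.

Lemma entZ (a : K) M s t : ent (a *: M) s t = a * ent M s t.
Proof. by have := ent_linear a M 0 s t; rewrite !addr0 ent0 addr0. Qed.

Lemma ent_sum (I : Type) (r : seq I) (F : I -> mx_alg K o) s t :
  ent (\sum_(i <- r) F i) s t = \sum_(i <- r) ent (F i) s t.
Proof.
exact: (big_morph (fun M => ent M s t) (fun M N => entD M N s t) (ent0 s t)).
Qed.

Lemma entM M N (l : seq (mxidx o)) s t : uniq l ->
  (forall r, r \notin l -> ent M s r * ent N r t = 0) ->
  ent (nmul M N) s t = \sum_(r <- l) ent M s r * ent N r t.
Proof.
case: o M N l s t => [n|] M N l s t ul h /=.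
  rewrite [LHS]mxE (bigID (mem l)) /= [X in _ + X]big1 ?addr0 => [|r /h //].
  by rewrite big_uniq.
rewrite [RHS]fsbig_seq //; apply/esym.
apply: (fsbig_widen [set` l]%classic [set: nat]%classic) => // r [_ /negP rl].
exact: h.
Qed.

Lemma ent_supp M : exists l : seq (mxidx o), uniq l /\
  forall s t, (s \notin l) || (t \notin l) -> ent M s t = 0.
Proof.
case: o M => [n|] M.
  by exists (enum 'I_n); split; [exact: enum_uniq|move=> s t; rewrite !mem_enum].
have [N MN] := mxinf_supp M; exists (iota 0 N); split; first exact: iota_uniq.
by move=> s t; rewrite !mem_iota /= !add0n -!leqNgt => /MN.
Qed.

Lemma ent_ex (E : mxidx o -> mxidx o -> K) (l : seq (mxidx o)) :
  (forall s t, (s \notin l) || (t \notin l) -> E s t = 0) ->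
  exists M, forall s t, ent M s t = E s t.
Proof.
case: o E l => [n|] E l h.
  by exists (\matrix_(i, j) E i j) => s t; rewrite /= mxE.
have hE : finsupp_mx E.
  apply/finsupp_mxP; exists (\max_(i <- l) i).+1 => i j ij; apply: h.
  have out r : (\max_(i <- l) i < r)%N -> r \notin l.
    move=> lr; apply: contraL lr => rl; rewrite -leqNgt.
    exact: (@leq_bigmax_seq _ l xpredT id r).
  by case/orP: ij => /out ->; rewrite ?orbT.
by exists (MxInf hE).
Qed.

End MatrixEntries.

(** The source of the sizes in the decomposition: a block is either finite or in bijection with
    [nat]. *)
Lemma enum_set (X : countType) (P : set X) :
  exists (o : option nat) (f : mxidx o -> X),
    injective f /\ forall x, P x <-> exists s, f s = x.
Proof.
have [fP|iP] := pselect (finite_set P).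
  pose l := fset_set P.
  have lP x : x \in l <-> P x by rewrite in_fset_set // inE.
  exists (Some (size l)), (fun i : 'I_(size l) => tnth (in_tuple l) i); split.
    by apply/tuple_uniqP; exact: fset_uniq.
  move=> x; split=> [/lP xl|[i <-]]; last by apply/lP; exact: mem_tnth.
  by have /tnthP[i ->] : x \in in_tuple l := xl; exists i.
have [f [_ finj fsurj]] : exists f, set_bij P [set: nat]%classic f.
  by apply/card_set_bijP/eq_card_nat => //; exact: countableP.
have [g gP] : {g : nat -> X & forall n, P (g n) /\ f (g n) = n}.
  apply: (@choice _ _ (fun n x => P x /\ f x = n)) => n.
  by have [x Px <-] := fsurj n I; exists x.
exists None, g; split.
  by move=> m n gmn; rewrite -(gP m).2 gmn (gP n).2.
move=> x; split=> [Px|[n <-]]; last by case: (gP n).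
by exists (f x); apply: finj; rewrite ?inE ?(gP _).2 //; case: (gP (f x)).
Qed.

Section MatrixUnitsIso.
Variables (K : fieldType).

Lemma ucoef_inj (A : nuAlgType K) (X : countType) (T : Type) (c : X -> T)
    (e : X -> X -> A) (mu : matrix_units c e) a b :
  (forall x y, c x = c y -> ucoef e x y a = ucoef e x y b) -> a = b.
Proof.
move=> ab; apply/eqP; rewrite -subr_eq0; apply/negPn/negP => /(munit_col_neq0 mu).
move=> [y /(munit_row_neq0 mu)[x]]; rewrite nmulA.
have [xy|xy] := pselect (c x = c y); last by rewrite (munit_corner0 mu) ?eqxx.
by rewrite nmulBr nmulBl !(ucoefP mu) // ab // subrr eqxx.
Qed.

(** [rel a b] says that [a] and [b] have the same coefficients. It is total on both sides by
    induction on the span, and functional both ways because coefficients separate elements; no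
    expansion in the units has to be chosen. *)
Lemma matrix_units_iso (A B : nuAlgType K) (X Y : countType) (T U : Type)
    (c : X -> T) (d : Y -> U) (e : X -> X -> A) (g : Y -> Y -> B)
    (h : X -> Y) (h' : Y -> X) :
  matrix_units c e -> matrix_units d g -> cancel h h' -> cancel h' h ->
  (forall x y, c x = c y <-> d (h x) = d (h y)) -> alg_iso A B.
Proof.
move=> mu mv hK hK' cd.
pose rel a b := forall x y, c x = c y -> ucoef g (h x) (h y) b = ucoef e x y a.
have relL (k : K) a1 a2 b1 b2 : rel a1 b1 -> rel a2 b2 ->
    rel (k *: a1 + a2) (k *: b1 + b2).
  move=> r1 r2 x y xy.
  by rewrite (ucoef_linear mu) // (ucoef_linear mv) ?r1 ?r2 //; apply/cd.
have rel0 : rel 0 0.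
  by move=> x y xy; rewrite (ucoef0 mu) // (ucoef0 mv) //; exact/cd.
have relE x y : c x = c y -> rel (e x y) (g (h x) (h y)).
  move=> xy z w zw; rewrite (ucoefE mu) // (ucoefE mv) //; [|exact/cd..].
  by rewrite !(can_eq hK).
have tot a : exists b, rel a b.
  elim/(munit_ind mu): a => [|a1 a2 [b1 r1] [b2 r2]|k x y xy].
  - by exists 0.
  - by exists (b1 + b2); have := relL 1 _ _ _ _ r1 r2; rewrite !scale1r.
  by exists (k *: g (h x) (h y)); have := relL k _ _ _ _ (relE _ _ xy) rel0;
     rewrite !addr0.
have tot' b : exists a, rel a b.
  elim/(munit_ind mv): b => [|b1 b2 [a1 r1] [a2 r2]|k x y xy].
  - by exists 0.
  - by exists (a1 + a2); have := relL 1 _ _ _ _ r1 r2; rewrite !scale1r.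
  exists (k *: e (h' x) (h' y)); have h'xy : c (h' x) = c (h' y).
    by apply/cd; rewrite !hK'.
  have := relL k _ _ _ _ (relE _ _ h'xy) rel0.
  by rewrite !addr0 !hK'.
have fun_r a b1 b2 : rel a b1 -> rel a b2 -> b1 = b2.
  move=> r1 r2; apply: (ucoef_inj mv) => x y xy.
  rewrite -(hK' x) -(hK' y); have h'xy : c (h' x) = c (h' y).
    by apply/cd; rewrite !hK'.
  by rewrite r1 // r2.
have fun_l a1 a2 b : rel a1 b -> rel a2 b -> a1 = a2.
  by move=> r1 r2; apply: (ucoef_inj mu) => x y xy; rewrite -r1 // r2.
have [f fP] := choice tot; have [f' f'P] := choice tot'.
have f_lin : linear f.
  by move=> k a b; apply: fun_r (fP _) _; exact: relL.
have f0 : f 0 = 0 by apply: fun_r (fP _) _.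
have fD a b : f (a + b) = f a + f b.
  by have := f_lin 1 a b; rewrite !scale1r.
have fZ (k : K) a : f (k *: a) = k *: f a.
  by have := f_lin k a 0; rewrite f0 !addr0.
have fE x y : c x = c y -> f (e x y) = g (h x) (h y).
  by move=> xy; apply: fun_r (fP _) _; exact: relE.
have fM : {morph f : x y / nmul x y}.
  move=> a b; elim/(munit_ind mu): a => [|a1 a2 h1 h2|k x y xy].
  - by rewrite nmul0r f0 nmul0r.
  - by rewrite nmulDl !fD h1 h2 nmulDl.
  elim/(munit_ind mu): b => [|b1 b2 h1 h2|l z w zw].
  - by rewrite nmulr0 f0 nmulr0.
  - by rewrite nmulDr !fD h1 h2 nmulDr.
  rewrite -!nscaleAl -!nscaleAr !fZ !fE // -!nscaleAl -!nscaleAr.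
  rewrite (munitM mu) // (munitM mv); [|exact/cd..].
  rewrite (can_eq hK); case: eqP => [yz|_]; last by rewrite f0.
  by rewrite fE // xy yz.
pose fl : {linear A -> B} := HB.pack f (GRing.isLinear.Build _ _ _ _ f f_lin).
exists fl; split=> //; exists f' => a.
  exact: fun_l (f'P _) (fP _).
exact: fun_r (fP _) (f'P _).
Qed.

Lemma matrix_units_transport (A B : nuAlgType K) (X : countType) (T : Type)
    (c : X -> T) (e : X -> X -> B) :
  alg_iso A B -> matrix_units c e -> exists g : X -> X -> A, matrix_units c g.
Proof.
move=> [f [fM [f' fK f'K]]] mu; exists (fun x y => f' (e x y)).
have f'0 : f' 0 = 0 by rewrite -[RHS]fK linear0.
split=> [x y z w xy zw|x|a].
- apply: (can_inj fK); rewrite fM !f'K (munitM mu) //.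
  by case: eqP; rewrite ?f'K ?linear0.
- apply/eqP => /(congr1 f); rewrite f'K linear0 => /eqP.
  by rewrite (negPf (munit_neq0 mu x)).
rewrite -(fK a); elim/(munit_ind mu): (f a) => [|a1 a2 h1 h2|k x y xy].
- by rewrite f'0; exact: Span0.
- have -> : f' (a1 + a2) = f' a1 + f' a2.
    by apply: (can_inj fK); rewrite linearD !f'K.
  exact: unit_spanD.
have -> : f' (k *: e x y) = k *: f' (e x y).
  by apply: (can_inj fK); rewrite linearZ /= !f'K.
exact: unit_span_unit.
Qed.

End MatrixUnitsIso.

Section DirectSumUnits.
Variables (K : fieldType) (I : countType) (n : I -> option nat).
Local Notation B := (dsum (fun i => mx_alg K (n i))).

Definition dsum_idx : countType := {i : I & mxidx (n i)}.
Definition dsum_pos (i : I) (s : mxidx (n i)) : dsum_idx :=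
  existT (fun i => mxidx (n i) : Type) i s.

Lemma dsum_pos_inj i : injective (@dsum_pos i).
Proof. by move=> s t /eqP; rewrite eq_Tagged => /eqP. Qed.

Lemma dsum_ex (E : forall i, mxidx (n i) -> mxidx (n i) -> K)
    (l : seq dsum_idx) :
  (forall i s t, (dsum_pos s \notin l) || (dsum_pos t \notin l) ->
    E i s t = 0) ->
  exists F : B, forall i s t, ent (F i) s t = E i s t.
Proof.
move=> hE.
have sub i : exists l' : seq (mxidx (n i)),
    forall s : mxidx (n i), dsum_pos s \in l -> s \in l'.
  elim: l {hE} => [|x l [l' h]]; first by exists [::].
  have [[s sx]|ns] := pselect (exists s : mxidx (n i), dsum_pos s = x).
    exists (s :: l') => t; rewrite !inE => /orP[|/h ->]; last by rewrite orbT.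
    by rewrite -sx (inj_eq (@dsum_pos_inj i)) => ->.
  exists l' => t; rewrite !inE => /orP[/eqP tx|/h //].
  by case: ns; exists t.
have mat i : exists M : mx_alg K (n i), forall s t, ent M s t = E i s t.
  have [l' h] := sub i; apply: (@ent_ex _ _ _ l') => s t st; apply: hE.
  by case/orP: st => /(contra (h _)) ->; rewrite ?orbT.
pose M i := projT1 (cid (mat i)).
have ME i s t : ent (M i) s t = E i s t by rewrite /M; case: cid.
have fin : finite_set [set i | M i != 0]%classic.
  apply: (@sub_finite_set _ _ [set` [seq tag x | x <- l]]%classic); last first.
    exact: finite_seq.
  move=> i /= /eqP Mi; apply: contrapT => il; apply: Mi; apply: ent_inj => s t.
  rewrite ent0 ME hE //; apply/orP; left; apply/negP => sl; apply: il.
  by apply/mapP; exists (dsum_pos s).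
by exists (DSum fin).
Qed.

Lemma dsum_unit_ex (x y : dsum_idx) : exists F : B, forall i s t,
  ent (F i) s t = ((dsum_pos s == x) && (dsum_pos t == y))%:R.
Proof.
apply: (@dsum_ex (fun i s t => ((dsum_pos s == x) && (dsum_pos t == y))%:R)
  [:: x; y]) => i s t; rewrite !inE !negb_or.
by case/orP => /andP[/negPf h1 /negPf h2]; rewrite ?h1 ?h2 ?andbF.
Qed.

Definition dsum_unit x y : B := projT1 (cid (dsum_unit_ex x y)).

Lemma dsum_unitE x y i s t :
  ent (dsum_unit x y i) s t = ((dsum_pos s == x) && (dsum_pos t == y))%:R.
Proof. by rewrite /dsum_unit; case: cid. Qed.

Lemma dsum_ent_inj (F G : B) :
  (forall i s t, ent (F i) s t = ent (G i) s t) -> F = G.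
Proof. by move=> FG; apply: dsumP => i; exact: ent_inj. Qed.

Lemma dsum_sumE (J : Type) (r : seq J) (F : J -> B) i :
  (\sum_(j <- r) F j) i = \sum_(j <- r) F j i.
Proof. exact: (big_morph (fun G : B => G i)). Qed.

Lemma dsum_pos_neq i j (s : mxidx (n i)) (t : mxidx (n j)) : i != j ->
  (dsum_pos s == dsum_pos t) = false.
Proof. by move=> ij; apply: contraNF ij => /eqP/(congr1 (@tag I _)) /= ->. Qed.

Lemma dsum_matrix_units : matrix_units (@tag I _) dsum_unit.
Proof.
have unitE i (s t : mxidx (n i)) j (u v : mxidx (n j)) :
    ent (dsum_unit (dsum_pos s) (dsum_pos t) j) u v =
    if i == j then ((dsum_pos u == dsum_pos s) && (dsum_pos v == dsum_pos t))%:R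
    else 0.
  rewrite dsum_unitE; have [//|ij] := eqVneq i j.
  by rewrite dsum_pos_neq // eq_sym.
split=> [[i s] [j t] [i' s'] [j' t'] /= ij ij'|[i s]|F].
- case: j / ij t => t; case: j' / ij' t' => t'.
  apply: dsum_ent_inj => j u v.
  rewrite -[LHS]/(ent (nmul (dsum_unit (dsum_pos s) (dsum_pos t) j)
    (dsum_unit (dsum_pos s') (dsum_pos t') j)) u v).
  have [ij|ij] := eqVneq i j; last first.
    rewrite (@entM _ _ _ _ [::]) // ?big_nil => [|r _].
      case: ifP => _; last by rewrite ent0.
      by rewrite dsum_unitE (dsum_pos_neq u s) // eq_sym.
    by rewrite unitE (negPf ij) mul0r.
  case: _ / ij u v => u v.
  (* Only the column index [t] of the left unit can contribute as intermediate index. *)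
  rewrite (@entM _ _ _ _ [:: t]) // ?big_seq1 => [|r]; last first.
    rewrite inE -(inj_eq (@dsum_pos_inj i)) unitE eqxx => /negPf ->.
    by rewrite andbF mul0r.
  rewrite !dsum_unitE eqxx andbT.
  set b := (X in if X then _ else _).
  have -> : b = (dsum_pos t == dsum_pos s') by [].
  case: (dsum_pos t == dsum_pos s'); last by rewrite mulr0 ent0.
  by rewrite dsum_unitE -natrM mulnb.
- apply/eqP => /(congr1 (fun F : B => ent (F i) s s)) /eqP.
  by rewrite dsum_unitE !eqxx ent0 oner_eq0.
have fin := dsum_supp F; pose li := fset_set [set i | F i != 0]%classic.
have liP i : i \notin li -> F i = 0.
  by rewrite in_fset_set // => /negP h; apply/eqP/negPn/negP => Fi;
     apply: h; apply: mem_set.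
have [l lP] : {l : forall i, seq (mxidx (n i)) & forall i, uniq (l i) /\
    forall s t, (s \notin l i) || (t \notin l i) -> ent (F i) s t = 0}.
  exists (fun i => projT1 (cid (ent_supp (F i)))) => i.
  by case: cid.
suff -> : F = \sum_(i <- li) \sum_(s <- l i) \sum_(t <- l i)
    ent (F i) s t *: dsum_unit (dsum_pos s) (dsum_pos t).
  do 3!apply: unit_span_sum => ?; exact: unit_span_unit.
apply: dsum_ent_inj => j u v; rewrite dsum_sumE ent_sum.
have termE i : ent ((\sum_(s <- l i) \sum_(t <- l i) ent (F i) s t *:
    dsum_unit (dsum_pos s) (dsum_pos t)) j) u v =
    \sum_(s <- l i) \sum_(t <- l i) ent (F i) s t *
      ent (dsum_unit (dsum_pos s) (dsum_pos t) j) u v.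
  rewrite dsum_sumE ent_sum; apply: eq_bigr => s _.
  rewrite dsum_sumE ent_sum; apply: eq_bigr => t _.
  by rewrite -entZ.
under eq_bigr do rewrite termE.
have out i : i != j -> \sum_(s <- l i) \sum_(t <- l i) ent (F i) s t *
      ent (dsum_unit (dsum_pos s) (dsum_pos t) j) u v = 0.
  move=> /negPf ij; rewrite big1 // => s _; rewrite big1 // => t _.
  by rewrite unitE ij mulr0.
have [jli|jli] := boolP (j \in li); last first.
  rewrite liP // ent0 big1_seq // => i /andP[_ ili]; apply: out.
  by apply: contraNneq jli => <-.
rewrite (bigD1_seq j) ?fset_uniq //= [X in _ + X]big1 ?addr0 => [|i /out //].
have [ul supp] := lP j.
have [uv|] := boolP ((u \notin l j) || (v \notin l j)).
  rewrite supp // big1_seq // => s /andP[_ sl].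
  rewrite big1_seq // => t /andP[_ tl].
  rewrite unitE eqxx !(inj_eq (@dsum_pos_inj j)).
  case: eqP => [us|_]; last by rewrite mulr0.
  case: eqP => [vt|_]; last by rewrite mulr0.
  by rewrite us vt sl tl in uv.
rewrite negb_or !negbK => /andP[ulj vlj].
rewrite (bigD1_seq u) //= [X in _ + X]big1 ?addr0 => [|s /negPf su].
  rewrite (bigD1_seq v) //= [X in _ + X]big1 ?addr0 => [|t /negPf tv].
    by rewrite unitE !eqxx mulr1.
  by rewrite unitE eqxx !(inj_eq (@dsum_pos_inj j)) [v == t]eq_sym tv andbF mulr0.
rewrite big1 // => t _.
by rewrite unitE eqxx !(inj_eq (@dsum_pos_inj j)) [u == s]eq_sym su mulr0.
Qed.

End DirectSumUnits.

Section Blocks.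
Variables (X : countType) (T : Type) (c : X -> T).

Definition same_block (x : X) : pred X := fun y => `[< c y = c x >].

Fact same_block_ex x : exists y, same_block x y.
Proof. by exists x; apply/asboolP. Qed.

Definition block_rep x : X := xchoose (same_block_ex x).

Lemma block_repP x : c (block_rep x) = c x.
Proof. by have /asboolP := xchooseP (same_block_ex x). Qed.

Lemma block_rep_eq x y : c x = c y -> block_rep x = block_rep y.
Proof. by move=> xy; apply: eq_xchoose => z; rewrite /same_block xy. Qed.

(** [T] is a bare type. Canonical representatives make the set of blocks a subtype of [X], hence
    countable. *)
Definition blocks : countType := {x : X | x == block_rep x}.

Definition block (x : X) : blocks :=
  exist (fun x => x == block_rep x) (block_rep x)
    (introT eqP (esym (block_rep_eq (block_repP x)))).

Lemma block_val x : c (val (block x)) = c x.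
Proof. exact: block_repP. Qed.

Lemma blocks_inj (i j : blocks) : c (val i) = c (val j) -> i = j.
Proof.
move=> /block_rep_eq ij; apply: val_inj.
by rewrite (eqP (valP i)) ij -(eqP (valP j)).
Qed.

End Blocks.

Section DirectSumDecomposition.
Variables (K : fieldType) (A : nuAlgType K) (X : countType) (T : Type).
Variables (c : X -> T) (e : X -> X -> A).
Hypothesis mu : matrix_units c e.

Lemma matrix_units_dsum : exists (I : countType) (n : I -> option nat),
  alg_iso A (dsum (fun i => mx_alg K (n i))).
Proof.
have en_ex (i : blocks c) : exists p : {o : option nat & mxidx o -> X},
    injective (projT2 p) /\
    forall x, c x = c (val i) <-> exists s, projT2 p s = x.
  have [o [f fP]] := enum_set [set x | c x = c (val i)]%classic.
  by exists (existT _ o f).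
have [p pP] := choice en_ex; pose n i := projT1 (p i).
pose en i : mxidx (n i) -> X := projT2 (p i).
have en_inj i : injective (en i) := (pP i).1.
have enP i x : c x = c (val i) <-> exists s, en i s = x := (pP i).2 x.
have c_en i s : c (en i s) = c (val i) by apply/enP; exists s.
pose h' (q : dsum_idx n) : X := en (tag q) (tagged q).
have h'_inj : injective h'.
  move=> [i s] [j t]; rewrite /h' /= => st.
  have ij : i = j by apply: blocks_inj; rewrite -(c_en i s) -(c_en j t) st.
  by case: j / ij t st => t /en_inj ->.
have h_ex x : exists q, h' q = x.
  have [s sx] : exists s, en (block c x) s = x by apply/enP; rewrite block_val.
  by exists (existT _ (block c x) s).
have [h hP] := choice h_ex.
exists (blocks c), n.
apply: (@matrix_units_iso _ _ _ _ _ _ _ _ _ _ _ h h' mu (dsum_matrix_units K n)).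
- exact: hP.
- by move=> q; apply: h'_inj; rewrite hP.
move=> x y; rewrite -{1}(hP x) -{1}(hP y) /h' !c_en.
by split=> [/blocks_inj|->].
Qed.

End DirectSumDecomposition.

(** * The monoid V of an algebra with matrix units *)

Section ModuleActions.
Variables (R : nuRingType) (M : nuModType R).

Lemma act0l (m : M) : act (0 : R) m = 0.
Proof. by apply: (addrI (act 0 m)); rewrite -actDl !addr0. Qed.

Lemma actNl (x : R) (m : M) : act (- x) m = - act x m.
Proof. by apply: (addrI (act x m)); rewrite -actDl !subrr act0l. Qed.

Lemma act_suml (S : Type) (r : seq S) (f : S -> R) (m : M) :
  act (\sum_(t <- r) f t) m = \sum_(t <- r) act (f t) m.
Proof.
exact: (big_morph (fun x => act x m) (fun x y => actDl x y m) (act0l m)).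
Qed.

Lemma act_sumr (S : Type) (r : seq S) (f : S -> M) (x : R) :
  act x (\sum_(t <- r) f t) = \sum_(t <- r) act x (f t).
Proof. exact: (big_morph (act x) (actDr x) (act0 M x)). Qed.

End ModuleActions.

Section ModulesOverMatrixUnits.
Variables (K : fieldType) (A : nuAlgType K) (X : countType) (T : Type).
Variables (c : X -> T) (e : X -> X -> A).
Hypothesis mu : matrix_units c e.
Local Notation I := (blocks c).
Implicit Types (i j : I) (J : seq I).

Definition eb i : A := e (val i) (val i).

Lemma eb_idem i : nmul (eb i) (eb i) = eb i.
Proof. exact: (munit_idem mu). Qed.

Definition simple_mod i : fgProj A := pproj (eb_idem i).

Fixpoint simples J : fgProj A :=
  if J is i :: J' then fgProj_sum (simple_mod i) (simples J') else fgProj_zero A.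

Lemma Vclass_simples J :
  Vclass (simples J) = \big[@Vadd A/@V0 A]_(i <- J) Vclass (simple_mod i).
Proof.
elim: J => [|i J IH]; first by rewrite big_nil.
by rewrite big_cons -IH /= Vadd_class.
Qed.

(* [multiplicity M i n]: the corner of [M] at block [i], a [K]-space through
   the scalar multiples of [eb i], has dimension [n]. *)
Definition multiplicity (M : nuModType A) i (n : nat) : Prop :=
  exists phi : 'rV[K]_n -> M,
    [/\ {morph phi : u v / u + v},
        forall (a : K) v, phi (a *: v) = act (a *: eb i) (phi v),
        injective phi &
        forall m, act (eb i) m = m -> exists v, phi v = m].

(** Both maps parametrise the same corner, so [f] factors through [g] by an injective linear map,
    and rank gives the bound. *)
Lemma multiplicity_le (M : nuModType A) i n p :
  multiplicity M i n -> multiplicity M i p -> (n <= p)%N.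
Proof.
move=> [f [fD fZ finj fsurj]] [g [gD gZ ginj gsurj]].
have f_fix v : act (eb i) (f v) = f v by have := fZ 1 v; rewrite !scale1r.
have [h hP] : {h : 'rV[K]_n -> 'rV[K]_p & forall v, g (h v) = f v}.
  by apply: (@choice _ _ (fun v w => g w = f v)) => v; exact/gsurj/f_fix.
have h_lin : linear h.
  by move=> a u v; apply: ginj; rewrite gD gZ !hP fD fZ.
pose hl : {linear 'rV[K]_n -> 'rV[K]_p} :=
  HB.pack h (GRing.isLinear.Build _ _ _ _ h h_lin).
suff hf : row_free (lin1_mx hl) by rewrite -(eqP hf) rank_leq_col.
apply: inj_row_free => v; rewrite mul_rV_lin1 /= => hv.
apply: finj; rewrite -hP hv; apply: esym.
by rewrite -hP; congr g; exact: (linear0 hl).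
Qed.

Lemma multiplicity_unique (M : nuModType A) i n p :
  multiplicity M i n -> multiplicity M i p -> n = p.
Proof.
move=> h1 h2; apply/eqP; rewrite eqn_leq.
by rewrite (multiplicity_le h1 h2) (multiplicity_le h2 h1).
Qed.

Lemma multiplicity_iso (M N : nuModType A) i n :
  module_iso M N -> multiplicity M i n -> multiplicity N i n.
Proof.
move=> [t [[tD tZ] [t' tK t'K]]] [f [fD fZ finj fsurj]].
exists (t \o f); split=> [u v|a v||m em] /=; rewrite ?fD ?tD ?fZ ?tZ //.
- exact: inj_comp (can_inj tK) finj.
have [|v vE] := fsurj (t' m); last by exists v; rewrite vE t'K.
by apply: (can_inj tK); rewrite tZ t'K.
Qed.

Lemma multiplicity_zero i : multiplicity zero_module i 0.
Proof.
exists (fun=> 0); split=> [u v|a v|u v _|m _].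
- by rewrite addr0.
- by rewrite act0.
- by rewrite [u]thinmx0 [v]thinmx0.
by exists 0; rewrite [m]zero_moduleP.
Qed.

Lemma multiplicity_sum (M N : nuModType A) i n p :
  multiplicity M i n -> multiplicity N i p -> multiplicity (M * N)%type i (n + p).
Proof.
move=> [f [fD fZ finj fsurj]] [g [gD gZ ginj gsurj]].
exists (fun v => (f (lsubmx v), g (rsubmx v))); split.
- by move=> u v; rewrite !linearD fD gD.
- by move=> a v; rewrite !linearZ /= fZ gZ.
- move=> u v [/finj e1 /ginj e2].
  by rewrite -[u]hsubmxK -[v]hsubmxK e1 e2.
move=> [m m']; rewrite /act /= /prod_act /= => -[/fsurj[u <-] /gsurj[v <-]].
by exists (row_mx u v); rewrite row_mxKl row_mxKr.
Qed.

(** The corner of [A (eb j)] at [i] is the line of multiples of [eb j] if [i = j]; otherwise the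
    blocks differ and it vanishes. *)
Lemma multiplicity_simple i j : multiplicity (simple_mod j) i (j == i).
Proof.
have [<-|ij] := eqVneq j i.
  have fE (v : 'rV[K]_1) : nmul (v 0 0 *: eb j) (eb j) = v 0 0 *: eb j.
    by rewrite -nscaleAl eb_idem.
  exists (fun v => Pmod (fE v)); split.
  - by move=> u v; apply: val_inj; rewrite /= mxE scalerDl.
  - move=> a v; apply: val_inj; rewrite /= mxE.
    by rewrite -nscaleAl -nscaleAr eb_idem scalerA.
  - move=> u v /(congr1 val) /= /eqP; rewrite -subr_eq0 -scalerBl scaler_eq0.
    rewrite (negPf (munit_neq0 mu _)) orbF subr_eq0 => /eqP uv.
    by apply/rowP => k; rewrite ord1.
  move=> m em; have [k kE] := munit_corner mu (val m) (erefl (c (val j))).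
  exists (k%:M); apply: val_inj; rewrite /= !mxE eqxx mulr1n -kE.
  by rewrite -nmulA -/(eb j) (pmod_fix m) -[LHS]/(val (act (eb j) m)) em.
exists (fun=> 0); split=> [u v|a v|u v _|m em].
- by rewrite addr0.
- by rewrite act0.
- by rewrite [u]thinmx0 [v]thinmx0.
exists 0; apply: val_inj; rewrite /= -em [RHS]/= -(pmod_fix m).
rewrite nmulA (munit_corner0 mu) // => h; case/eqP: ij.
by apply: blocks_inj; rewrite h.
Qed.

Lemma multiplicity_simples J i : multiplicity (simples J) i (count_mem i J).
Proof.
elim: J => [|j J IH] /=; first exact: multiplicity_zero.
by apply: multiplicity_sum => //; exact: multiplicity_simple.
Qed.

Lemma simples_inj J J' :
  Vclass (simples J) = Vclass (simples J') -> perm_eq J J'.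
Proof.
move=> /Vclass_eq JJ'; apply/allP => i _; apply/eqP.
exact: multiplicity_unique (multiplicity_iso JJ' (multiplicity_simples J i))
  (multiplicity_simples J' i).
Qed.

(** A greedy basis: a vector [m] already in the image is skipped, any other adds a summand
    [A (eb i)] mapped onto the multiples of [m]. Injectivity survives because, by
    [munit_transitive], a nonzero multiple of [m] in the old image would bring [m] itself into
    it. *)
Lemma simples_embed (M : nuModType A) (L : seq (I * M)) :
  (forall p, p \in L -> act (eb p.1) p.2 = p.2) ->
  exists J (psi : simples J -> M), [/\ module_hom psi, injective psi &
    forall p, p \in L -> exists q, psi q = p.2].
Proof.
elim: L => [_|[i m] L IH hL].
  exists [::], (fun=> 0); split=> //.
    by split=> [u v|x u]; rewrite ?addr0 ?act0.
  by move=> u v _; rewrite [u]zero_moduleP [v]zero_moduleP.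
have [|J [psi [hpsi psi_inj psiL]]] := IH.
  by move=> p pL; apply: hL; rewrite inE pL orbT.
have [psiD psiZ] := hpsi.
have em : act (eb i) m = m by apply: (hL (i, m)); rewrite inE eqxx.
have [[q qm]|nm] := pselect (exists q, psi q = m).
  exists J, psi; split=> // p; rewrite inE => /orP[/eqP ->|/psiL //].
  by exists q.
exists (i :: J), (fun u : simple_mod i * simples J => act (val u.1) m + psi u.2).
have psi0 : psi 0 = 0 by exact: hom0.
split.
- split=> [u v|x u]; first by rewrite psiD pmod_addE actDl addrACA.
  by rewrite actDr actA psiZ.
- move=> u v uv.
  have : act (val (u.1 - v.1)) m = psi (v.2 - u.2).
    have psiN w : psi (- w) = - psi w.
      by apply: (addrI (psi w)); rewrite -psiD !subrr.
    have valB : val (u.1 - v.1) = val u.1 - val v.1 by [].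
    rewrite valB actDl actNl psiD psiN.
    apply: (addIr (act (val v.1) m)); rewrite subrK.
    by apply: (addIr (psi u.2)); rewrite uv addrAC subrK addrC.
  have [uv1|uv1] := eqVneq (val (u.1 - v.1)) 0.
    move=> _; have e1 : u.1 = v.1.
      by apply/eqP; rewrite -subr_eq0; apply/eqP/val_inj.
    case: u v uv {uv1} e1 => [u1 u2] [v1 v2] /= uv e1.
    by move: uv; rewrite e1 => /addrI/psi_inj ->.
  have [b bE] := munit_transitive mu uv1 (pmod_fix _).
  move=> /(congr1 (act b)); rewrite actA bE em -psiZ => h.
  by case: nm; exists (act b (v.2 - u.2)).
move=> p; rewrite inE => /orP[/eqP -> /=|/psiL[q <-]].
  by exists (pmod_gen (eb_idem i), 0); rewrite psi0 addr0.
by exists (0, q); rewrite /= act0l add0r.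
Qed.

Lemma module_local_unit (M : nuModType A) (m : M) : unital_module M ->
  exists s : seq X, act (unit_sum e s) m = m.
Proof.
move=> uM; have [r ->] := uM m.
suff [s hs] : exists s : seq X, forall t : seq X, uniq t -> {subset s <= t} ->
    forall p, p \in r -> nmul (unit_sum e t) p.1 = p.1.
  exists (undup s).
  rewrite act_sumr; apply: eq_big_seq => p pr.
  by rewrite actA (hs (undup s)) ?undup_uniq // => x; rewrite mem_undup.
elim: r => [|p r [s hs]]; first by exists [::].
have [s' hs'] := munit_local_unit mu p.1; exists (s' ++ s) => t ut sub q.
rewrite inE => /orP[/eqP ->|qr].
  by have [|//] := hs' t ut; move=> x xs; apply: sub; rewrite mem_cat xs.
by apply: hs => // x xs; apply: sub; rewrite mem_cat xs orbT.
Qed.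

Lemma fgProj_simples (M : fgProj A) : exists J, Vclass M = Vclass (simples J).
Proof.
have uM := fgproj_unital M; have [n [x xP]] := fgproj_fg M.
have [s sP] : {s : 'I_n -> seq X & forall k, act (unit_sum e (s k)) (x k) = x k}.
  apply: (@choice _ _ (fun k s => act (unit_sum e s) (x k) = x k)) => k.
  exact: module_local_unit.
(* [e y y] applied to [x k] is moved to the representative of the block of [y], where
   [simples_embed] applies; the unit in the opposite direction brings it back. *)
pose gen k y : I * M := (block c y, act (e (val (block c y)) y) (x k)).
pose L := [seq gen k y | k <- enum 'I_n, y <- s k].
have [|J [psi [hpsi psi_inj psiL]]] := @simples_embed M L.
  move=> _ /allpairsPdep[k [y [_ _ ->]]] /=; rewrite actA.
  by rewrite (munitMM mu) ?block_val.
have [psiD psiZ] := hpsi; have psi0 := hom0 hpsi.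
have psi_sum (S : eqType) (r : seq S) (g : S -> M) :
    (forall t, t \in r -> exists q, psi q = g t) ->
    exists q, psi q = \sum_(t <- r) g t.
  elim: r => [|t r IH] hg; first by exists 0; rewrite big_nil.
  have [|q qE] := IH; first by move=> u ur; apply: hg; rewrite inE ur orbT.
  have [|q' q'E] := hg t; first by rewrite inE eqxx.
  by exists (q' + q); rewrite psiD big_cons qE q'E.
have psi_surj m : exists q, psi q = m.
  have [a ->] := xP m; apply: (psi_sum _ _ _) => k _.
  suff [q <-] : exists q, psi q = x k by exists (act (a k) q); rewrite psiZ.
  rewrite -sP act_suml; apply: psi_sum => y ys.
  have [|q qE] := psiL (gen k y).
    by apply/allpairsPdep; exists k, y; rewrite mem_enum.
  exists (act (e y (val (block c y))) q); rewrite psiZ qE /= actA.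
  by rewrite (munitMM mu) ?block_val.
have [psi' psi'K] := choice psi_surj.
exists J; apply/Vclass_eq/module_iso_sym; exists psi; split=> //.
by exists psi' => // q; apply: psi_inj; rewrite psi'K.
Qed.

End ModulesOverMatrixUnits.

(** * Free abelian monoids *)

Section FinitelySupportedFunctions.
Variable I : choiceType.
Implicit Types (h : {fsfun I -> nat with 0%N}) (s : seq I) (i : I).

Lemma fsfun_of_seq s : exists h, forall i, h i = count_mem i s.
Proof.
exists [fsfun i in [fset i in s]%fset => count_mem i s | 0%N]%fset => i.
rewrite fsfunE inE /=; case: ifP => // /negbT /count_memPn //.
Qed.

Lemma seq_of_fsfun h : exists s, forall i, h i = count_mem i s.
Proof.
have count_on (t : seq I) : uniq t -> exists s, forall i,
    count_mem i s = if i \in t then h i else 0%N.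
  elim: t => [_|x t IH /= /andP[xt /IH[s sP]]]; first by exists [::].
  exists (nseq (h x) x ++ s) => i; rewrite count_cat count_nseq sP inE /= eq_sym.
  rewrite in_cons; have [->|_] := eqVneq i x; last by rewrite mul0n.
  by rewrite (negPf xt) mul1n addn0.
have [s sP] := count_on _ (fset_uniq (finsupp h)).
by exists s => i; rewrite sP; case: ifP => // /negbT; exact: fsfun_dflt.
Qed.

End FinitelySupportedFunctions.

Section FreeMonoids.
Variables (T : Type) (zero : T) (add : Monoid.com_law zero) (I : choiceType).
Hypothesis free : iso_dsum_nat add I.

Lemma iso_dsum_nat_cancellative : cancellative_monoid add.
Proof.
move: free => [f [f0 fD [g fK gK]]] a b c ab; apply: (can_inj fK).
by apply/fsfunP => i; apply/eqP; rewrite -(eqn_add2r (f c i)) -!fD ab.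
Qed.

Lemma iso_dsum_nat_atomic : atomic_monoid add.
Proof.
move: free => [f [f0 fD [g fK gK]]] x.
have f_inj0 u : (forall i, f u i = 0%N) -> monoid_unit add u.
  move=> fu; exists zero; rewrite Monoid.mulm1; apply: (can_inj fK).
  by apply/fsfunP => i; rewrite fu f0.
(* The element that corresponds to the indicator function of [i]. *)
pose d i := g (projT1 (cid (fsfun_of_seq [:: i]))).
have dE i j : f (d i) j = (i == j).
  by rewrite /d gK; case: cid => h /= ->; rewrite addn0.
have [s sP] := seq_of_fsfun (f x).
exists (size s), (fun k => d (tnth (in_tuple s) k)); split=> [k|]; last first.
  rewrite -(big_tnth _ _ s xpredT d); apply: (can_inj fK).
  apply/fsfunP => j; rewrite sP.
  elim: (s) => [|i t IH]; first by rewrite big_nil f0.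
  by rewrite big_cons fD dE /= IH.
move=> u v /(congr1 f); set i := tnth _ _ => uv.
have uvj j : (f u j + f v j)%N = (i == j) by rewrite -fD -uv dE.
have sum0 m n : (m + n = 0)%N -> m = 0%N /\ n = 0%N.
  by move=> /eqP; rewrite addn_eq0 => /andP[/eqP -> /eqP ->].
(* The value 1 at [i] cannot be shared: whichever of [u] and [v] vanishes at [i] vanishes
   everywhere. *)
have [ui|ui] := eqVneq (f u i) 0%N; [left|right]; apply: f_inj0 => j.
  by have := uvj j; have [<-//|_ /sum0[]] := eqVneq i j.
have := uvj j; have [<-|_ /sum0[]//] := eqVneq i j.
by case: (f u i) ui => // n _; rewrite addSn => -[/sum0[]].
Qed.

End FreeMonoids.

Section MonoidOfMatrixUnits.
Variables (K : fieldType) (A : nuAlgType K) (X : countType) (T : Type).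
Variables (c : X -> T) (e : X -> X -> A).
Hypothesis mu : matrix_units c e.

(** [rel] links a class to the multiplicities of any list of simple modules that represents it. It
    is single-valued because multiplicities are isomorphism invariants, injective because permuted
    lists have the same sum in V. *)
Lemma matrix_units_iso_dsum_nat : iso_dsum_nat (@Vadd A) (blocks c).
Proof.
pose rel (C : Vmon A) (h : {fsfun blocks c -> nat with 0%N}) :=
  exists J, C = Vclass (simples mu J) /\ forall i, h i = count_mem i J.
have tot C : exists h, rel C h.
  have [M ->] := Vclass_surj C; have [J ->] := fgProj_simples mu M.
  by have [h hJ] := fsfun_of_seq J; exists h, J.
have tot' h : exists C, rel C h.
  by have [J hJ] := seq_of_fsfun h; exists (Vclass (simples mu J)), J.
have rel_fun C h h' : rel C h -> rel C h' -> h = h'.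
  move=> [J [-> hJ]] [J' [/(simples_inj) /permP JJ' hJ']].
  by apply/fsfunP => i; rewrite hJ hJ' JJ'.
have rel_inj C C' h : rel C h -> rel C' h -> C = C'.
  move=> [J [-> hJ]] [J' [-> hJ']]; rewrite !Vclass_simples.
  apply: perm_big; apply/allP => i _ /=; apply/eqP.
  by rewrite -hJ -hJ'.
have [f fP] := choice tot; have [g gP] := choice tot'.
exists f; split.
- move=> i; have r0 : rel (@V0 A) [fsfun].
    by exists [::]; split=> // j; rewrite fsfunE.
  by rewrite (rel_fun _ _ _ (fP _) r0) fsfunE.
- move=> C D i; have [J [CJ fJ]] := fP C; have [J' [DJ fJ']] := fP D.
  have [J'' [CDJ fJ'']] := fP (Vadd C D).
  rewrite fJ fJ' fJ'' -count_cat.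
  have JJ : Vclass (simples mu J'') = Vclass (simples mu (J ++ J')).
    by rewrite -CDJ CJ DJ !Vclass_simples big_cat.
  exact: (permP (simples_inj JJ)).
exists g => [C|h]; first exact: rel_inj (gP _) (fP _).
exact: rel_fun (fP _) (gP _).
Qed.

End MonoidOfMatrixUnits.

(** * Matrix units from line points *)

Section LinePoints.
Variables (k : nat) (G : kGraph k).
Hypothesis G_rf : row_finite_no_sources G.
Implicit Types (x y z w : infpath G) (l : G) (v : kvert G) (m n p q r : Nk k).

Lemma infpath_extend l : exists x, ini x (kdeg l) = l.
Proof.
have [z zl] := infpath_from G_rf (ksrc l).
by exists (prepend l z); case: (prependP (esym zl)).
Qed.

(** Both paths extend to infinite ones, which coincide; so both are the initial segment of that path
    in their common degree. *)
Lemma line_point_unique_path v l l' : line_point v -> krng l = v ->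
  krng l' = v -> kdeg l = kdeg l' -> l = l'.
Proof.
move=> [x [vx _]] lv l'v d.
have ini_l b : krng b = v -> ini x (kdeg b) = b.
  move=> bv; have [z zb] := infpath_extend b.
  suff <- : z = x by [].
  have : infpaths_from v z by rewrite /infpaths_from /= -(krng_ini z (kdeg b)) zb.
  by rewrite vx.
by rewrite -(ini_l l) // -[RHS](ini_l l') // d.
Qed.

(** Prepending [l] turns paths out of the source into paths out of the range, and a period of a tail
    is a period of the whole path. *)
Lemma line_point_src l : line_point (krng l) -> line_point (ksrc l).
Proof.
move=> [x [vx nper]]; have xl z : infpath_at z 0 = ksrc l -> z = sigma (kdeg l) x.
  move=> zl; have [_ <-] := prependP (esym zl); congr sigma.
  have : infpaths_from (krng l) (prepend l z).
    by rewrite /infpaths_from /= infpath_at_prepend.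
  by rewrite vx.
exists (sigma (kdeg l) x); split.
  apply/seteqP; split=> [z /xl //|_ ->]; have [z zl] := infpath_from G_rf (ksrc l).
  suff : infpath_at (sigma (kdeg l) x) 0 = ksrc l by [].
  by rewrite -(xl z zl).
move=> [p [q [pq e]]]; apply: nper; exists (p + kdeg l), (q + kdeg l).
split; last by rewrite -!sigma_sigma.
by rewrite ![_ + kdeg l]addrC => /addNkI.
Qed.

Lemma line_point_later x m n : leNk m n -> line_point (infpath_at x m) ->
  line_point (infpath_at x n).
Proof.
move=> mn; have := @line_point_src (x (omega_seg mn)).
by rewrite kmorph_rng kmorph_src.
Qed.

Lemma line_point_sigma v x y : line_point v -> infpath_at x 0 = v ->
  infpath_at y 0 = v -> x = y.
Proof.
move=> [z [vz _]] xv yv.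
have : infpaths_from v x by []. have : infpaths_from v y by [].
by rewrite vz => -> ->.
Qed.

Lemma line_point_aperiodic x m p q : line_point (infpath_at x m) ->
  sigma p x = sigma q x -> p = q.
Proof.
move=> [z [vz nper]] e; apply: contrapT => pq; apply: nper; exists p, q; split=> //.
suff <- : sigma m x = z by rewrite !sigma_sigma ![_ + m]addrC -!sigma_sigma e.
have : infpaths_from (infpath_at x m) (sigma m x) by exact: infpath_at_sigma0.
by rewrite vz.
Qed.

(* [tie x y p q]: beyond [x p] and [y q] the two paths are the same line. *)
Definition tie x y p q : Prop :=
  sigma p x = sigma q y /\ line_point (infpath_at x p).

Lemma tie_add x y p q n : tie x y p q -> tie x y (p + n) (q + n).
Proof.
move=> [e lp]; split; first by rewrite ![_ + n]addrC -!sigma_sigma e.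
exact: line_point_later (leNk_addr p n) lp.
Qed.

Definition same_tail x y : Prop := exists p q, sigma p x = sigma q y.

Lemma same_tail_sym x y : same_tail x y -> same_tail y x.
Proof. by move=> [p [q e]]; exists q, p. Qed.

Lemma same_tail_trans x y z : same_tail x y -> same_tail y z -> same_tail x z.
Proof.
move=> [p [q e]] [r [s e']]; exists (r + p), (q + s).
by rewrite -!sigma_sigma e sigma_sigma addrC -sigma_sigma e'.
Qed.

(** Turns tail equivalence into an equality of labels, the form in which [matrix_units] takes its
    blocks. *)
Definition tail_class x : set (infpath G) := [set y | same_tail x y]%classic.

Lemma tail_classP x y : tail_class x = tail_class y <-> same_tail x y.
Proof.
split=> [e|xy].
  by rewrite -[same_tail x y]/(tail_class x y) e; exists 0, 0.
apply/seteqP; split=> z; last exact: same_tail_trans.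
by apply: same_tail_trans; exact: same_tail_sym.
Qed.

Hypothesis lp : forall y, exists m, line_point (infpath_at y m).

Lemma tie_ex x y : same_tail x y -> exists p q, tie x y p q.
Proof.
move=> [p [q e]]; have [m xm] := lp x; exists (p + m), (q + m); split.
  by rewrite ![_ + m]addrC -!sigma_sigma e.
exact: line_point_later (leNk_addl m p) xm.
Qed.

(** A path is determined by its segment up to a line point, and there are countably many
    segments. *)
Fact infpath_code_ex : exists f : infpath G -> G, injective f.
Proof.
have [f fP] := choice lp; exists (fun y => ini y (f y)) => y z yz.
have fyz : f y = f z by rewrite -(kdeg_ini y (f y)) yz kdeg_ini.
apply: (infpath_eq (p := f y)); first by rewrite yz -fyz.
apply: (line_point_sigma (fP y)); first by rewrite infpath_at_sigma0.
by rewrite infpath_at_sigma0 -!ksrc_ini yz fyz.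
Qed.

Lemma infpath_countable : exists (X : countType) (f : X -> infpath G)
  (g : infpath G -> X), cancel f g /\ cancel g f.
Proof.
have [f finj] := infpath_code_ex.
pose g l := if pselect (exists y, f y = l) is left h
  then Some (projT1 (cid h)) else None.
have fK : pcancel f g.
  move=> y; rewrite /g; case: pselect => [h|[]]; last by exists y.
  by case: cid => z /= /finj ->.
by exists (pcan_type fK), id, id.
Qed.

End LinePoints.

Section LineUnits.
Variables (k : nat) (G : kGraph k) (K : fieldType).
Hypothesis k_gt0 : (0 < k)%N.
Hypothesis G_rf : row_finite_no_sources G.
Hypothesis lp : forall y : infpath G, exists m, line_point (infpath_at y m).
Local Notation R := (KP G K).
Local Notation F := (KP_family K G_rf).
Implicit Types (x y z w : infpath G) (l : G) (v : kvert G) (m n p q r : Nk k).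

(** At a line point the sum in (KP4) has a single term. *)
Lemma line_point_SxTx l : line_point (krng l) ->
  Sx F l ** Tx F l = KPp F (krng l).
Proof.
move=> lv; have [s [us sP ->]] := pSxTx F G_rf (krng l) (kdeg l).
have ls : l \in s by apply/sP.
rewrite (bigD1_seq l) // big1_seq => [|l' /andP[l'l /sP[h1 h2]]].
  by rewrite [RHS]addr0.
by case/eqP: l'l; exact: (line_point_unique_path G_rf lv).
Qed.

Definition corner x p y q : R := Sx F (ini x p) ** Tx F (ini y q).

(** Past [p] and [q] both paths follow the same line, where the common extra segment cancels by
    [line_point_SxTx]. *)
Lemma corner_add x y p q n : tie x y p q ->
  corner x (p + n) y (q + n) = corner x p y q.
Proof.
have xs := ini_add_src x p n; have ys := ini_add_src y q n.
move=> [e lx]; rewrite /corner !ini_add -SxM // -TxM //.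
have xr : krng (ini (sigma p x) n) = infpath_at x p.
  by rewrite krng_ini infpath_at_sigma0.
rewrite -e -!nmulA [Sx F (ini (sigma p x) n) ** _]nmulA line_point_SxTx xr //.
by rewrite -ksrc_ini nmulA Sxp.
Qed.

(** Extend the ties by [p'] and by [p]: the segments of [x] now agree, and both shifts of [y] equal
    the same shift of [x]. Aperiodicity of [y] equates their degrees. *)
Lemma corner_unique x y p q p' q' : tie x y p q -> tie x y p' q' ->
  corner x p y q = corner x p' y q'.
Proof.
move=> h h'; rewrite -(corner_add p' h) -(corner_add p h').
rewrite [p' + p]addrC; congr corner.
have [m ym] := lp y; apply: (line_point_aperiodic ym).
have [<- _] := tie_add G_rf p' h; have [<- _] := tie_add G_rf p h'.
by rewrite [p' + p]addrC.
Qed.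

Definition line_unit x y : R :=
  if pselect (exists pq : Nk k * Nk k, tie x y pq.1 pq.2) is left h
  then corner x (projT1 (cid h)).1 y (projT1 (cid h)).2 else 0.

Lemma line_unitE x y p q : tie x y p q -> line_unit x y = corner x p y q.
Proof.
move=> h; rewrite /line_unit; case: pselect => [h'|[]]; last by exists (p, q).
by case: cid => -[p' q'] /= h''; exact: corner_unique.
Qed.

Lemma corner_mul x y z w p n q :
  corner x p y n ** corner z n w q =
  if ini y n == ini z n
  then Sx F (ini x p) ** KPp F (infpath_at y n) ** Tx F (ini w q) else 0.
Proof.
rewrite /corner -!nmulA [Tx F (ini y n) ** _]nmulA TxSx ?kdeg_ini // ksrc_ini.
by case: ifP => _; rewrite ?nmul0r ?nmulr0.
Qed.

Lemma line_unitM x y z w : same_tail x y -> same_tail z w ->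
  line_unit x y ** line_unit z w = if `[< y = z >] then line_unit x w else 0.
Proof.
move=> /(tie_ex G_rf lp)[p [q xy]] /(tie_ex G_rf lp)[r [s zw]].
case: asboolP => [yz|yz].
  (* Both ties are extended until the two inner segments of [y] have the common degree [q + r]. *)
  rewrite -{}yz in zw *; have xy' := tie_add G_rf r xy; have zw' := tie_add G_rf q zw.
  have xw : tie x w (p + r) (s + q).
    split; last by case: xy'.
    by rewrite xy'.1 addrC zw'.1.
  rewrite (line_unitE xy') (line_unitE zw') (line_unitE xw).
  rewrite [r + q]addrC corner_mul eqxx.
  have -> : infpath_at y (q + r) = infpath_at x (p + r).
    by rewrite -(infpath_at_sigma0 (q + r)) -xy'.1 infpath_at_sigma0.
  by rewrite -ksrc_ini Sxp.
(* Distinct paths differ in some degree [n]; extending both ties to a common degree above [n] makes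
   the inner product vanish by (KP3). *)
have [n yzn] : exists n, ini y n <> ini z n.
  apply: contrapT => h; apply: yz; apply: ini_inj => n.
  by apply: contrapT => yzn; apply: h; exists n.
have xy' := tie_add G_rf (r + n) xy; have zw' := tie_add G_rf (q + n) zw.
rewrite (line_unitE xy') (line_unitE zw').
have -> : r + (q + n) = q + (r + n) by rewrite addrCA.
rewrite corner_mul; case: eqP => // e; case: yzn.
have nle : leNk n (q + (r + n)) by rewrite addrA leNk_addl.
by rewrite -(pre_ini y nle) e pre_ini.
Qed.

(** Sandwiched between [Tx] and [Sx] of its segment, the unit gives back a vertex idempotent. *)
Lemma line_unit_neq0 x : line_unit x x != 0.
Proof.
have [m xm] := lp x; have xx : tie x x m m by [].
rewrite (line_unitE xx) /corner; apply/eqP => e0.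
have := pp_neq0 K G_rf k_gt0 (infpath_at x m).
rewrite -ksrc_ini -(ppE F) -(TxSx_id F) -nmulA.
by rewrite [Sx F _ ** _]nmulA e0 nmul0r nmulr0 eqxx.
Qed.

Lemma line_unit_ST l l' : ksrc l = ksrc l' -> line_point (ksrc l) ->
  exists x y, same_tail x y /\ Sx F l ** Tx F l' = line_unit x y.
Proof.
move=> ll' lpl; have [z zl] := infpath_from G_rf (ksrc l).
have [h1 h2] := prependP (esym zl).
have [h3 h4] := @prependP _ _ l' z (esym (etrans zl ll')).
have xy : tie (prepend l z) (prepend l' z) (kdeg l) (kdeg l').
  by split; rewrite ?h2 ?h4 // -ksrc_ini h1.
exists (prepend l z), (prepend l' z); split.
  by exists (kdeg l), (kdeg l'); case: xy.
by rewrite (line_unitE xy) /corner h1 h3.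
Qed.

Definition line_decomposition v (s : seq G) : Prop :=
  (forall l, l \in s -> krng l = v /\ line_point (ksrc l)) /\
  KPp F v = \sum_(l <- s) Sx F l ** Tx F l.

(* Otherwise some infinite path meets only vertices without a decomposition,
   and so no line point. *)
Lemma line_decomposition_ex v : exists s, line_decomposition v s.
Proof.
apply: contrapT => nv.
have [|y [_ yP]] := infpath_choice
    (P := fun v => ~ exists s, line_decomposition v s) _ nv.
  move=> u nu; apply: contrapT => nl; apply: nu.
  have [s [us sP sE]] := pSxTx F G_rf u (ones k).
  have [t tP] : {t : G -> seq G & forall l, l \in s ->
      line_decomposition (ksrc l) (t l)}.
    apply: (@choice _ _ (fun l t => l \in s -> line_decomposition (ksrc l) t)).
    move=> l; have [ls|ls] := boolP (l \in s); last by exists [::].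
    have [lu ld] := (sP l).1 ls.
    have [t tP] : exists t, line_decomposition (ksrc l) t.
      by apply: contrapT => nt; apply: nl; exists l.
    by exists t.
  exists [seq kcomp l l' | l <- s, l' <- t l]; split.
    move=> _ /allpairsPdep[l [l' [ls l't ->]]].
    have [lu _] := (sP l).1 ls; have [hl _] := tP l ls; have [h1 h2] := hl l' l't.
    by rewrite krng_comp // ksrc_comp.
  rewrite sE big_allpairs_dep; apply: eq_big_seq => l ls.
  have [hl hE] := tP l ls; rewrite -(Sxp F l) -nmulA hE nmul_suml nmul_sumr.
  apply: eq_big_seq => l' l't; have [h1 _] := hl l' l't.
  by rewrite -SxM // -TxM // !nmulA.
have [m ym] := lp y; have [n mn] := yP m; case.
exists [:: kid (infpath_at y n)]; split=> [l|].
  rewrite inE => /eqP ->; rewrite krng_id ksrc_id; split=> //.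
  exact (line_point_later G_rf mn ym).
by rewrite big_seq1 Sx0 ?Tx0 ?kdeg_id // krng_id ppE.
Qed.

Lemma KP_matrix_units : exists (X : countType) (T : Type) (c : X -> T)
  (e : X -> X -> R), matrix_units c e.
Proof.
have [X [f [g [fK gK]]]] := infpath_countable lp.
exists X, (set (infpath G)), (fun a => tail_class (f a)),
  (fun a b => line_unit (f a) (f b)).
set c := (fun a => tail_class (f a)); set e := (fun a b => line_unit (f a) (f b)).
have rule : unit_rule c e.
  move=> a b a' b' /tail_classP h /tail_classP h'.
  rewrite /e line_unitM //; congr (if _ then _ else _).
  by apply/asboolP/eqP => [/(can_inj fK)|->].
have ST l l' : ksrc l = ksrc l' -> line_point (ksrc l) ->
    unit_span c e (Sx F l ** Tx F l').
  move=> ll' lpl; have [x [y [xy ->]]] := line_unit_ST ll' lpl.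
  have := @unit_span_unit _ _ _ _ c e 1 (g x) (g y).
  by rewrite scale1r /e /c !gK; apply; apply/tail_classP.
(* Expanding the idempotent at the source of [l] makes [Sx F l] a sum of terms [s_(l l') s_l'^*] in
   which [l'] ends at a line point. *)
have SP l : unit_span c e (Sx F l).
  have [s [sl sE]] := line_decomposition_ex (ksrc l).
  rewrite -Sxp sE nmul_sumr big_seq; apply: big_rec => [|l' a]; first exact: Span0.
  move=> /sl[h1 h2]; apply: unit_spanD.
  by rewrite nmulA SxM //; apply: ST; rewrite ksrc_comp.
have TP l : unit_span c e (Tx F l).
  have [s [sl sE]] := line_decomposition_ex (ksrc l).
  rewrite -pTx sE nmul_suml big_seq; apply: big_rec => [|l' a]; first exact: Span0.
  move=> /sl[h1 h2]; apply: unit_spanD.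
  by rewrite -nmulA TxM //; apply: ST; rewrite // ksrc_comp.
split=> [//|a|a]; first exact: line_unit_neq0.
elim/KP_ind: a => [v|l|l||a b|a|k' a|a b].
- have := SP (kid v); rewrite Sx0 ?kdeg_id // krng_id; exact.
- by have := SP (val l); rewrite Sx_val.
- by have := TP (val l); rewrite Tx_val.
- exact: Span0.
- exact: unit_spanD.
- by rewrite -scaleN1r; exact: unit_spanZ.
- exact: unit_spanZ.
- exact: unit_spanM.
Qed.

End LineUnits.

(** * The cycle of implications *)

Lemma dsum_to_matrix_units (K : fieldType) (A : nuAlgType K) (I : countType)
    (n : I -> option nat) : alg_iso A (dsum (fun i => mx_alg K (n i))) ->
  exists (X : countType) (T : Type) (c : X -> T) (e : X -> X -> A),
    matrix_units c e.
Proof.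
move=> /matrix_units_transport/(_ (dsum_matrix_units K n))[e mu].
by exists (dsum_idx n), I, (@tag I _), e.
Qed.

Theorem theorem4p3 (k : nat) (hk : (0 < k)%N) (Lambda : kGraph k) (K : fieldType)
    (hLambda : row_finite_no_sources Lambda) :
  [<->
    semisimple (KP Lambda K);
    exists (I : countType) (n : I -> option nat),
      alg_iso (KP Lambda K) (dsum (fun i => mx_alg K (n i)));
    (exists (I : countType) (n : I -> option nat),
       iso_dsum_nat (@Vadd (KP Lambda K)) I) /\
    von_neumann_regular (KP Lambda K);
    [/\ cancellative_monoid (@Vadd (KP Lambda K)),
        atomic_monoid (@Vadd (KP Lambda K)) &
        von_neumann_regular (KP Lambda K)];
    forall y : infpath Lambda, exists m : Nk k, line_point (infpath_at y m)].
Proof.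
tfae.
- move=> [_ soc]; have lp := socle_line_point hLambda hk soc.
  have [X [T [c [e mu]]]] := KP_matrix_units K hk hLambda lp.
  exact: matrix_units_dsum mu.
- move=> [I [n /dsum_to_matrix_units[X [T [c [e mu]]]]]].
  split; last exact: munit_regular mu.
  by exists (blocks c), (fun=> None); exact: matrix_units_iso_dsum_nat mu.
- move=> [[I [_ free]] reg]; split=> //.
    exact: iso_dsum_nat_cancellative free.
  exact: iso_dsum_nat_atomic free.
- move=> [_ at_V reg]; apply: (socle_line_point hLambda hk).
  exact: KP_atomic_socle.
move=> lp; have [X [T [c [e mu]]]] := KP_matrix_units K hk hLambda lp.
exact: munit_semisimple mu.
Qed.
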